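(* Let $L$ be an operator of affine type on $M_+(E)$ with functions $F$ and $R$. Suppose an $M_+(E^\Delta)$-valued solution $(X_t)_{t\ge0}$ to the martingale problem for $L$ exists, on a filtered probability space $(\Omega,\mathcal F,(\mathcal F_t),\mathbb P)$. Let $g\in D_-$ and assume there is a function $t\mapsto\psi_t$ on $[0,T]$ with values in $D_-$ solving $\partial_t\psi_t=R(\psi_t)$, $\psi_0=g$, in the sense that $\langle\psi_t,\nu\rangle=\langle g,\nu\rangle+\int_0^t\langle R(\psi_s),\nu\rangle ds$ for all $\nu\in M_+(E^\Delta)$ and $t\in(0,T]$. Define $\phi_t=\int_0^tF(\psi_s)ds$ and suppose it takes values in $\mathbb R_-$. Then for all $0\le t\le T$, almost surely, \[\mathbb E[\exp(\langle g,X_T\rangle)\mid\mathcal F_t]=\exp(\phi_{T-t}+\langle\psi_{T-t},X_t\rangle).\]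
   Context: $E$ locally compact Polish, $E^\Delta$ one-point compactification; $M(E)$, $M_+(E)$, $M_+(E^\Delta)$ finite signed/non-negative measures with weak topology. $C_\Delta(E)=\{f|_E:f\in C(E^\Delta)\}$; $D\subseteq C_\Delta(E)$ dense linear subspace containing $1$; $D_-=\{g\in D:g\le0\}$. $\langle g,\nu\rangle=\int g\,d\nu$. $\mathcal D$ is the linear span of maps $\nu\mapsto\phi(\langle g_1,\nu\rangle,\dots,\langle g_m,\nu\rangle)$, $g_i\in D$, $\phi$ a polynomial or in $C_0^\infty(\mathbb R^m)$. A linear $L$ on $\mathcal D$ (with values in measurable maps on $M(E)$) is of affine type on $M_+(E)$ if there exist $F:D\to\mathbb R$, $R:D\to C_\Delta(E)$ with $L\exp(\langle g,\cdot\rangle)(\nu)=(F(g)+\langle R(g),\nu\rangle)\exp(\langle g,\nu\rangle)$ for all $g\in D_-$, $\nu\in M_+(E)$. An $M_+(E^\Delta)$-valued solution of the martingale problem for $L$ is a càdlàg $M_+(E^\Delta)$-valued adapted process with deterministic $X_0$ such that $f(X_t)-f(X_0)-\int_0^tLf(X_s)ds$ is a local martingale for all $f$ in the domain of $L$ (functions evaluated on $M_+(E^\Delta)$ by the same formulas). *)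

(* Defs.v *)
From HB Require Import structures.
From mathcomp Require Import all_boot all_order all_algebra.
From mathcomp Require Import all_classical all_reals all_analysis.
Set Implicit Arguments.
Unset Strict Implicit.
Unset Printing Implicit Defensive.
Import Order.TTheory GRing.Theory Num.Def Num.Theory.
Import numFieldNormedType.Exports.
Local Open Scope classical_set_scope.
Local Open Scope ring_scope.

(* The compactified state space.  K plays the role of E^Delta: a compact,   *)
(* Hausdorff (pseudo)metric space, with a distinguished point Delta; the    *)

Definition compact_metric_space (R : realType) (K : pseudoPMetricType R) : Prop :=
  hausdorff_space K /\ compact [set: K].

Definition Kborel (R : realType) (K : pseudoPMetricType R) :=
  g_sigma_algebraType (@open K).

Definition Mplus (R : realType) (K : pseudoPMetricType R) :=
  {finite_measure set (Kborel K) -> \bar R}.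

Definition in_MplusE (R : realType) (K : pseudoPMetricType R) (Delta : K)
  (nu : Mplus K) : Prop := nu [set Delta] = 0%E.

Definition pair (R : realType) (K : pseudoPMetricType R) (h : K -> R)
  (nu : Mplus K) : R :=
  fine (\int[nu]_(x in [set: Kborel K]) (h x)%:E)%E.

(* C_Delta(E) (identified with C(E^Delta)) *)
Definition CDelta (R : realType) (K : pseudoPMetricType R) : set (K -> R) :=
  [set h | continuous h].
Arguments CDelta {R} K.

Definition admissible_D (R : realType) (K : pseudoPMetricType R)
  (D : set (K -> R)) : Prop :=
  [/\ D `<=` CDelta K,
      D (fun _ => 1),
      (forall (a : R) g h, D g -> D h -> D (fun x => a * g x + h x)) &
      (forall f, CDelta K f -> forall eps : R, 0 < eps ->
          exists2 g, D g & forall x, `|f x - g x| < eps)].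

Definition Dminus (R : realType) (K : pseudoPMetricType R)
  (D : set (K -> R)) : set (K -> R) :=
  [set g | D g /\ forall x, g x <= 0].

Inductive polyfun (R : realType) (m : nat) : ('rV[R]_m -> R) -> Prop :=
| PF_const (c : R) : polyfun (fun _ => c)
| PF_coord (i : 'I_m) : polyfun (fun x => x ord0 i)
| PF_add p q : polyfun p -> polyfun q -> polyfun (fun x => p x + q x)
| PF_mul p q : polyfun p -> polyfun q -> polyfun (fun x => p x * q x).

Fixpoint iterD (R : realType) (m : nat) (vs : seq 'rV[R]_m)
  (phi : 'rV[R]_m -> R) : 'rV[R]_m -> R :=
  match vs with
  | [::] => phi
  | v :: vs' => iterD vs' ('D_v phi)
  end.

Definition smooth (R : realType) (m : nat) (phi : 'rV[R]_m -> R) : Prop :=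
  forall vs : seq 'rV[R]_m,
    continuous (iterD vs phi) /\ forall v x, derivable (iterD vs phi) x v.

Definition C0infty (R : realType) (m : nat) (phi : 'rV[R]_m -> R) : Prop :=
  smooth phi /\ compact (closure [set x | phi x != 0]).

Definition cylinder (R : realType) (K : pseudoPMetricType R)
  (D : set (K -> R)) (f : Mplus K -> R) : Prop :=
  exists (m : nat) (phi : 'rV[R]_m -> R) (gs : 'I_m -> K -> R),
    [/\ forall i, D (gs i),
        polyfun phi \/ C0infty phi &
        forall nu, f nu = phi (\row_i pair (gs i) nu)].

Inductive calD (R : realType) (K : pseudoPMetricType R)
  (D : set (K -> R)) : (Mplus K -> R) -> Prop :=
| calD_zero : calD D (fun _ => 0)
| calD_comb (a : R) f h : cylinder D f -> calD D h ->
    calD D (fun nu => a * f nu + h nu).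

Definition expf (R : realType) (K : pseudoPMetricType R) (g : K -> R)
  (nu : Mplus K) : R := expR (pair g nu).

(* Borel sigma-algebra of the weak topology on M_+(E^Delta): generated by   *)
(* the maps nu |-> <h, nu>, h continuous.                                   *)
Definition weak_generators (R : realType) (K : pseudoPMetricType R)
  : set (set (Mplus K)) :=
  [set A | exists (h : K -> R) (B : set R),
      [/\ continuous h, measurable B & A = (pair h) @^-1` B]].
Arguments weak_generators {R} K.

Definition measurable_on_measures (R : realType) (K : pseudoPMetricType R)
  (f : Mplus K -> R) : Prop :=
  forall B : set R, measurable B ->
    <<s weak_generators K >> (f @^-1` B).

Definition linear_operator (R : realType) (K : pseudoPMetricType R)
  (D : set (K -> R)) (L : (Mplus K -> R) -> (Mplus K -> R)) : Prop :=
  (forall f, calD D f -> measurable_on_measures (L f)) /\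
  (forall (a : R) f h, calD D f -> calD D h ->
     L (fun nu => a * f nu + h nu) = (fun nu => a * L f nu + L h nu)).

Definition affine_type (R : realType) (K : pseudoPMetricType R) (Delta : K)
  (D : set (K -> R)) (L : (Mplus K -> R) -> (Mplus K -> R))
  (F : (K -> R) -> R) (Rop : (K -> R) -> (K -> R)) : Prop :=
  (forall g, D g -> CDelta K (Rop g)) /\
  (forall g, Dminus D g -> forall nu : Mplus K, in_MplusE Delta nu ->
     L (expf g) nu = (F g + pair (Rop g) nu) * expf g nu).

(* Convention of the M_+(E^Delta)-valued martingale problem: the function  *)
(* L exp<g,.> is evaluated on M_+(E^Delta) "by the same formula", i.e. the  *)
(* affine formula also gives its values at measures charging Delta.        *)
Definition affine_formula_on_MplusEDelta (R : realType) (K : pseudoPMetricType R)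
  (D : set (K -> R)) (L : (Mplus K -> R) -> (Mplus K -> R))
  (F : (K -> R) -> R) (Rop : (K -> R) -> (K -> R)) : Prop :=
  forall g, Dminus D g -> forall nu : Mplus K,
     L (expf g) nu = (F g + pair (Rop g) nu) * expf g nu.

Definition domL (R : realType) (K : pseudoPMetricType R)
  (D : set (K -> R)) : set (Mplus K -> R) :=
  [set f | calD D f \/ exists2 g, Dminus D g & f = expf g].

Definition filtration (d : measure_display) (Omega : measurableType d)
  (R : realType) (Fil : R -> set (set Omega)) : Prop :=
  (forall t, sigma_algebra setT (Fil t)) /\
  (forall t, Fil t `<=` measurable) /\
  (forall s t, s <= t -> Fil s `<=` Fil t).

Definition measurable_wrt (Omega : Type) (R : realType)
  (G : set (set Omega)) (Z : Omega -> R) : Prop :=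
  forall B : set R, measurable B -> G (Z @^-1` B).

Definition is_cond_exp (d : measure_display) (Omega : measurableType d)
  (R : realType) (P : probability Omega R) (G : set (set Omega))
  (Y Z : Omega -> R) : Prop :=
  [/\ P.-integrable setT (EFin \o Y),
      measurable_wrt G Z,
      P.-integrable setT (EFin \o Z) &
      forall A, G A ->
        (\int[P]_(w in A) (Y w)%:E = \int[P]_(w in A) (Z w)%:E)%E].

Definition martingale (d : measure_display) (Omega : measurableType d)
  (R : realType) (P : probability Omega R) (Fil : R -> set (set Omega))
  (M : R -> Omega -> R) : Prop :=
  (forall t, 0 <= t -> measurable_wrt (Fil t) (M t)) /\
  (forall t, 0 <= t -> P.-integrable setT (EFin \o M t)) /\
  (forall s t, 0 <= s -> s <= t -> is_cond_exp P (Fil s) (M t) (M s)).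

Definition stopping_time (d : measure_display) (Omega : measurableType d)
  (R : realType) (Fil : R -> set (set Omega)) (tau : Omega -> \bar R) : Prop :=
  (forall w, (0 <= tau w)%E) /\
  (forall t, 0 <= t -> Fil t [set w | (tau w <= t%:E)%E]).

Definition stop_time (R : realType) (t : R) (tau : \bar R) : R :=
  match tau with
  | r%:E => Num.min t r
  | _ => t
  end.

Definition local_martingale (d : measure_display) (Omega : measurableType d)
  (R : realType) (P : probability Omega R) (Fil : R -> set (set Omega))
  (M : R -> Omega -> R) : Prop :=
  exists tau : nat -> Omega -> \bar R,
    [/\ forall n, stopping_time Fil (tau n),
        forall n w, (tau n w <= tau n.+1 w)%E,
        {ae P, forall w, forall r : R, exists n, (r%:E < tau n w)%E} &
        forall n, martingale P Fil (fun t w => M (stop_time t (tau n w)) w)].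

Definition cadlag_path (R : realType) (K : pseudoPMetricType R)
  (x : R -> Mplus K) : Prop :=
  forall h : K -> R, continuous h ->
    (forall t, 0 <= t -> (fun s => pair h (x s)) @ at_right t --> pair h (x t)) /\
    (forall t, 0 < t -> cvg ((fun s => pair h (x s)) @ at_left t)).

Definition MP_solution (d : measure_display) (Omega : measurableType d)
  (R : realType) (P : probability Omega R) (Fil : R -> set (set Omega))
  (K : pseudoPMetricType R) (D : set (K -> R))
  (L : (Mplus K -> R) -> (Mplus K -> R)) (X : R -> Omega -> Mplus K) : Prop :=
  [/\ (forall w, cadlag_path (fun t => X t w)),
      (forall t, 0 <= t -> forall h : K -> R, continuous h ->
         measurable_wrt (Fil t) (fun w => pair h (X t w))),
      (exists nu0 : Mplus K, forall w A, measurable A -> X 0 w A = nu0 A) &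
      (forall f, domL D f ->
         (forall w t, 0 <= t ->
            lebesgue_measure.-integrable `[0, t]
              (fun s => (L f (X s w))%:E)) /\
         local_martingale P Fil (fun t w =>
           f (X t w) - f (X 0 w)
           - Rintegral lebesgue_measure `[0, t] (fun s => L f (X s w))))].

(* Main.v *)
Require Import Defs.
From HB Require Import structures.
From mathcomp Require Import all_boot all_order all_algebra.
From mathcomp Require Import all_classical all_reals all_analysis.
From mathcomp Require Import measurable_realfun ring lra.
Set Implicit Arguments.
Unset Strict Implicit.
Unset Printing Implicit Defensive.
Import Order.TTheory GRing.Theory Num.Def Num.Theory.
Import numFieldNormedType.Exports.
Local Open Scope classical_set_scope.
Local Open Scope ring_scope.

(* With [V b nu = exp (phi_b + <psi_b, nu>)] and [k b q = E (1_A V b (X_q))],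
   [A] in [F_t], the claim is [k S t = k 0 T] for [S = T - t].  The flow equation
   gives [V b nu - V 0 nu] as the integral over [0, b] of [W = (F + <R, nu>) V],
   and the martingale problem for [exp <psi_b, .>], localized to the event that
   the mass of [X] has stayed below [N], gives [k b q - k b t] as the integral of
   the same [W] over [t, q], up to the probability of leaving that event.
   Integrating the first identity in [q] and the second in [b] over the triangle
   [b + (q - t) <= s], Fubini identifies the two double integrals of [W]; letting
   [N] go to infinity, the integral of [k b t] over [b] in [0, s] equals that of
   [k 0 q] over [q] in [t, t + s] for all [s <= S].  Left derivatives at [s = S]
   give the claim. *)

(** * Real-valued integrals *)

(** The natural route would be to differentiate [q -> k (T - q) q], but [<R(psi_b), nu>] is only
    integrable in [b], and the two identities control [k] in each variable separately, so no chain
    rule is at hand along the diagonal. Integrating over triangles replaces it: the boundary terms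
    on the hypotenuse [b + q = t + s] occur in both identities and cancel. Three obstacles shape the
    rest. The rate [F + <R, nu>] is unbounded in [nu] and the martingale property is only local,
    hence the indicator of bounded past mass, carried inside [W]. Fubini then needs the integral of
    [|W|] over [b] to be bounded over all [nu] of mass at most [N], whereas integrability is given
    for one [nu] at a time; a uniform boundedness argument on the cone of measures closes this gap.
    Finally, the filtration may fail to be right-continuous, so the exit time of an adapted event
    need not be a stopping time, and optional stopping at it is obtained through grids approaching
    it from the right. *)

Section Rintegral_extra.
Context d (T : measurableType d) (R : realType).
Variables (mu : {measure set T -> \bar R}) (D : set T).
Hypothesis mD : measurable D.

Lemma le_integrableR (f g : T -> R) : measurable_fun D f ->
  (forall x, D x -> `|f x| <= g x) ->
  mu.-integrable D (EFin \o g) -> mu.-integrable D (EFin \o f).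
Proof.
move=> mf fg; apply: le_integrable => //; first exact/measurable_EFinP.
by move=> x Dx /=; rewrite lee_fin (le_trans (fg x Dx))// ler_norm.
Qed.

Lemma integrableRZ (k : R) (f : T -> R) : mu.-integrable D (EFin \o f) ->
  mu.-integrable D (EFin \o (fun x => k * f x)).
Proof.
move=> fi; rewrite (_ : _ \o _ = fun x => (k%:E * (EFin \o f) x)%E)//.
exact: integrableZl.
Qed.

Lemma integrableRD (f g : T -> R) : mu.-integrable D (EFin \o f) ->
  mu.-integrable D (EFin \o g) -> mu.-integrable D (EFin \o (fun x => f x + g x)).
Proof.
move=> fi gi; rewrite (_ : _ \o _ = (EFin \o f) \+ (EFin \o g))%E//.
exact: integrableD.
Qed.

Lemma integrableRB (f g : T -> R) : mu.-integrable D (EFin \o f) ->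
  mu.-integrable D (EFin \o g) -> mu.-integrable D (EFin \o (fun x => f x - g x)).
Proof.
move=> fi gi; rewrite (_ : _ \o _ = (EFin \o f) \- (EFin \o g))%E//.
exact: integrableB.
Qed.

Hypothesis muD : (mu D < +oo)%E.

Lemma integrable_cstR (C : R) : mu.-integrable D (EFin \o cst C).
Proof. exact: measurable_bounded_integrable (@bounded_cst _ _ _ _ _). Qed.

Lemma bounded_integrableR (f : T -> R) (C : R) : measurable_fun D f ->
  (forall x, D x -> `|f x| <= C) -> mu.-integrable D (EFin \o f).
Proof.
by move=> mf fC; apply: le_integrableR mf fC _; exact: integrable_cstR.
Qed.

Lemma Rintegral_bound (f : T -> R) (C : R) : measurable_fun D f ->
  (forall x, D x -> `|f x| <= C) -> `|\int[mu]_(x in D) f x| <= C * fine (mu D).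
Proof.
move=> mf fC; have fi := bounded_integrableR mf fC.
rewrite (le_trans (le_normr_Rintegral _ _))// -Rintegral_cst// le_Rintegral//.
  exact: integrable_norm.
exact: integrable_cstR.
Qed.

End Rintegral_extra.

Lemma Rdominated_cvg d (T : measurableType d) (R : realType)
    (mu : {measure set T -> \bar R}) (D : set T) (f_ : nat -> T -> R)
    (f g : T -> R) : measurable D ->
  (forall n, measurable_fun D (f_ n)) -> measurable_fun D f ->
  {ae mu, forall x, D x -> f_ ^~ x @ \oo --> f x} ->
  mu.-integrable D (EFin \o g) -> (forall n x, D x -> `|f_ n x| <= g x) ->
  \int[mu]_(x in D) f_ n x @[n --> \oo] --> \int[mu]_(x in D) f x.
Proof.
move=> mD mf_ mf f_f ig fg.
(* Integrability of the limit, itself a conclusion of dominated convergence, makes its integral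
   finite, so that [fine] passes to the limit below. *)
have fi : mu.-integrable D (EFin \o f).
  have [] // := @dominated_convergence _ _ _ mu D mD (fun n => EFin \o f_ n)
    (EFin \o f) (EFin \o g).
  - by move=> n; exact/measurable_EFinP.
  - exact/measurable_EFinP.
  - by apply: filterS f_f => x h Dx; apply: cvg_EFin; [exact: nearW|exact: h].
  - by apply: aeW => x n Dx; rewrite lee_fin fg.
have [] // := @dominated_convergence _ _ _ mu D mD (fun n => EFin \o f_ n)
    (EFin \o f) (EFin \o g).
- by move=> n; exact/measurable_EFinP.
- exact/measurable_EFinP.
- by apply: filterS f_f => x h Dx; apply: cvg_EFin; [exact: nearW|exact: h].
- by apply: aeW => x n Dx; rewrite lee_fin fg.
move=> _ _ /=; rewrite -[X in _ --> X -> _]fineK; last exact: integrable_fin_num.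
by move/fine_cvg.
Qed.

Lemma measurable_fun_fine d (T : measurableType d) (R : realType) (D : set T)
  (F : T -> \bar R) : measurable_fun D F -> measurable_fun D (fun x => fine (F x)).
Proof. by move=> mF; apply: (@measurableT_comp _ _ _ _ _ _ fine). Qed.

Lemma integrable_fubini_G d1 d2 (T1 : measurableType d1) (T2 : measurableType d2)
    (R : realType) (m1 : {sigma_finite_measure set T1 -> \bar R})
    (m2 : {sigma_finite_measure set T2 -> \bar R}) (f : T1 * T2 -> \bar R) :
  (m1 \x m2)%E.-integrable setT f -> m2.-integrable setT (fubini_G m1 f).
Proof.
move=> fi; have mf : measurable_fun setT f by exact: measurable_int fi.
apply/integrableP; split; first exact: (measurable_fubini_G fi).
apply: le_lt_trans ((integrable21ltyP m1 m2 mf).1 fi).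
apply: ge0_le_integral => //.
- by apply: measurableT_comp => //; exact: (measurable_fubini_G fi).
- apply: (measurable_fun_fubini_tonelli_G (abse \o f)) => //=.
  exact: measurableT_comp.
- by move=> y _; apply: le_abse_integral => //; exact: measurableT_comp.
Qed.

Section Rfubini.
Context d1 d2 (T1 : measurableType d1) (T2 : measurableType d2) (R : realType).
Variables (m1 : {sigma_finite_measure set T1 -> \bar R})
  (m2 : {sigma_finite_measure set T2 -> \bar R}).
Variables (D1 : set T1) (D2 : set T2).
Hypotheses (mD1 : measurable D1) (mD2 : measurable D2).
Variable f : T1 * T2 -> R.

Let mD : measurable (D1 `*` D2). Proof. exact: measurableX. Qed.

(** Fubini is applied to the extension of [f] by zero to the whole product space; its sections are
    extensions by zero of the sections of [f]. *)
Let patchE x y : (f \_ (D1 `*` D2)) (x, y) = ((fun y => f (x, y)) \_ D2) y * \1_D1 x.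
Proof.
rewrite /patch indicE in_setX /=.
by case: (x \in D1); case: (y \in D2); rewrite /= ?mulr1 ?mulr0.
Qed.

Let patchE' x y : (f \_ (D1 `*` D2)) (x, y) = ((fun x => f (x, y)) \_ D1) x * \1_D2 y.
Proof.
rewrite /patch indicE in_setX /=.
by case: (x \in D1); case: (y \in D2); rewrite /= ?mulr1 ?mulr0.
Qed.

(** Tonelli for a function that need not be bounded: the sections in the first variable only have
    uniformly bounded [L^1] norm. This is the form in which the rate of the flow is controlled. *)
Lemma integrable_prod_bound (C : R) : (m2 D2 < +oo)%E ->
  measurable_fun (D1 `*` D2) f ->
  (forall y, D2 y -> m1.-integrable D1 (fun x => (f (x, y))%:E)) ->
  (forall y, D2 y -> \int[m1]_(x in D1) `|f (x, y)| <= C) ->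
  (m1 \x m2)%E.-integrable (D1 `*` D2) (EFin \o f).
Proof.
move=> fD2 mf fi fC; apply/(integrable_mkcond _ mD); rewrite restrict_EFin.
set g := f \_ (D1 `*` D2).
have mg : measurable_fun setT g by apply/(measurable_restrictT _ mD).
apply/integrable21ltyP; first exact/measurable_EFinP.
apply: (@le_lt_trans _ _ (\int[m2]_y (C%:E * (\1_D2 y)%:E))%E).
  apply: ge0_le_integral => //.
  - by move=> y _; exact: integral_ge0.
  - apply: (measurable_fun_fubini_tonelli_G (abse \o (EFin \o g))) => //=.
    by apply: measurableT_comp => //; exact/measurable_EFinP.
  - by apply/measurable_EFinP/measurable_funM => //; exact: measurable_indic.
  move=> y _.
  have [yD|yD] := pselect (D2 y); last first.
    rewrite !indicE memNset//= mule0 integral0_eq// => x _.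
    by rewrite /= /g patchE' indicE memNset//= mulr0 normr0.
  rewrite indicE mem_set// mule1.
  rewrite (_ : (fun _ => _) = (fun x => `|f (x, y)|%:E) \_ D1); last first.
    apply/funext => x; rewrite /= /g patchE' indicE mem_set// mulr1 /patch.
    by case: ifP => //=; rewrite normr0.
  rewrite -integral_mkcond -[leLHS]fineK ?lee_fin ?fC//.
  apply: integrable_fin_num => //.
  exact: (integrable_norm (f := fun x => f (x, y)) (fi _ yD)).
have D2i : m2.-integrable setT (fun y => (\1_D2 y)%:E).
  apply/integrableP; split; first exact/measurable_EFinP/measurable_indic.
  under eq_integral do rewrite /= ger0_norm//.
  by rewrite integral_indic// setIT.
by rewrite integralZl// ltey_eq fin_numM// integrable_fin_num.
Qed.

Hypothesis fi : (m1 \x m2)%E.-integrable (D1 `*` D2) (EFin \o f).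

Let gi : (m1 \x m2)%E.-integrable setT (EFin \o (f \_ (D1 `*` D2))).
Proof. by move/(integrable_mkcond _ mD) : fi; rewrite restrict_EFin. Qed.

Let FE x : \int[m2]_y (f \_ (D1 `*` D2)) (x, y) =
  ((fun x => \int[m2]_(y in D2) f (x, y)) \_ D1) x.
Proof.
rewrite [RHS]/patch; case: ifPn => xD.
  rewrite [RHS]Rintegral_mkcond; apply: eq_Rintegral => y _.
  by rewrite patchE indicE xD mulr1.
transitivity (\int[m2]_(_ in setT) (0 : R)); last by rewrite Rintegral_cst// mul0r.
by apply: eq_Rintegral => y _; rewrite patchE indicE (negbTE xD) mulr0.
Qed.

Let GE y : \int[m1]_x (f \_ (D1 `*` D2)) (x, y) =
  ((fun y => \int[m1]_(x in D1) f (x, y)) \_ D2) y.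
Proof.
rewrite [RHS]/patch; case: ifPn => yD.
  rewrite [RHS]Rintegral_mkcond; apply: eq_Rintegral => x _.
  by rewrite patchE' indicE yD mulr1.
transitivity (\int[m1]_(_ in setT) (0 : R)); last by rewrite Rintegral_cst// mul0r.
by apply: eq_Rintegral => x _; rewrite patchE' indicE (negbTE yD) mulr0.
Qed.


Lemma integrable_Rintegral12 :
  m1.-integrable D1 (EFin \o (fun x => \int[m2]_(y in D2) f (x, y))).
Proof.
apply/(integrable_mkcond _ mD1); rewrite restrict_EFin -(funext FE).
have Fi := integrable_fubini_F gi.
have mF : measurable_fun setT (fubini_F m2 (EFin \o (f \_ (D1 `*` D2)))).
  exact: measurable_int Fi.
apply: le_integrable Fi => //.
  apply/measurable_EFinP.
  exact: measurable_fun_fine mF.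
(* Where the section integral is infinite, [fine] returns 0, which the infinite majorant still
   dominates. *)
move=> x _ /=; rewrite /Rintegral /fubini_F /=.
by case: integral => [r| |] //=; rewrite normr0 leey.
Qed.

Lemma integrable_Rintegral21 :
  m2.-integrable D2 (EFin \o (fun y => \int[m1]_(x in D1) f (x, y))).
Proof.
apply/(integrable_mkcond _ mD2); rewrite restrict_EFin -(funext GE).
have Gi := integrable_fubini_G gi.
have mG : measurable_fun setT (fubini_G m1 (EFin \o (f \_ (D1 `*` D2)))).
  exact: measurable_int Gi.
apply: le_integrable Gi => //.
  apply/measurable_EFinP.
  exact: measurable_fun_fine mG.
move=> x _ /=; rewrite /Rintegral /fubini_G /=.
by case: integral => [r| |] //=; rewrite normr0 leey.
Qed.

Lemma Rintegral_prod12 : \int[(m1 \x m2)%E]_(z in D1 `*` D2) f z =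
  \int[m1]_(x in D1) \int[m2]_(y in D2) f (x, y).
Proof.
rewrite Rintegral_mkcond [RHS]Rintegral_mkcond -(funext FE).
rewrite {1}/Rintegral -integral12_prod_meas1//; congr fine.
apply: ae_eq_integral => //.
- exact: (measurable_int _ (integrable_fubini_F gi)).
- apply/measurable_EFinP; apply: measurable_fun_fine.
  exact: (measurable_int _ (integrable_fubini_F gi)).
(* Sections are integrable for almost every [x] only; on the exceptional null set [fine] may alter
   the value. *)
apply: filterS (ae_integrable1 gi) => x xi _.
by rewrite /fubini_F fineK//; exact: integrable_fin_num.
Qed.

Lemma Rintegral_prod21 : \int[(m1 \x m2)%E]_(z in D1 `*` D2) f z =
  \int[m2]_(y in D2) \int[m1]_(x in D1) f (x, y).
Proof.
rewrite Rintegral_mkcond [RHS]Rintegral_mkcond -(funext GE).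
rewrite {1}/Rintegral -integral21_prod_meas1//; congr fine.
apply: ae_eq_integral => //.
- exact: (measurable_int _ (integrable_fubini_G gi)).
- apply/measurable_EFinP; apply: measurable_fun_fine.
  exact: (measurable_int _ (integrable_fubini_G gi)).
apply: filterS (ae_integrable2 gi) => x xi _.
by rewrite /fubini_G fineK//; exact: integrable_fin_num.
Qed.

End Rfubini.

(** * Lebesgue integrals on the line: reflection, and a chain rule for the exponential of an
    indefinite integral *)

Section real_line.
Context (R : realType).
Notation mu := (@lebesgue_measure R).
Implicit Types (f y : R -> R) (a b c s : R).

Lemma lebesgue_itvcc_lty a b : (mu `[a, b] < +oo)%E.
Proof. by rewrite lebesgue_measure_itv/=; case: ifP => // _; rewrite -EFinB ltry. Qed.

Lemma lebesgue_itvcc a b : a <= b -> mu `[a, b] = (b - a)%:E.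
Proof.
move=> ab; rewrite lebesgue_measure_itv/= lte_fin.
by case: ltgtP ab => // -> _; rewrite subrr.
Qed.

Lemma Rintegral_cat f a b c : a <= b -> b <= c ->
  mu.-integrable `[a, c] (EFin \o f) ->
  \int[mu]_(x in `[a, c]) f x =
  \int[mu]_(x in `[a, b]) f x + \int[mu]_(x in `[b, c]) f x.
Proof.
move=> ab bc fi; have := @Rintegral_itvB _ f (BLeft a) (BRight c) b fi.
rewrite !bnd_simp => /(_ ab bc) E.
rewrite -(@Rintegral_itv_obnd_cbnd _ b (BRight c)) -?E; first by rewrite addrC subrK.
by apply: integrableS fi => //; apply: subset_itvr; rewrite bnd_simp.
Qed.

Lemma Rintegral_small f s e : mu.-integrable `[0, s] (EFin \o f) -> 0 < e ->
  exists2 del, 0 < del & forall a b, 0 <= a -> a <= b -> b <= s -> b - a < del ->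
    \int[mu]_(x in `[a, b]) `|f x| < e.
Proof.
move=> fi e0.
have fi' : mu.-integrable setT (EFin \o (f \_ `[0, s])).
  by move/integrable_mkcond : fi; rewrite restrict_EFin; apply.
have [del [del0 h]] := integral_normr_continuous fi' e0.
exists del => // a b a0 ab bs bad.
apply: le_lt_trans (h [set` `[a, b]] (measurable_itv _) _); last first.
  by rewrite [X in (X < _)%E](lebesgue_itvcc ab) lte_fin.
rewrite le_eqVlt; apply/orP; left; apply/eqP/eq_Rintegral => x /[!inE] xab.
rewrite patchE ifT// inE; move: x xab; apply: subset_itv; rewrite bnd_simp//.
Qed.

(** Lebesgue measure is determined by half-open intervals, and the reflection turns []a, b]] into
    [[s - b, s - a[], of the same length. *)
Lemma lebesgue_pushforward_subl s (A : set (measurableTypeR R)) : measurable A ->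
  pushforward mu (fun x : measurableTypeR R => (s - x : measurableTypeR R)) A = mu A.
Proof.
have ms : measurable_fun setT (fun x : measurableTypeR R => (s - x : measurableTypeR R)).
  by apply: measurable_funB.
move=> mA; apply/esym.
apply: (@lebesgue_measure_unique R
  (measure_function_pushforward__canonical__measure_function_Measure mu ms)) => //.
move=> _ [[a b] _ <-] /=; rewrite /pushforward.
rewrite [X in _ = lebesgue_measure X](_ : _ = `[s - b, s - a[%classic); last first.
  by apply/seteqP; split => x; rewrite /= !in_itv/= => /andP[? ?]; apply/andP; split; lra.
rewrite !lebesgue_measure_itv/= !lte_fin.
have -> : (s - b < s - a) = (a < b) by apply/idP/idP => ?; lra.
by case: ifP => // _; congr EFin; rewrite opprB addrCA; lra.
Qed.

Lemma integral_subl (F : R -> \bar R) s : measurable_fun setT F ->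
  (\int[mu]_x F (s - x)%R = \int[mu]_x F x)%E.
Proof.
move=> mF.
have ms : measurable_fun setT (fun x : measurableTypeR R => (s - x : measurableTypeR R)).
  by apply: measurable_funB.
have ge0E (G : R -> \bar R) : measurable_fun setT G -> (forall x, 0 <= G x)%E ->
    (\int[mu]_x G (s - x)%R = \int[mu]_x G x)%E.
  move=> mG G0.
  transitivity (\int[pushforward mu (fun x : measurableTypeR R => (s - x : measurableTypeR R)%R)]_x G x)%E.
    by rewrite ge0_integral_pushforward.
  by apply: eq_measure_integral => A mA _; exact: lebesgue_pushforward_subl.
rewrite integralE [RHS]integralE -(ge0E F^\+%E)//; last exact: measurable_funepos.
rewrite -(ge0E F^\-%E)//; last exact: measurable_funeneg.
by under eq_integral do rewrite funepos_comp; under [X in (_ - X)%E = _]eq_integral do rewrite funeneg_comp.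
Qed.

Lemma Rintegral_subl f c u v : mu.-integrable `[u, v] (EFin \o f) ->
  \int[mu]_(x in `[c - v, c - u]) f (c - x) = \int[mu]_(x in `[u, v]) f x.
Proof.
move=> fi.
have fi' : mu.-integrable setT (EFin \o (f \_ `[u, v])).
  by move/integrable_mkcond : fi; rewrite restrict_EFin; apply.
rewrite Rintegral_mkcond [RHS]Rintegral_mkcond /Rintegral; congr fine.
rewrite -(@integral_subl (EFin \o (f \_ `[u, v])) c); last exact: measurable_int fi'.
apply: eq_integral => x _ /=; congr EFin; rewrite !patchE; congr (if _ then _ else _).
by apply/idP/idP; rewrite !inE/= !in_itv/= => /andP[? ?]; apply/andP; split; lra.
Qed.

Lemma Rintegral_subitv f a u v b : a <= u -> u <= v -> v <= b ->
  mu.-integrable `[a, b] (EFin \o f) -> (forall x, 0 <= f x) ->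
  \int[mu]_(x in `[u, v]) f x <= \int[mu]_(x in `[a, b]) f x.
Proof.
move=> au uv vb fi f0.
rewrite (@Rintegral_cat f a u b)//; last exact: le_trans vb.
rewrite (@Rintegral_cat f u v b)//; last first.
  by apply: integrableS fi => //; apply: subset_itvr; rewrite bnd_simp.
by rewrite addrCA ler_wpDr// addr_ge0// Rintegral_ge0.
Qed.

(** A mean value theorem insensitive to the order of [x] and [z]; the intermediate point is located
    relative to [z], which serves as the reference value on a small cell. *)
Lemma expR_MVT x z : exists c, [/\ expR x - expR z = expR c * (x - z),
  `|c - z| <= `|x - z| & c <= maxr x z].
Proof.
have H u v : u <= v -> exists c, [/\ expR v - expR u = expR c * (v - u), u <= c & c <= v].
  move=> uv; have [c /[!in_itv]/= /andP[uc cv] E] :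
      exists2 c, c \in `[u, v] & expR v - expR u = expR c * (v - u).
    by apply: MVT_segment => //; apply: continuous_subspaceT => ?; exact: continuous_expR.
  by exists c.
have [zx|xz] := leP z x.
  have [c [E zc cx]] := H _ _ zx; exists c; split => //.
  by rewrite !ger0_norm ?subr_ge0// lerB.
have [c [E xc cz]] := H _ _ (ltW xz); exists c; split => //.
  by rewrite -[LHS]opprB E -mulrN opprB.
by rewrite !ler0_norm ?subr_le0 ?(ltW xz)// lerN2 lerB.
Qed.

Lemma expR_lip (M x z : R) : x <= M -> z <= M ->
  `|expR x - expR z| <= expR M * `|x - z|.
Proof.
have [c [-> _ cM]] := expR_MVT x z; move=> xM zM.
rewrite normrM ger0_norm ?expR_ge0// ler_wpM2r// ler_expR (le_trans cM)//.
by rewrite ge_max xM.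
Qed.

(* Local errors are O(osc y * \int |f|), hence sum to o(1) over a fine mesh. *)
Lemma expR_integral_chain f y (M S : R) : 0 <= S ->
  mu.-integrable `[0, S] (EFin \o f) ->
  (forall b, 0 <= b <= S -> y b = y 0 + \int[mu]_(x in `[0, b]) f x) ->
  (forall b, 0 <= b <= S -> y b <= M) ->
  mu.-integrable `[0, S] (EFin \o (fun x => f x * expR (y x))) /\
  expR (y S) - expR (y 0) = \int[mu]_(x in `[0, S]) (f x * expR (y x)).
Proof.
move=> S0 fi yE yM.
have fiS a b : 0 <= a -> b <= S -> mu.-integrable `[a, b] (EFin \o f).
  move=> a0 bS; apply: integrableS fi => //; apply: subset_itv; rewrite bnd_simp//.
have yB a b : 0 <= a -> a <= b -> b <= S -> y b - y a = \int[mu]_(x in `[a, b]) f x.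
  move=> a0 ab bS; rewrite (yE b) ?(yE a); [|lra..].
  by rewrite (@Rintegral_cat f 0 a b)//; [lra|exact: fiS].
have Ic : {within `[0, S], continuous (fun x => y 0 + \int[mu]_(x in `[0, x]) f x)}.
  move=> x; apply: cvgD; first exact: cvg_cst.
  exact: (parameterized_integral_continuous S0 fi).
have yc : {within `[0, S], continuous y}.
  by apply: subspace_eq_continuous Ic => x; rewrite inE/= in_itv/= => /yE.
have my : measurable_fun `[0, S] y by apply: subspace_continuous_measurable_fun.
have mf : measurable_fun `[0, S] f by apply/measurable_EFinP; exact: measurable_int fi.
have gi : mu.-integrable `[0, S] (EFin \o (fun x => f x * expR (y x))).
  have gM : mu.-integrable `[0, S] (EFin \o (fun x => expR M * `|f x|)).
    by apply: integrableRZ => //; exact: integrable_norm fi.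
  apply: le_integrableR gM => //.
    by apply: measurable_funM => //; exact: measurableT_comp.
  move=> x /= /[!in_itv]/= xS; rewrite normrM mulrC ler_wpM2r// ger0_norm ?expR_ge0//.
  by rewrite ler_expR yM.
split => //.
have giS a b : 0 <= a -> b <= S ->
    mu.-integrable `[a, b] (EFin \o (fun x => f x * expR (y x))).
  by move=> a0 bS; apply: integrableS gi => //; apply: subset_itv; rewrite bnd_simp.
pose D b := expR (y b) - expR (y 0) - \int[mu]_(x in `[0, b]) (f x * expR (y x)).
have D0 : D 0 = 0 by rewrite /D set_itv1 Rintegral_set1 subrr subr0.
suff : D S = 0 by rewrite /D => /eqP; rewrite subr_eq0 => /eqP.
have nfi a b : 0 <= a -> b <= S -> mu.-integrable `[a, b] (EFin \o (fun x => `|f x|)).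
  by move=> a0 bS; exact: integrable_norm (fiS a b a0 bS).
have loc e a b : 0 <= a -> a <= b -> b <= S ->
    \int[mu]_(x in `[a, b]) `|f x| <= e ->
    `|D b - D a| <= 2 * e * expR M * \int[mu]_(x in `[a, b]) `|f x|.
  move=> a0 ab bS small.
  have osc u v : a <= u -> u <= v -> v <= b -> `|y v - y u| <= e.
    move=> au uv vb; rewrite yB//; [|lra|lra].
    apply: le_trans (le_normr_Rintegral _ _) _ => //; first by apply: fiS; lra.
    apply: le_trans small.
    by apply: (@Rintegral_subitv (fun x => `|f x|)) => //; exact: nfi.
  (* Writing the increment of [expR \o y] as [expR c] times the integral of [f] puts the whole
     defect under one integral, with the small factor [expR c - expR (y x)]. *)
  have [c [E cya cM]] := expR_MVT (y b) (y a).
  have -> : D b - D a = \int[mu]_(x in `[a, b]) (f x * (expR c - expR (y x))).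
    transitivity (\int[mu]_(x in `[a, b]) (expR c * f x - f x * expR (y x))).
      rewrite RintegralB//; last 2 first.
      - by apply: integrableRZ => //; exact: fiS.
      - exact: giS.
      rewrite RintegralZl//; last exact: fiS.
      rewrite -yB// -E /D (@Rintegral_cat (fun x => f x * expR (y x)) 0 a b)//; last exact: giS.
      lra.
    by apply: eq_Rintegral => x _; rewrite mulrBr mulrC.
  have e0 : 0 <= e by apply: le_trans small; exact: Rintegral_ge0.
  have cle : c <= M by rewrite (le_trans cM)// ge_max !yM//; apply/andP; split => //; lra.
  have mf' : measurable_fun `[a, b] (fun x => f x * (expR c - expR (y x))).
    apply: (@measurable_funS _ _ _ _ `[0, S]) => //.
      by apply: subset_itv; rewrite bnd_simp.
    by apply: measurable_funM => //; apply: measurable_funB => //; exact: measurableT_comp.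
  have bnd x : `[a, b]%classic x ->
      `|f x * (expR c - expR (y x))| <= 2 * e * expR M * `|f x|.
    move=> /= /[!in_itv]/= /andP[ax xb]; rewrite normrM mulrC ler_wpM2r//.
    apply: le_trans (@expR_lip M _ _ cle _) _; first by apply: yM; lra.
    rewrite mulrC ler_wpM2r ?expR_ge0//.
    (* The factor 2: both [c] and [y x] lie within [e] of [y a], since [y] moves by at most the
       integral of [|f|] over the cell. *)
    apply: le_trans (ler_distD (y a) _ _) _.
    rewrite mulr_natl mulr2n lerD//; first by rewrite (le_trans cya)// osc.
    by rewrite distrC osc.
  have Ki : mu.-integrable `[a, b] (EFin \o (fun x => 2 * e * expR M * `|f x|)).
    by apply: integrableRZ => //; exact: nfi.
  have Fi : mu.-integrable `[a, b] (EFin \o (fun x => f x * (expR c - expR (y x)))).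
    by apply: le_integrableR Ki.
  apply: le_trans (le_normr_Rintegral _ Fi) _ => //.
  rewrite -RintegralZl//; last exact: nfi.
  by apply: le_Rintegral => //; exact: integrable_norm Fi.
have loc2 e : 0 < e -> `|D S| <= e * (2 * expR M * \int[mu]_(x in `[0, S]) `|f x|).
  move=> e0; have [del del0 small] := Rintegral_small fi e0.
  (* The mesh lies below the threshold given by absolute continuity of the integral of [|f|], so
     [loc] applies to every cell and the cell bounds add up. *)
  have [n Sn] : exists n : nat, S / n.+1%:R < del.
    exists (truncn (S / del)); rewrite ltr_pdivrMr// -ltr_pdivrMl// mulrC.
    exact: truncnS_gt.
  pose c i : R := S * (i%:R / n.+1%:R).
  have cS i : c i.+1 - c i = S / n.+1%:R.
    by rewrite /c -mulrBr -mulrBl -natrB ?leqnSn// subSnn mul1r.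
  have c0 i : 0 <= c i by rewrite /c mulr_ge0.
  have cm i : c i <= c i.+1 by rewrite -subr_ge0 cS divr_ge0.
  have cle i : (i <= n.+1)%N -> c i <= S.
    by move=> ?; rewrite /c ler_piMr// ler_pdivrMr// mul1r ler_nat.
  have ind i : (i <= n.+1)%N ->
      `|D (c i)| <= 2 * e * expR M * \int[mu]_(x in `[0, c i]) `|f x|.
    elim: i => [_|i IH iS].
      by rewrite /c mul0r mulr0 D0 set_itv1 Rintegral_set1 normr0 mulr0.
    rewrite (@Rintegral_cat (fun x => `|f x|) 0 (c i) (c i.+1))//; last exact: nfi (cle _ iS).
    rewrite mulrDr -[D _](subrK (D (c i))) addrC.
    apply: le_trans (ler_normD _ _) _; apply: lerD; first exact: IH (ltnW iS).
    by apply: loc => //; [exact: cle|rewrite ltW// small// ?cle// cS].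
  have := ind n.+1 (leqnn _); rewrite /c divff// mulr1.
  by move=> /le_trans; apply; rewrite le_eqVlt; apply/orP; left; apply/eqP; ring.
apply/eqP; rewrite -normr_le0.
set C := 2 * expR M * _ in loc2.
have C0 : 0 <= C by rewrite /C !mulr_ge0 ?expR_ge0// Rintegral_ge0.
apply/ler_addgt0Pr => e e0; rewrite add0r.
apply: le_trans (loc2 (e / (C + 1)) _) _; first by rewrite divr_gt0// ltr_wpDl.
rewrite mulrAC ler_pdivrMr ?ltr_wpDl// ler_wpM2l// ?ltW//; lra.
Qed.
End real_line.

(** * Integration of continuous functions on a compact space *)

Section measures_on_compact.
Context (R : realType) (K : pseudoPMetricType R).
Hypothesis Kcpt : compact [set: K].
Implicit Types (h k : K -> R) (nu : Mplus K).

Lemma continuous_bounded h : continuous h -> exists2 C, 0 <= C & forall x, `|h x| <= C.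
Proof.
move=> ch; have [c _ hc] : exists2 c, c \in [set: K] & forall t, t \in [set: K] -> `|h t| <= `|h c|.
  apply: compact_EVT_max => //; first by exists point.
  by apply: continuous_subspaceT => x; apply: continuous_comp; [exact: ch|exact: norm_continuous].
by exists `|h c| => // x; apply: hc; rewrite inE.
Qed.

Lemma measurable_Kborel h : continuous h -> measurable_fun setT (h : Kborel K -> R).
Proof.
move=> /continuousP ch; apply: (measurability _ (RGenOpens.measurableE R)).
move=> _ [_ [a [b ->] <-]]; rewrite setTI; apply: sub_sigma_algebra.
exact/ch/interval_open.
Qed.

Lemma finite_measure_lty nu (A : set (Kborel K)) : measurable A -> (nu A < +oo)%E.
Proof. by move=> mA; rewrite ltey_eq fin_num_measure. Qed.

Lemma integrable_continuous h nu : continuous h ->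
  nu.-integrable setT (EFin \o (h : Kborel K -> R)).
Proof.
move=> ch; have [C _ hC] := continuous_bounded ch.
apply: (@bounded_integrableR _ _ _ nu setT measurableT _ h C) => //.
  exact: finite_measure_lty.
exact: measurable_Kborel.
Qed.

Lemma pairD h k nu : continuous h -> continuous k ->
  pair (fun x => h x + k x) nu = pair h nu + pair k nu.
Proof. by move=> ch ck; apply: RintegralD => //; exact: integrable_continuous. Qed.

Lemma pairZ a h nu : continuous h -> pair (fun x => a * h x) nu = a * pair h nu.
Proof. by move=> ch; apply: RintegralZl => //; exact: integrable_continuous. Qed.

Lemma pair0 nu : pair (fun _ : K => 0 : R) nu = 0.
Proof. by rewrite /pair integral0. Qed.

Lemma continuous_cst (a : R) : continuous (fun _ : K => a).
Proof. by move=> x; exact: cvg_cst. Qed.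

Lemma continuous_sum (I : Type) (r : seq I) (f : I -> K -> R) :
  (forall i, continuous (f i)) -> continuous (fun x => \sum_(i <- r) f i x).
Proof.
move=> cf; elim: r => [|i r IH].
  by under eq_fun do rewrite big_nil; exact: continuous_cst.
under eq_fun do rewrite big_cons.
by move=> x; apply: cvgD; [exact: cf|exact: IH].
Qed.

Lemma pair_sum n (c : 'I_n -> R) (h : 'I_n -> K -> R) nu :
  (forall i, continuous (h i)) ->
  pair (fun x => \sum_i c i * h i x) nu = \sum_i c i * pair (h i) nu.
Proof.
move=> ch; have cch i : continuous (fun x => c i * h i x).
  by move=> x; apply: cvgMr; exact: ch.
elim: (index_enum _) => [|i r IH].
  by under [in LHS]eq_fun do rewrite big_nil; rewrite big_nil pair0.
under [in LHS]eq_fun do rewrite big_cons.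
by rewrite big_cons -IH -pairZ// -pairD//; exact: continuous_sum.
Qed.

Lemma pair_monotone h k nu : continuous h -> continuous k -> (forall x, h x <= k x) ->
  pair h nu <= pair k nu.
Proof.
by move=> ch ck hk; apply: le_Rintegral => //; exact: integrable_continuous.
Qed.

Definition mass nu : R := pair (fun _ => 1) nu.

Lemma mass_ge0 nu : 0 <= mass nu.
Proof. by apply: Rintegral_ge0 => x _. Qed.

Lemma pair_cst a nu : pair (fun _ => a) nu = a * mass nu.
Proof.
rewrite -pairZ; last exact: continuous_cst.
by congr pair; apply/funext => x; rewrite mulr1.
Qed.

Lemma norm_pair_le h nu C : continuous h -> (forall x, `|h x| <= C) ->
  `|pair h nu| <= C * mass nu.
Proof.
move=> ch hC; rewrite ler_norml -mulNr -!pair_cst; apply/andP; split; apply: pair_monotone => //.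
- exact: continuous_cst.
- by move=> x; have := hC x; rewrite ler_norml => /andP[].
- exact: continuous_cst.
- by move=> x; have := hC x; rewrite ler_norml => /andP[].
Qed.

Lemma pair_le0 h nu : continuous h -> (forall x, h x <= 0) -> pair h nu <= 0.
Proof.
by move=> ch h0; rewrite -(pair0 nu); apply: pair_monotone => //; exact: continuous_cst.
Qed.

Lemma pair_cvg (h_ : nat -> K -> R) h nu C : (forall n, continuous (h_ n)) ->
  continuous h -> (forall x, h_ ^~ x @ \oo --> h x) ->
  (forall n x, `|h_ n x| <= C) -> pair (h_ n) nu @[n --> \oo] --> pair h nu.
Proof.
move=> ch_ ch hh hC.
apply: (@Rdominated_cvg _ _ _ nu setT (fun n => (h_ n : Kborel K -> R)) _ (fun _ => C)) => //.
- by move=> n; exact: measurable_Kborel.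
- exact: measurable_Kborel.
- by apply: aeW => x _; exact: hh.
- by apply: integrable_cstR => //; exact: finite_measure_lty.
Qed.

(** Urysohn functions for finitely many balls, divided by their sum. The balls of radius [e / 2], on
    which these functions equal 1, already cover, so the sum is positive. *)
Lemma partition_of_unity (e : R) : 0 < e -> exists (n : nat) (x : nat -> K) (chi : nat -> K -> R),
  [/\ forall i, continuous (chi i), forall i y, 0 <= chi i y,
      forall y, \sum_(i < n) chi i y = 1 & forall i y, chi i y != 0 -> ball (x i) e y].
Proof.
move=> e0; have e20 : 0 < e / 2 by rewrite divr_gt0.
have : finite_subset_cover [set: K] (fun x => (ball x (e / 2))°) [set: K].
  have := Kcpt; rewrite compact_cover; apply.
    by move=> x _; exact: open_interior.
  by move=> x _; exists x => //; exact: nbhsx_ballx.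
move=> [s _ scov].
have urys (x : K) : exists u : K -> R, [/\ continuous u, forall y, 0 <= u y,
    forall y, ball x (e / 2) y -> u y = 1 & forall y, u y != 0 -> ball x e y].
  (* By the triangle inequality no point of the half-radius ball is within [e / 2] of the complement
     of the full ball. *)
  have sep : uniform_separator (ball x (e / 2)) (~` ball x e).
    apply: uniform_separatorW; exists [set ab | ball ab.1 (e / 2) ab.2].
      exact: (entourage_ball _ (PosNum e20)).
    rewrite -subset0 => -[a b] /= [[xa nxb] ab]; apply: nxb.
    by rewrite [e]splitr; exact: ball_triangle xa ab.
  have /(@uniform_separatorP _ R) [f [cf f01 f0 f1]] := sep.
  exists (fun y => 1 - f y); split.
  - by move=> y; apply: cvgB; [exact: cvg_cst|exact: cf].
  - by move=> y; have := f01 (f y) (ex_intro2 _ _ y I erefl); rewrite /= in_itv/= => /andP[]; rewrite subr_ge0.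
  - by move=> y xy; have /= -> := f0 (f y) (ex_intro2 _ _ y xy erefl); rewrite subr0.
  - move=> y; apply: contraNP => xy; have /= -> := f1 (f y) (ex_intro2 _ _ y xy erefl).
    by rewrite subrr.
have [u uP] := choice urys.
(* Indices from [n] on yield the default point; continuity, sign and support hold for them too, and
   the sum does not see them. *)
pose n := size (finmap.enum_fset s); pose x i := nth point (finmap.enum_fset s) i.
pose S y := \sum_(i < n) u (x i) y.
have u0 z y : 0 <= u z y by have [_ ->] := uP z.
have S0 y : 0 < S y.
  have [z zs /interior_subset zy] := scov y I.
  have zi : (index z (finmap.enum_fset s) < n)%N by rewrite index_mem.
  rewrite /S (bigD1 (Ordinal zi))//= ltr_pwDl//; last by apply: sumr_ge0.
  rewrite /x nth_index//; have [_ _ ->//] := uP z.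
exists n, x, (fun i y => u (x i) y / S y); split.
- move=> i y; apply: cvgM; first by have [cu _ _ _] := uP (x i); exact: cu.
  apply: cvgV; first by rewrite gt_eqF.
  by apply: (continuous_sum (f := fun (i : 'I_n) y => u (x i) y)) => j; have [] := uP (x j).
- by move=> i y; rewrite divr_ge0// ltW.
- by move=> y; rewrite -mulr_suml -/(S y) divff// gt_eqF.
- move=> i y; rewrite mulf_eq0 negb_or => /andP[uy _].
  by have [_ _ _] := uP (x i); exact.
Qed.

End measures_on_compact.

(** * Approximation of pairings by finite sums, and constructions of finite measures *)

Section discretization.
Context (R : realType) (K : pseudoPMetricType R).
Hypothesis Kcpt : compact [set: K].
Implicit Types (h : K -> R) (nu : Mplus K).

(** Partitions of unity of radius [1 / (m + 1)] approximate [<h, nu>] by sums in which [h] enters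
    only through values at points and [nu] only through fixed test functions. The countably many
    centres are dense, which later turns suprema over [K] into countable ones. *)
Lemma pair_discretization : exists (n : nat -> nat) (x : nat -> nat -> K)
    (chi : nat -> nat -> K -> R),
  [/\ forall m i, continuous (chi m i),
      forall y (e : R), 0 < e -> exists m i, ball (x m i) e y &
      forall h nu, continuous h ->
        \sum_(i < n m) h (x m i) * pair (chi m i) nu @[m --> \oo] --> pair h nu].
Proof.
have /choice[p pP] : forall m, exists p : nat * (nat -> K) * (nat -> K -> R),
    [/\ forall i, continuous (p.2 i), forall i y, 0 <= p.2 i y,
      forall y, \sum_(i < p.1.1) p.2 i y = 1 &
      forall i y, p.2 i y != 0 -> ball (p.1.2 i) m.+1%:R^-1 y].
  move=> m; have m0 : 0 < m.+1%:R^-1 :> R by rewrite invr_gt0.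
  have [n [x [chi chiP]]] := partition_of_unity Kcpt m0.
  by exists (n, x, chi).
exists (fun m => (p m).1.1), (fun m => (p m).1.2), (fun m => (p m).2); split.
- by move=> m i; have [+ _ _ _] := pP m; exact.
- move=> y e e0; have [m me] : exists m : nat, m.+1%:R^-1 < e.
    exists (truncn e^-1); rewrite invf_plt ?posrE// truncnS_gt//.
  have [_ chi0 chi1 chib] := pP m.
  (* With no centre close to [y], all members of the partition would vanish there, yet they sum to
     1. *)
  have [//|no] := pselect (exists m i, ball ((p m).1.2 i) e y).
  have : \sum_(i < (p m).1.1) (p m).2 i y = 0.
    apply: big1 => i _; apply/eqP/negPn/negP => /chib b; apply: no.
    by exists m, i; exact: le_ball (ltW me) _ b.
  by rewrite chi1 => /eqP; rewrite oner_eq0.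
move=> h nu ch; have [C C0 hC] := continuous_bounded Kcpt ch.
have cchi m i : continuous ((p m).2 i) by have [+ _ _ _] := pP m; exact.
under eq_fun do rewrite -(@pair_sum _ _ Kcpt _ (fun i => h ((p _).1.2 i)) (fun i => (p _).2 i))//.
apply: (pair_cvg (C := C)) => //.
- move=> m; apply: (continuous_sum (f := fun (i : 'I_((p m).1.1)) y => h ((p m).1.2 i) * (p m).2 i y)).
  by move=> i x; apply: cvgMr; exact: cchi.
- move=> y; apply/cvgrPdist_le => e e0.
  have /cvgrPdist_le/(_ e e0) /nbhs_ballP[r /= r0 hr] := ch y.
  near=> m; have [_ chi0 chi1 chib] := pP m.
  rewrite -[h y]mulr1 -(chi1 y) mulr_sumr -sumrB.
  apply: le_trans (ler_norm_sum _ _ _) _; rewrite -[e]mulr1 -(chi1 y) mulr_sumr.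
  apply: ler_sum => i _; rewrite -mulrBl normrM (ger0_norm (chi0 _ _)).
  have [->|/chib b] := eqVneq ((p m).2 i y) 0; first by rewrite !mulr0.
  rewrite ler_wpM2r//; apply: hr; apply: ball_sym; apply: le_ball b.
  by rewrite ltW//; near: m; exact: near_infty_natSinv_lt (PosNum r0).
- move=> m y; have [_ chi0 chi1 chib] := pP m.
  apply: le_trans (ler_norm_sum _ _ _) _; rewrite -[C]mulr1 -(chi1 y) mulr_sumr.
  by apply: ler_sum => i _; rewrite normrM (ger0_norm (chi0 _ _)) ler_wpM2r.
Unshelve. all: by end_near. Qed.

(** The discretized pairings are sums of products of a function of the first variable and one of the
    second; joint measurability passes to their pointwise limit. *)
Lemma pair_jointly_measurable d1 d2 (T1 : measurableType d1) (T2 : measurableType d2)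
    (D1 : set T1) (D2 : set T2) (h : T1 -> K -> R) (nu : T2 -> Mplus K) :
  measurable D1 -> measurable D2 ->
  (forall b, D1 b -> continuous (h b)) -> (forall x, measurable_fun D1 (h ^~ x)) ->
  (forall f, continuous f -> measurable_fun D2 (fun z => pair f (nu z))) ->
  measurable_fun (D1 `*` D2) (fun bz => pair (h bz.1) (nu bz.2)).
Proof.
move=> mD1 mD2 ch mh mnu; have [n [x [chi [cchi _ cvg]]]] := pair_discretization.
apply: (@measurable_fun_cvg _ _ _ _ (fun m bz => \sum_(i < n m) h bz.1 (x m i) * pair (chi m i) (nu bz.2))).
  move=> m; apply: measurable_sum => i; apply: measurable_funM.
    apply: (@measurable_comp _ _ _ _ _ _ D1 (fun b => h b (x m i)) _ fst) => //; last exact: measurable_funTS.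
    by move=> _ [[b z] [] /= ? _ <-].
  apply: (@measurable_comp _ _ _ _ _ _ D2 (fun z => pair (chi m i) (nu z)) _ snd) => //.
  - by move=> _ [[b z] [] /= _ ? <-].
  - exact: mnu.
  - exact: measurable_funTS.
by move=> [b z] [/= Db _]; apply: cvg; exact: ch.
Qed.

(** By continuity of [h b] the bound need only be checked at the dense sequence of centres, a
    countable intersection. *)
Lemma measurable_normle d1 (T1 : measurableType d1) (D1 : set T1)
    (h : T1 -> K -> R) (c : R) : measurable D1 ->
  (forall b, D1 b -> continuous (h b)) -> (forall x, measurable_fun D1 (h ^~ x)) ->
  measurable (D1 `&` [set b | forall x, `|h b x| <= c]).
Proof.
move=> mD1 ch mh; have [n [x [chi [_ dense _]]]] := pair_discretization.
rewrite (_ : _ `&` _ = \bigcap_m \bigcap_i (D1 `&` [set b | `|h b (x m i)| <= c])).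
  apply: bigcapT_measurable => m; apply: bigcapT_measurable => i.
  rewrite (_ : [set b | _] = (fun b => `|h b (x m i)|) @^-1` `]-oo, c]); last first.
    by apply/seteqP; split => b /=; rewrite in_itv.
  have mm : measurable_fun D1 (fun b => `|h b (x m i)|).
    by apply: measurableT_comp => //; exact: mh.
  exact: mm.
apply/seteqP; split => [b [Db hb] m _ i _|b hb]; first by split => //; exact: hb.
have Db : D1 b by have [] := hb 0%N I 0%N I.
split => // y; apply/ler_addgt0Pr => e e0.
have /cvgrPdist_le/(_ e e0) /nbhs_ballP[r /= r0 hr] := ch b Db y.
have [m [i /ball_sym/hr yx]] := dense y r r0.
have [_ /= xc] := hb m I i I.
by rewrite addrC -[h b y](subrK (h b (x m i))) (le_trans (ler_normD _ _))// lerD.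
Qed.


Section uniform_bound.
Context (S : R) (r : R -> K -> R).
Notation leb := (@lebesgue_measure R).
Hypothesis S0 : 0 <= S.
Hypothesis cr : forall s, 0 <= s <= S -> continuous (r s).
Hypothesis ri : forall nu : Mplus K,
  leb.-integrable `[0, S] (EFin \o (fun s => pair (r s) nu)).

(** Testing against point masses turns a hypothesis on all pairings into one on the values at each
    point. *)
Lemma dirac_Mplus (x : K) :
  exists nu : Mplus K, forall h : K -> R, continuous h -> pair h nu = h x.
Proof.
exists [the {finite_measure set _ -> \bar R} of @dirac _ (Kborel K) x R] => h ch.
rewrite /pair integral_dirac//; first by rewrite diracT mul1e.
by apply/measurable_EFinP; exact: measurable_Kborel.
Qed.

End uniform_bound.

(** Taking [C] to be a bound of [h] reduces identities for scaled and summed measures to nonnegative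
    integrands. *)
Lemma pair_shift C h nu : continuous h -> pair h nu = pair (fun x => h x + C) nu - C * mass nu.
Proof.
by move=> ch; rewrite pairD// ?pair_cst ?addrK//; exact: continuous_cst.
Qed.

Lemma scale_Mplus (a : R) nu : 0 <= a ->
  exists nu' : Mplus K, forall h, continuous h -> pair h nu' = a * pair h nu.
Proof.
move=> a0; pose nu' : Mplus K :=
  [the {finite_measure set _ -> \bar R} of mscale (NngNum a0) nu].
have pos h : continuous h -> (forall x, 0 <= h x) -> pair h nu' = a * pair h nu.
  move=> ch h0; rewrite /pair ge0_integral_mscale//=; last 2 first.
  - by apply/measurable_EFinP; exact: measurable_Kborel.
  - by move=> x _; rewrite lee_fin.
  by rewrite fineM//; apply: integrable_fin_num => //; exact: integrable_continuous.
have mE : mass nu' = a * mass nu by apply: pos => //; exact: continuous_cst.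
exists nu' => h ch; have [C C0 hC] := continuous_bounded Kcpt ch.
rewrite (@pair_shift C h nu')// (@pair_shift C h nu)// mE pos; first by rewrite mulrBr mulrCA.
  by move=> x; apply: cvgD; [exact: ch|exact: cvg_cst].
by move=> x; have := hC x; rewrite ler_norml => /andP[]; rewrite -subr_ge0 opprK.
Qed.

Section series_measure.
Variable nu_ : nat -> Mplus K.
Let m_ k : {measure set (Kborel K) -> \bar R} := nu_ k.
Let m := mseries m_ 0.
Hypothesis mT : (m setT < +oo)%E.
Let m_fin : fin_num_fun m. Proof. exact: lty_fin_num_fun. Qed.
HB.instance Definition _ := Measure.on m.
HB.instance Definition _ := @Measure_isFinite.Build _ _ _ m m_fin.

Let series_ge0 : exists mu : Mplus K, forall h, continuous h -> (forall x, 0 <= h x) ->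
  \sum_(k < n) pair h (nu_ k) @[n --> \oo] --> pair h mu.
Proof.
exists [the {finite_measure set _ -> \bar R} of m] => h ch h0.
have mh : measurable_fun setT (EFin \o (h : Kborel K -> R)).
  by apply/measurable_EFinP; exact: measurable_Kborel.
have fin : (\int[m]_x (h x)%:E)%E \is a fin_num.
  apply: integrable_fin_num => //.
  exact: (@integrable_continuous _ _ Kcpt h [the {finite_measure set _ -> \bar R} of m]).
rewrite {2}/pair.
have E : (\int[m]_x (h x)%:E = \sum_(n <oo) \int[m_ n]_x (h x)%:E)%E.
  by apply: ge0_integral_measure_series => // x _; rewrite lee_fin.
have : ((\sum_(0 <= k < n) \int[m_ k]_x (h x)%:E)%E @[n --> \oo] --> (\int[m]_x (h x)%:E)%E).
  by rewrite E; apply: is_cvg_nneseries => k _ _; apply: integral_ge0 => x _; rewrite lee_fin.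
rewrite -[X in _ --> X -> _]fineK// => /fine_cvg.
apply: cvg_trans; apply: near_eq_cvg; apply: nearW => n /=.
rewrite big_mkord /pair sum_fine// => k _.
by apply: integrable_fin_num => //; exact: integrable_continuous.
Qed.

Lemma series_Mplus : exists mu : Mplus K, forall h, continuous h ->
  \sum_(k < n) pair h (nu_ k) @[n --> \oo] --> pair h mu.
Proof.
have [mu muP] := series_ge0; exists mu => h ch.
have [C C0 hC] := continuous_bounded Kcpt ch.
rewrite (@pair_shift C h mu)//.
rewrite (_ : (fun n => _) = fun n => \sum_(k < n) pair (fun x => h x + C) (nu_ k) -
    C * \sum_(k < n) mass (nu_ k)); last first.
  apply/funext => n; rewrite mulr_sumr -sumrB; apply: eq_bigr => k _.
  exact: pair_shift.
apply: cvgB; last by apply: cvgMr; apply: muP => //; exact: continuous_cst.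
apply: muP; first by move=> x; apply: cvgD; [exact: ch|exact: cvg_cst].
by move=> x; have := hC x; rewrite ler_norml => /andP[]; rewrite -subr_ge0 opprK.
Qed.

End series_measure.

Lemma summable_Mplus (nu_ : nat -> Mplus K) (C : R) :
  (forall n, \sum_(k < n) mass (nu_ k) <= C) ->
  exists mu : Mplus K, forall h, continuous h ->
    \sum_(k < n) pair h (nu_ k) @[n --> \oo] --> pair h mu.
Proof.
move=> nuC; apply: series_Mplus.
have -> : mseries (fun k => nu_ k : {measure set (Kborel K) -> \bar R}) 0 setT =
    (\sum_(k <oo) (mass (nu_ k))%:E)%E.
  apply: eq_eseriesr => k _; rewrite /mass /pair integral_cst// mul1e fineK//.
  exact: fin_num_measure.
apply: (@le_lt_trans _ _ C%:E); last exact: ltry.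
apply: lime_le; first by apply: is_cvg_nneseries => k _ _; rewrite lee_fin mass_ge0.
by apply: nearW => n; rewrite sumEFin lee_fin big_mkord.
Qed.

End discretization.

(** * A uniform bound for time-integrated pairings *)

Section uniform_bound.
Context (R : realType) (K : pseudoPMetricType R).
Hypothesis Kcpt : compact [set: K].
Context (S : R) (r : R -> K -> R).
Notation leb := (@lebesgue_measure R).
Hypothesis S0 : 0 <= S.
Hypothesis cr : forall s, 0 <= s <= S -> continuous (r s).
Hypothesis ri : forall nu : Mplus K,
  leb.-integrable `[0, S] (EFin \o (fun s => pair (r s) nu)).

Let le_of_sub1 (x y z : R) : x - y <= 1 -> z + 1 < x -> z <= y.
Proof. lra. Qed.

Let half_telescope (u a b c m : R) : u <= a - b -> m <= b / 2 -> c <= b / 2 ->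
  u + m <= a - c.
Proof. lra. Qed.

Let I0S : set (measurableTypeR R) := [set` `[0, S]].
Let mI : measurable I0S. Proof. exact: measurable_itv. Qed.

Lemma measurable_coord x : measurable_fun I0S (r ^~ x).
Proof.
have [nu nuP] := dirac_Mplus x.
have : measurable_fun I0S (fun s => pair (r s) nu).
  by apply/measurable_EFinP; exact: (measurable_int _ (ri nu)).
apply: eq_measurable_fun => s; rewrite inE /I0S/= in_itv/= => sS.
by rewrite nuP//; exact: cr.
Qed.

(** On [Sn n] the pairing with [r s] is at most [n] times the mass, so that a perturbation of small
    mass is harmless there. *)
Let Sn (n : nat) := I0S `&` [set s | forall x, `|r s x| <= n%:R].

Let mSn n : measurable (Sn n).
Proof.
apply: (measurable_normle Kcpt) => //; last exact: measurable_coord.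
Qed.

Let norm_int (f : R -> R) : leb.-integrable I0S (EFin \o f) ->
  leb.-integrable I0S (EFin \o (fun s => `|f s|)).
Proof. by move=> fi; exact: integrable_norm fi. Qed.

Let indic_int (f : R -> R) n : leb.-integrable I0S (EFin \o f) ->
  leb.-integrable I0S (EFin \o (fun s => `|f s| * \1_(Sn n) s)).
Proof.
move=> fi; apply: le_integrableR (norm_int fi) => //.
  apply: measurable_funM; last exact: measurable_indic.
  have mf : measurable_fun I0S f.
    by apply/measurable_EFinP; exact: (measurable_int _ fi).
  exact: measurableT_comp.
move=> s _; rewrite normrM normr_id indicE.
by case: (_ \in _); rewrite ?normr1 ?normr0 ?mulr1 ?mulr0.
Qed.

(** One hump: [A] is the pairing of the measures chosen so far and [eta] the mass still available;
    [y.1] is the next measure and [y.2] the mass left for all later ones. *)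
Let step (A : R -> R) (eta : R) (k : nat) :
  (forall C, exists nu : Mplus K,
    C * mass nu < \int[leb]_(s in I0S) `|pair (r s) nu|) ->
  leb.-integrable I0S (EFin \o A) -> 0 < eta ->
  exists y : Mplus K * R, [/\ mass y.1 <= eta / 2, 0 < y.2, y.2 <= eta / 2 &
    exists n : nat, n%:R * y.2 * S <= 1 /\
      k.+1%:R <= \int[leb]_(s in I0S) (`|A s + pair (r s) y.1| * \1_(Sn n) s)].
Proof.
move=> unb Ai eta0; have e20 : 0 < eta / 2 by rewrite divr_gt0.
set a := \int[leb]_(s in I0S) `|A s|.
(* Rescaled to mass [eta / 2], this measure has pairing of norm above [a + k + 2]. Adding [A] costs
   [a], truncating to [Sn n] costs 1, and the later humps will cost 1 more, leaving [k]. *)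
have [nu0 nu0P] := unb ((a + k.+2%:R) / (eta / 2)).
have m0 : 0 < mass nu0.
  rewrite lt_neqAle mass_ge0 andbT eq_sym; apply/eqP => m0; move: nu0P.
  rewrite m0 mulr0 (_ : \int[_]_(_ in _) _ = \int[leb]_(s in I0S) 0).
    by rewrite Rintegral_cst// mul0r ltxx.
  apply: eq_Rintegral => s; rewrite inE /I0S/= in_itv/= => sS.
  have [C _ hC] := continuous_bounded Kcpt (cr sS).
  apply/eqP; rewrite -normr_le0 normr_id.
  by rewrite (le_trans (norm_pair_le Kcpt nu0 (cr sS) hC))// m0 mulr0.
have [nu nuP] := scale_Mplus Kcpt nu0 (ltW (divr_gt0 e20 m0)).
have mE : mass nu = eta / 2.
  by rewrite /mass nuP -/(mass _) ?divfK ?gt_eqF//; exact: continuous_cst.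
have Bi := ri nu.
have pnu : a + k.+2%:R < \int[leb]_(s in I0S) `|pair (r s) nu|.
  rewrite [ltRHS](_ : _ = (eta / 2 / mass nu0) * \int[leb]_(s in I0S) `|pair (r s) nu0|).
    have := nu0P; rewrite -(ltr_pM2l (divr_gt0 e20 m0)); apply: le_lt_trans.
    rewrite le_eqVlt; apply/orP; left; apply/eqP; field.
    by rewrite !gt_eqF.
  rewrite -RintegralZl//; last exact: norm_int (ri nu0).
  apply: eq_Rintegral => s; rewrite inE /I0S/= in_itv/= => sS.
  rewrite nuP; last exact: cr.
  by rewrite normrM (@ger0_norm _ (eta / 2 / mass nu0))// ltW// divr_gt0.
have ABi : leb.-integrable I0S (EFin \o (fun s => A s + pair (r s) nu)) by exact: integrableRD.
have big : k.+2%:R < \int[leb]_(s in I0S) `|A s + pair (r s) nu|.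
  rewrite -(ltrD2l a); apply: lt_le_trans pnu _.
  rewrite -RintegralD//; [|exact: norm_int..].
  apply: le_Rintegral => //; first exact: norm_int.
    by apply: integrableRD => //; exact: norm_int.
  move=> s _; rewrite -[X in `|X| <= _](addKr (A s)) (le_trans (ler_normD _ _))//.
  by rewrite normrN.
(* Each [r s] is bounded on the compact space, so the sets [Sn n] exhaust the time interval. *)
have lim : \int[leb]_(s in I0S) (`|A s + pair (r s) nu| * \1_(Sn n) s) @[n --> \oo] -->
    \int[leb]_(s in I0S) `|A s + pair (r s) nu|.
  apply: (@Rdominated_cvg _ _ _ leb I0S _ _ (fun s => `|A s + pair (r s) nu|)) => //.
  - by move=> n; apply/measurable_EFinP; exact: (measurable_int _ (indic_int n ABi)).
  - by apply/measurable_EFinP; exact: (measurable_int _ (norm_int ABi)).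
  - apply: aeW => s; rewrite /I0S /= in_itv/= => sS; apply/cvgrPdist_le => e e0.
    have [C C0 hC] := continuous_bounded Kcpt (cr sS).
    near=> n; rewrite indicE mem_set; first by rewrite mulr1 subrr normr0 ltW.
    split; first by rewrite /I0S/= in_itv.
    move=> x /=; rewrite (le_trans (hC x))//; near: n; exact: nbhs_infty_ger.
  - exact: norm_int.
  - move=> n s _; rewrite normrM normr_id indicE.
    by case: (_ \in _); rewrite ?normr1 ?normr0 ?mulr1 ?mulr0.
have [n nP] : exists n : nat, k.+1%:R <=
    \int[leb]_(s in I0S) (`|A s + pair (r s) nu| * \1_(Sn n) s).
  have /cvgrPdist_le/(_ 1 ltr01)[n _ /(_ n (leqnn n))/=] := lim.
  rewrite ler_norml => /andP[_ h]; exists n.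
  by apply: le_of_sub1 h _; rewrite natr1.
have nS0 : 0 < n%:R * S + 1 by rewrite ltr_wpDl// mulr_ge0.
(* With this budget, later humps alter the integral over [Sn n] by at most 1; the summand 1 in the
   denominator covers the case [n * S = 0]. *)
exists (nu, minr (eta / 2) (n%:R * S + 1)^-1); split => /=.
- by rewrite mE.
- by rewrite lt_min e20 invr_gt0.
- by rewrite ge_min lexx.
exists n; split => //; rewrite mulrAC.
apply: (@le_trans _ _ (n%:R * S * (n%:R * S + 1)^-1)).
  by rewrite ler_wpM2l ?mulr_ge0// ge_min lexx orbT.
by rewrite ler_pdivrMr// mul1r lerDl.
Unshelve. all: by end_near. Qed.

(* Banach--Steinhaus by a gliding hump: if no constant worked, a rapidly
   convergent series of measures would have a non-integrable pairing. *)
Lemma uniform_integral_bound : exists2 C, 0 <= C &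
  forall nu : Mplus K, \int[leb]_(s in `[0, S]) `|pair (r s) nu| <= C * mass nu.
Proof.
apply: contrapT => noC.
have unb C : exists nu : Mplus K, C * mass nu < \int[leb]_(s in I0S) `|pair (r s) nu|.
  apply: contrapT => no; apply: noC; exists `|C| => // nu.
  apply: (@le_trans _ _ (C * mass nu)); last by rewrite ler_wpM2r ?mass_ge0// ler_norm.
  by rewrite leNgt; apply/negP => h; apply: no; exists nu.
have /choice[f fP] : forall x : (R -> R) * R * nat, exists y : Mplus K * R,
    leb.-integrable I0S (EFin \o x.1.1) -> 0 < x.1.2 ->
    [/\ mass y.1 <= x.1.2 / 2, 0 < y.2, y.2 <= x.1.2 / 2 &
    exists n : nat, n%:R * y.2 * S <= 1 /\ x.2.+1%:R <=
      \int[leb]_(s in I0S) (`|x.1.1 s + pair (r s) y.1| * \1_(Sn n) s)].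
  move=> [[A eta] k] /=.
  have [[Ai eta0]|no] := pselect (leb.-integrable I0S (EFin \o A) /\ 0 < eta).
    by have [y yP] := step k unb Ai eta0; exists y.
  exists ([the {finite_measure set (Kborel K) -> \bar R} of mzero], 0) => Ai e0.
  by exfalso; exact: no.
(* The state consists of the pairing of the humps chosen so far and the mass left for the later
   ones. *)
pose st := fix st k : (R -> R) * R := match k with
  | 0%N => (fun _ => 0, 1)
  | k'.+1 => let y := f (st k', k') in
     (fun s => (st k').1 s + pair (r s) y.1, y.2) end.
pose nu_ k := (f (st k, k)).1.
have stP k : leb.-integrable I0S (EFin \o (st k).1) /\ 0 < (st k).2.
  elim: k => [|k [Ai e0]] /=.
    by split => //; apply: integrable_cstR => //; exact: lebesgue_itvcc_lty.
  have [_ ? _ _] := fP (st k, k) Ai e0; split => //.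
  exact: (integrableRD mI Ai (ri _)).
have fk k := fP (st k, k) (stP k).1 (stP k).2.
have stE k s : (st k).1 s = \sum_(j < k) pair (r s) (nu_ j).
  by elim: k => [|k IH] /=; rewrite ?big_ord0// big_ord_recr /= -IH.
(* The new hump and the new budget each take at most half of the old budget, so the masses
   telescope. *)
have tail k m : \sum_(k <= j < k + m) mass (nu_ j) <= (st k).2 - (st (k + m)%N).2.
  elim: m => [|m IH]; first by rewrite !addn0 big_geq ?subrr.
  rewrite addnS big_nat_recr ?leq_addr//=.
  have [h1 _ h2 _] := fk (k + m)%N; exact: half_telescope IH h1 h2.
have [mu muP] : exists mu : Mplus K, forall h, continuous h ->
    \sum_(k < n) pair h (nu_ k) @[n --> \oo] --> pair h mu.
  apply: (summable_Mplus Kcpt (C := 1)) => n.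
  have := tail 0%N n; rewrite add0n big_mkord /= => /le_trans; apply.
  by rewrite lerBlDr lerDl ltW// (stP n).2.
set p := \int[leb]_(s in I0S) `|pair (r s) mu|.
have ple k : k%:R <= p.
  have [_ e0 _ [n [nS big]]] := fk k; rewrite /= in e0 nS big.
  set e := (f (st k, k)).2 in e0 nS.
  (* The humps after the [k]-th have total mass at most [e], hence total pairing at most [n * e] on
     [Sn n]. *)
  have near_mu s : Sn n s -> `|(st k.+1).1 s| - n%:R * e <= `|pair (r s) mu|.
    move=> [+ rn]; rewrite /I0S /= in_itv/= => sS.
    have cv : `|\sum_(j < m) pair (r s) (nu_ j)| @[m --> \oo] --> `|pair (r s) mu|.
      by apply: cvg_norm; apply: muP; exact: cr.
    rewrite -(cvg_lim _ cv)//; apply: limr_ge; first exact: cvgP cv.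
    exists k.+1 => // m /= km.
    rewrite -(subnKC km); set l := (m - k.+1)%N.
    rewrite -(big_mkord xpredT (fun j => pair (r s) (nu_ j))) (@big_cat_nat _ _ _ k.+1)//= ?leq_addr//.
    rewrite big_mkord -(stE k.+1 s).
    set t := \sum_(_ <= _ < _) _.
    have tn : `|t| <= n%:R * e.
      apply: le_trans (ler_norm_sum _ _ _) _.
      apply: (@le_trans _ _ (\sum_(k.+1 <= j < k.+1 + l) n%:R * mass (nu_ j))).
        by apply: ler_sum => j _; apply: norm_pair_le => //; exact: cr.
      rewrite -mulr_sumr ler_wpM2l// (le_trans (tail _ _))//.
      by rewrite lerBlDr lerDl ltW// (stP _).2.
    rewrite lerBlDr -[X in `|X| <= _](addrK t) (le_trans (ler_normB _ _))//.
    by rewrite lerD2l.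
  have mui := ri mu.
  have main : \int[leb]_(s in I0S) (`|(st k.+1).1 s| * \1_(Sn n) s - n%:R * e) <= p.
    apply: le_Rintegral => //.
    - apply: integrableRB => //; first exact: indic_int (stP k.+1).1.
      by apply: integrable_cstR => //; exact: lebesgue_itvcc_lty.
    - exact: norm_int.
    move=> s _; rewrite indicE; have [sn|sn] := pselect (Sn n s).
      by rewrite mem_set// mulr1 near_mu.
    rewrite memNset// mulr0 sub0r (le_trans _ (normr_ge0 _))//.
    by rewrite oppr_le0 mulr_ge0// ltW.
  move: main; rewrite RintegralB//; last 2 first.
  - exact: indic_int (stP k.+1).1.
  - by apply: integrable_cstR => //; exact: lebesgue_itvcc_lty.
  have muI : leb I0S = S%:E by rewrite -[in RHS](subr0 S); exact: lebesgue_itvcc.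
  have -> : \int[leb]_(_ in I0S) (n%:R * e) = n%:R * e * S.
    by rewrite Rintegral_cst//; congr (_ * _); exact: (congr1 fine muI).
  apply: le_trans.
  by rewrite lerBrDr (le_trans _ big)// -natr1 lerD2l.
have := ple (truncn `|p|).+1; rewrite leNgt => /negP; apply.
by rewrite (le_lt_trans (ler_norm p))// truncnS_gt.
Qed.

End uniform_bound.

(** * Stopped martingales and exit from an adapted event *)

Section sigma_algebra_facts.
Context (T : Type) (G : set (set T)).
Hypothesis sG : sigma_algebra setT G.

Lemma sigma_algebra_setC A : G A -> G (~` A).
Proof. by case: sG => _ h _ /h; rewrite setTD. Qed.

Lemma sigma_algebra_setbigcap (F : nat -> set T) : (forall n, G (F n)) -> G (\bigcap_n F n).
Proof.
move=> GF; rewrite -[X in G X]setCK setC_bigcap; apply: sigma_algebra_setC.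
by case: sG => _ _; apply => n; exact: sigma_algebra_setC.
Qed.

Lemma sigma_algebra_setI A B : G A -> G B -> G (A `&` B).
Proof.
move=> GA GB; rewrite -bigcap2E; apply: sigma_algebra_setbigcap.
move=> [|[|n]] //=; rewrite -setC0; apply: sigma_algebra_setC.
by case: sG.
Qed.

Lemma sigma_algebra_setD A B : G A -> G B -> G (A `\` B).
Proof. by move=> GA GB; rewrite setDE; apply: sigma_algebra_setI => //; exact: sigma_algebra_setC. Qed.

End sigma_algebra_facts.

Section optional_stopping.
Context d (Omega : measurableType d) (R : realType) (P : probability Omega R).
Variables (Fil : R -> set (set Omega)) (M : R -> Omega -> R).
Hypotheses (fil : filtration Fil) (mart : martingale P Fil M).

Let filS s t A : s <= t -> Fil s A -> Fil t A.
Proof. by move=> st; case: fil => _ [_ h]; exact: h. Qed.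

Let filM t A : Fil t A -> measurable A.
Proof. by case: fil => _ [h _]; exact: h. Qed.

Let filG t : sigma_algebra setT (Fil t). Proof. by case: fil. Qed.

Let Mi t : 0 <= t -> P.-integrable setT (EFin \o M t).
Proof. by case: mart => _ [h _]; exact: h. Qed.

Let MiA t A : 0 <= t -> measurable A -> P.-integrable A (EFin \o M t).
Proof. by move=> t0 mA; apply: integrableS (Mi t0). Qed.

Let mM t A : 0 <= t -> measurable_fun A (M t).
Proof.
by move=> t0; apply: measurable_funTS; apply/measurable_EFinP; exact: (measurable_int _ (Mi t0)).
Qed.

Lemma martingale_int s t A : 0 <= s -> s <= t -> Fil s A ->
  \int[P]_(w in A) M t w = \int[P]_(w in A) M s w.
Proof.
by move=> s0 st sA; case: mart => _ [_ /(_ _ _ s0 st)[_ _ _ h]]; rewrite /Rintegral h.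
Qed.

(** The submartingale property of [|M|]: the sign of [M s] splits [A] into two events of [Fil s],
    and on each of them [|M s|] is [M s] up to a fixed sign. *)
Lemma martingale_norm_int s t A : 0 <= s -> s <= t -> Fil s A ->
  \int[P]_(w in A) `|M s w| <= \int[P]_(w in A) `|M t w|.
Proof.
move=> s0 st sA; have t0 := le_trans s0 st; have mA := filM sA.
pose B := M s @^-1` `[0, +oo[.
have sB : Fil s B by case: mart => /(_ s s0) h _; exact: h.
have sAB : Fil s (A `&` B) by exact: sigma_algebra_setI.
have sAnB : Fil s (A `\` B) by exact: sigma_algebra_setD.
have split u : 0 <= u -> \int[P]_(w in A) `|M u w| =
    \int[P]_(w in A `&` B) `|M u w| + \int[P]_(w in A `\` B) `|M u w|.
  move=> u0; rewrite -[in LHS](setUIDK A B) Rintegral_setU//.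
  - exact: filM sAB.
  - exact: filM sAnB.
  - by rewrite setUIDK; apply: integrable_norm; exact: MiA.
  - by apply/disj_set2P; rewrite setDE setIACA setICr setI0.
rewrite !split//; apply: lerD.
- rewrite (_ : \int[_]_(_ in _) _ = \int[P]_(w in A `&` B) M s w); last first.
    apply: eq_Rintegral => w; rewrite inE => -[_]; rewrite /B/= in_itv/= andbT => M0.
    by rewrite ger0_norm.
  rewrite -(martingale_int s0 st)//; have mAB := filM sAB.
  apply: le_Rintegral => //; [exact: MiA|by apply: integrable_norm; exact: MiA|].
  by move=> w _; exact: ler_norm.
- rewrite (_ : \int[_]_(_ in _) _ = \int[P]_(w in A `\` B) (-1 * M s w)); last first.
    apply: eq_Rintegral => w; rewrite inE => -[_]; rewrite /B/= in_itv/= andbT => /negP.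
    by rewrite -ltNge => M0; rewrite ltr0_norm// mulN1r.
  have mAB := filM sAnB.
  rewrite RintegralZl//; last exact: MiA.
  rewrite -(martingale_int s0 st)// -RintegralZl//; last exact: MiA.
  apply: le_Rintegral => //.
  + by apply: integrableRZ => //; exact: MiA.
  + by apply: integrable_norm; exact: MiA.
  by move=> w _; rewrite mulN1r -normrN; exact: ler_norm.
Qed.

Section grid.
Variables (C : R -> set Omega) (s : nat -> R).
Hypotheses (s0 : forall k, 0 <= s k) (sS : forall k, s k <= s k.+1).
Hypothesis sC : forall k, Fil (s k) (C (s k)).

(* value of [M] when stopped at the first point of the grid [s k, ..., s (k + n)]
   lying outside [C], or at [s (k + n)] if there is none *)
Fixpoint grid_stop (n k : nat) (w : Omega) : R :=
  if n is n'.+1 then if w \in C (s k) then grid_stop n' k.+1 w else M (s k) w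
  else M (s k) w.

Lemma measurable_grid_stop n k : measurable_fun setT (grid_stop n k).
Proof.
elim: n k => [|n IH] k /=; first exact: mM.
apply: measurable_fun_ifT => //; last exact: mM.
apply: (measurable_fun_bool true); rewrite setTI.
by rewrite (_ : _ @^-1` _ = C (s k)) ?preimage_mem_true//; exact: filM (sC k).
Qed.

Let le_s k n : s k <= s (k + n)%N.
Proof. by elim: n => [|n IH]; rewrite ?addn0// addnS (le_trans IH). Qed.

Lemma integrable_grid_stop n k A : measurable A ->
  P.-integrable A (EFin \o grid_stop n k).
Proof.
move=> mA; apply: (@integrableS _ _ _ P setT) => //.
elim: n k => [|n IH] k /=; first exact: Mi.
have gi : P.-integrable setT (EFin \o (fun w => `|grid_stop n k.+1 w| + `|M (s k) w|)).
  by apply: integrableRD => //; apply: integrable_norm; [exact: IH|exact: Mi].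
apply: le_integrableR gi => //; first exact: (measurable_grid_stop n.+1 k).
by move=> w _ /=; case: ifP => _; rewrite ?lerDl ?lerDr.
Qed.

Let split (f : Omega -> R) A B : measurable A -> measurable B ->
    P.-integrable A (EFin \o f) ->
  \int[P]_(w in A) f w = \int[P]_(w in A `&` B) f w + \int[P]_(w in A `\` B) f w.
Proof.
move=> mA mB fi; rewrite -[in LHS](setUIDK A B) Rintegral_setU//.
- exact: measurableI.
- exact: measurableD.
- by rewrite setUIDK.
- by apply/disj_set2P; rewrite setDE setIACA setICr setI0.
Qed.

Lemma grid_stop_int n k A : Fil (s k) A ->
  \int[P]_(w in A) grid_stop n k w = \int[P]_(w in A) M (s k) w.
Proof.
elim: n k A => [//|n IH] k A sA.
have sAC : Fil (s k) (A `&` C (s k)) by exact: sigma_algebra_setI.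
have mA := filM sA; have mC := filM (sC k).
rewrite (split mA mC); last exact: integrable_grid_stop.
rewrite [RHS](split mA mC); last exact: MiA.
congr (_ + _).
  rewrite -(martingale_int (s0 k) (sS k))// -IH; last exact: filS (sS k) sAC.
  by apply: eq_Rintegral => w; rewrite inE => -[_ Cw] /=; rewrite mem_set.
by apply: eq_Rintegral => w; rewrite inE => -[_ Cw] /=; rewrite memNset.
Qed.

(** Uniform integrability of the stopped values over all grids: on the event of stopping at a given
    grid point, [|M|] is a submartingale from there on, so the tail is dominated by that of the
    fixed variable at the last time. *)
Lemma grid_stop_tail n k A (c : R) : Fil (s k) A ->
  \int[P]_(w in A `&` [set w | c < `|grid_stop n k w|]) `|grid_stop n k w| <=
  \int[P]_(w in A `&` [set w | c < `|grid_stop n k w|]) `|M (s (k + n)%N) w|.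
Proof.
elim: n k A => [|n IH] k A sA; first by rewrite addn0.
have sAC : Fil (s k) (A `&` C (s k)) by exact: sigma_algebra_setI.
have sAD : Fil (s k) (A `\` C (s k)) by exact: sigma_algebra_setD.
have mA := filM sA; have mC := filM (sC k).
have mG m j : measurable [set w | c < `|grid_stop m j w|].
  rewrite (_ : [set _ | _] = (fun w => `|grid_stop m j w|) @^-1` `]c, +oo[); last first.
    by apply/seteqP; split => w /=; rewrite in_itv/= andbT.
  rewrite -[X in measurable X]setTI.
  have : measurable_fun setT (fun w => `|grid_stop m j w|).
    by apply: measurableT_comp => //; exact: measurable_grid_stop.
  by apply.
set B := [set w | _].
have mAB : measurable (A `&` B) by apply: measurableI => //; exact: mG.
rewrite (split mAB mC); last by apply: integrable_norm; exact: integrable_grid_stop.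
rewrite [leRHS](split mAB mC); last by apply: integrable_norm; exact: MiA.
have EC : A `&` B `&` C (s k) = A `&` C (s k) `&` [set w | c < `|grid_stop n k.+1 w|].
  apply/seteqP; rewrite /B /=; split=> w /= [].
    by move=> [Aw h] Cw; move: h; rewrite (mem_set Cw) => h; exact: (conj (conj Aw Cw) h).
  by move=> [Aw Cw] h; rewrite (mem_set Cw); exact: (conj (conj Aw h) Cw).
have ED : (A `&` B) `\` C (s k) = (A `\` C (s k)) `&` [set w | c < `|M (s k) w|].
  apply/seteqP; rewrite /B /=; split=> w /= [].
    by move=> [Aw h] Cw; move: h; rewrite (memNset Cw) => h; exact: (conj (conj Aw Cw) h).
  by move=> [Aw Cw] h; rewrite (memNset Cw); exact: (conj (conj Aw h) Cw).
apply: lerD.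
  rewrite EC -addSnnS; apply: le_trans _ (IH _ _ (filS (sS k) sAC)).
  rewrite le_eqVlt; apply/orP; left; apply/eqP.
  by apply: eq_Rintegral => w; rewrite inE => -[[_ Cw] _] /=; rewrite mem_set.
rewrite ED; apply: (@le_trans _ _
    (\int[P]_(w in (A `\` C (s k)) `&` [set w | c < `|M (s k) w|]) `|M (s k) w|)).
  rewrite le_eqVlt; apply/orP; left; apply/eqP.
  by apply: eq_Rintegral => w; rewrite inE => -[[_ Cw] _] /=; rewrite memNset.
apply: martingale_norm_int => //; apply: sigma_algebra_setI => //.
rewrite (_ : [set _ | _] = M (s k) @^-1` (`]c, +oo[ `|` `]-oo, -c[)); last first.
  by apply/seteqP; split => w /=; rewrite !in_itv/= andbT lter_normr ltrNr => /orP.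
case: mart => /(_ _ (s0 k)) h _; apply: h; exact: measurableU.
Qed.

End grid.

(** The first grid point outside [C] overshoots the exit time [sg] by at most one mesh, and never
    falls before it. *)
Lemma grid_stop_at C (s : nat -> R) w (sg h : R) n k :
  (forall j, s j.+1 = s j + h) ->
  (forall j, (k <= j <= k + n)%N -> s j < sg -> C (s j) w) ->
  (forall j, (k <= j <= k + n)%N -> C (s j) w -> s j <= sg) ->
  s k <= sg + h -> sg <= s (k + n)%N ->
  exists2 e, sg <= e <= sg + h & grid_stop C s n k w = M e w.
Proof.
move=> sh; elim: n k => [|n IH] k Clt Cle sk skn /=.
  by exists (s k) => //; rewrite sk andbT; move: skn; rewrite addn0.
have kk : (k <= k <= k + n.+1)%N by rewrite leqnn leq_addr.
case: ifPn => [/set_mem Ck|/negP Ck].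
  apply: IH; rewrite ?addSnnS//.
  - by move=> j /andP[kj jn]; apply: Clt; rewrite (ltnW kj).
  - by move=> j /andP[kj jn]; apply: Cle; rewrite (ltnW kj).
  - by rewrite sh lerD2r; exact: Cle.
exists (s k) => //; rewrite sk andbT leNgt; apply/negP => ks.
by apply: Ck; rewrite inE; exact: Clt.
Qed.

(** The exit time [sg] is not known to be a stopping time, but its grid approximations are discrete
    ones lying to its right. Right-continuity gives pointwise convergence of the stopped values, and
    the tail estimate at time [b] allows passing to the limit in the integral. *)
Lemma optional_exit (C : R -> set Omega) (A : set Omega) (sg : Omega -> R) (a b c : R) :
  0 <= a -> a <= b -> Fil a A -> (forall q, a <= q <= b -> Fil q (C q)) ->
  (forall w, A w -> [/\ a <= sg w <= b,
     forall q, a <= q <= b -> q < sg w -> C q w,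
     forall q, a <= q <= b -> C q w -> q <= sg w,
     (M ^~ w) @ at_right (sg w) --> M (sg w) w & `|M (sg w) w| <= c]) ->
  measurable_fun A (fun w => M (sg w) w) /\
  \int[P]_(w in A) M (sg w) w = \int[P]_(w in A) M a w.
Proof.
move=> a0 ab aA aC H; have mA := filM aA.
have b0 := le_trans a0 ab.
(* Adaptedness of [C] is known on [[a, b]] only; freezing it after [b] makes all grid indices
   admissible. *)
pose C' q := C (minr q b).
pose h (n : nat) := (b - a) / n.+1%:R.
have h0 n : 0 <= h n by rewrite divr_ge0// subr_ge0.
pose s (n k : nat) := a + h n * k%:R.
have sa n k : a <= s n k by rewrite lerDl mulr_ge0.
have s0 n k : 0 <= s n k by exact: le_trans (sa n k).
have sh n j : s n j.+1 = s n j + h n by rewrite /s -natr1 mulrDr mulr1 addrA.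
have sS n k : s n k <= s n k.+1 by rewrite sh lerDl.
have sb n : s n n.+1 = b by rewrite /s /h divfK// subrKC.
have sle n k : (k <= n.+1)%N -> s n k <= b.
  by move=> kn; rewrite -(sb n) /s lerD2l ler_wpM2l// ler_nat.
have sC' n k : Fil (s n k) (C' (s n k)).
  rewrite /C'; have [sbk|bs] := leP (s n k) b; first by apply: aC; rewrite sa.
  by apply: filS (ltW bs) _; apply: aC; rewrite ab lexx.
pose U n := grid_stop C' (s n) n.+1 0.
have Ulim w : A w -> U n w @[n --> \oo] --> M (sg w) w.
  move=> Aw; have [/andP[asg sgb] Clt Cle rc _] := H w Aw.
  have UE n : exists2 e, sg w <= e <= sg w + h n & U n w = M e w.
    apply: grid_stop_at => //.
    - by move=> j; rewrite add0n => /andP[_ jn] ?; rewrite /C' min_l ?sle//; apply: Clt; rewrite ?sa ?sle.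
    - move=> j; rewrite add0n => /andP[_ jn]; rewrite /C' min_l ?sle// => ?.
      by apply: Cle; rewrite ?sa ?sle.
    - by rewrite /s mulr0 addr0 (le_trans asg)// lerDl.
    - by rewrite add0n sb.
  apply/cvgrPdist_le => e e0; move/cvgrPdist_le : rc => /(_ e e0).
  rewrite /at_right => -[r /= r0 hr].
  have hlim : h n @[n --> \oo] --> 0.
    by rewrite -[X in _ --> X](mulr0 (b - a)); apply: cvgMr; exact: cvg_harmonic.
  move/cvgrPdist_lt : hlim => /(_ r r0); apply: filterS => n.
  rewrite sub0r normrN ger0_norm// => hn.
  have [u /andP[su us] ->] := UE n.
  move: su; rewrite le_eqVlt => /predU1P[<-|su]; first by rewrite subrr normr0 ltW.
  apply: hr => //=; rewrite ler0_norm ?subr_le0 ?(ltW su)// opprB.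
  by rewrite ltrBlDl (le_lt_trans us)// ltrD2l.
have mU n : measurable_fun setT (U n) by apply: measurable_grid_stop => // k; exact: sC'.
have mUA n : measurable_fun A (U n) by exact: measurable_funTS.
have mL : measurable_fun A (fun w => M (sg w) w) by apply: measurable_fun_cvg Ulim.
split=> //.
(* The limit is bounded by [c], so [U n w] exceeds [c + 1] for finitely many [n] only. Below, [V] is
   the part of [U] bounded by this level, and [Q] dominates the remaining part in mean. *)
pose B n := [set w | c + 1 < `|U n w|].
have mB n : measurable (B n).
  rewrite (_ : B n = (fun w => `|U n w|) @^-1` `]c + 1, +oo[); last first.
    by apply/seteqP; split => w /=; rewrite /B/= in_itv/= andbT.
  rewrite -[X in measurable X]setTI.
  have : measurable_fun setT (fun w => `|U n w|) by apply: measurableT_comp.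
  by apply.
have Bout w : A w -> \forall n \near \oo, ~ B n w.
  move=> Aw; have [_ _ _ _ Mc] := H w Aw.
  have /cvgrPdist_lt/(_ 1 ltr01) := Ulim w Aw; apply: filterS => n hn.
  apply/negP; rewrite -leNgt -[U n w](subrK (M (sg w) w)) addrC.
  by rewrite (le_trans (ler_normD _ _))// lerD// distrC ltW.
have Ui n : P.-integrable A (EFin \o U n).
  by apply: integrable_grid_stop => // k; exact: sC'.
pose V n w := U n w * \1_(~` B n) w.
have mV n : measurable_fun A (V n).
  by apply: measurable_funM => //; apply: measurable_indic; exact: measurableC.
have AP : (P A < +oo)%E by rewrite (le_lt_trans (probability_le1 _ _))// ltry.
have Vb n w : A w -> `|V n w| <= `|c + 1|.
  move=> _; rewrite /V indicE; have [Bw|Bw] := pselect (B n w).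
    by rewrite memNset ?mulr0 ?normr0//= ; apply: contrapT => /= nB; exact: nB.
  by rewrite mem_set// mulr1 (le_trans _ (ler_norm _))// leNgt; exact/negP.
have Vlim : \int[P]_(w in A) V n w @[n --> \oo] --> \int[P]_(w in A) M (sg w) w.
  apply: (@Rdominated_cvg _ _ _ P A _ _ (fun _ => `|c + 1|)) => //.
  - apply: aeW => w Aw; apply: cvg_trans (Ulim w Aw); apply: near_eq_cvg.
    have := Bout w Aw; apply: filterS => n Bn.
    by rewrite /V indicE mem_set ?mulr1.
  - exact: integrable_cstR.
pose Q n w := `|M b w| * \1_(B n) w.
have Qlim : \int[P]_(w in A) Q n w @[n --> \oo] --> (0 : R).
  rewrite -[X in _ --> X](_ : \int[P]_(w in A) (0 : R) = 0); last first.
    by rewrite Rintegral_cst// mul0r.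
  apply: (@Rdominated_cvg _ _ _ P A _ _ (fun w => `|M b w|)) => //.
  - move=> n; apply: measurable_funM; last exact: measurable_indic.
    by apply: measurableT_comp => //; exact: mM.
  - apply: aeW => w Aw; apply: (@cvg_trans _ ((fun _ : nat => 0 : R) @ \oo)); last exact: cvg_cst.
    apply: near_eq_cvg; have := Bout w Aw; apply: filterS => n Bn.
    by rewrite /Q indicE memNset ?mulr0.
  - by apply: integrable_norm; exact: MiA.
  - move=> n w _; rewrite /Q normrM normr_id indicE.
    by case: (_ \in _); rewrite ?normr1 ?normr0 ?mulr1 ?mulr0.
have UE n : \int[P]_(w in A) U n w = \int[P]_(w in A) M a w.
  have sn0 : s n 0%N = a by rewrite /s mulr0 addr0.
  by rewrite (grid_stop_int (s0 n) (sS n) (sC' n)) sn0.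
have UVQ n : `|\int[P]_(w in A) M a w - \int[P]_(w in A) V n w| <= \int[P]_(w in A) Q n w.
  have Vi : P.-integrable A (EFin \o V n) by exact: bounded_integrableR (Vb n).
  have UVi : P.-integrable A (EFin \o (fun w => `|U n w| * \1_(B n) w)).
    apply: le_integrableR (integrable_norm (Ui n)) => //.
      apply: measurable_funM; last exact: measurable_indic.
      exact: measurableT_comp.
    move=> w _ /=; rewrite normrM normr_id indicE.
    by case: (w \in B n); rewrite ?normr1 ?normr0 ?mulr1 ?mulr0.
  rewrite -(UE n) -RintegralB//.
  apply: le_trans (le_normr_Rintegral _ (integrableRB mA (Ui n) Vi)) _ => //.
  apply: (@le_trans _ _ (\int[P]_(w in A) (`|U n w| * \1_(B n) w))).
    apply: le_Rintegral => //; first by apply: integrable_norm; exact: integrableRB.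
    move=> w _; rewrite /V !indicE in_setC.
    by case: (w \in B n) => /=; rewrite ?mulr1 ?mulr0 ?subr0 ?subrr ?normr0.
  have E (f : Omega -> R) : \int[P]_(w in A) (f w * \1_(B n) w) = \int[P]_(w in A `&` B n) f w.
    by rewrite Rintegral_mkcondr; apply: eq_Rintegral => w _; rewrite patch_indic.
  rewrite (E (fun w => `|U n w|)) /Q (E (fun w => `|M b w|)).
  have := @grid_stop_tail C' (s n) (s0 n) (sS n) (sC' n) n.+1 0 A (c + 1).
  by rewrite add0n sb; apply; rewrite /s mulr0 addr0.
have : `|\int[P]_(w in A) M a w - \int[P]_(w in A) V n w| @[n --> \oo] -->
    `|\int[P]_(w in A) M a w - \int[P]_(w in A) M (sg w) w|.
  by apply: cvg_norm; apply: cvgB => //; exact: cvg_cst.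
move=> L; apply/esym/eqP; rewrite -subr_eq0 -normr_le0.
rewrite -(cvg_lim _ L)// -(cvg_lim _ Qlim)//; apply: ler_lim.
- exact: cvgP L.
- exact: cvgP Qlim.
- exact: nearW.
Qed.

End optional_stopping.

Lemma itv_setT_lty d (Omega : measurableType d) (R : realType)
    (P : probability Omega R) (a b : R) :
  ((@lebesgue_measure R \x P) (`[a, b] `*` [set: Omega]) < +oo)%E.
Proof.
apply: (@le_lt_trans _ _ (@lebesgue_measure R `[a, b]%classic * P setT)%E).
  by rewrite le_eqVlt; apply/orP; left; apply/eqP; exact: product_measure1E.
by rewrite probability_setT mule1 lebesgue_itvcc_lty.
Qed.

Lemma lebesgue_itvco_lty (R : realType) (a b : R) :
  (@lebesgue_measure R `[a, b[%classic < +oo)%E.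
Proof. by rewrite lebesgue_measure_itv/=; case: ifP => // _; rewrite -EFinB ltry. Qed.

(** * Martingale increments up to the exit from a decreasing family of events *)

Section exit_estimate.
Context d (Omega : measurableType d) (R : realType) (P : probability Omega R).
Notation leb := (@lebesgue_measure R).
Variables (Fil : R -> set (set Omega)) (y l : R -> Omega -> R) (B : R -> set Omega).
Variables (c : R).
Hypotheses (fil : filtration Fil) (y01 : forall t w, 0 <= y t w <= 1)
  (yrc : forall t w, 0 <= t -> (y ^~ w) @ at_right t --> y t w)
  (my : forall t, 0 <= t -> measurable_fun setT (y t))
  (li : forall t w, 0 <= t -> leb.-integrable `[0, t] (EFin \o (l ^~ w)))
  (lmart : local_martingale P Fil (fun t w =>
     y t w - y 0 w - \int[leb]_(s in `[0, t]) l s w))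
  (FB : forall q, 0 <= q -> Fil q (B q))
  (Bdec : forall q q' w, 0 <= q -> q <= q' -> B q' w -> B q w)
  (c0 : 0 <= c) (lB : forall q w, 0 <= q -> B q w -> `|l q w| <= c).

Let N t w := y t w - y 0 w - \int[leb]_(s in `[0, t]) l s w.

Let I_cont w t : 0 <= t ->
  (fun q => \int[leb]_(s in `[0, q]) l s w) @ at_right t --> \int[leb]_(s in `[0, t]) l s w.
Proof.
move=> t0; have t1 : 0 <= t + 1 by rewrite addr_ge0.
have t01 : 0 < t + 1 by rewrite ltr_wpDl.
have := parameterized_integral_continuous t1 (li w t1).
move=> /(continuous_within_itvP _ t01)[cI c_r _].
move: t0; rewrite le_eqVlt => /predU1P[<-//|t0].
by apply: cvg_at_right_filter; apply: cI; rewrite in_itv/= t0 ltrDl ltr01.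
Qed.

Let N_cont w t : 0 <= t -> (N ^~ w) @ at_right t --> N t w.
Proof.
by move=> t0; apply: cvgB; [apply: cvgB; [exact: yrc|exact: cvg_cst]|exact: I_cont].
Qed.

(* [sg] is the exit time of [C] within [[a, b]] *)
Let exit (C : R -> set Omega) a b w := sup [set q | a <= q <= b /\ C q w].

Let exitP (C : R -> set Omega) a b w : 0 <= a -> a <= b -> C a w ->
  (forall q q', 0 <= q -> q <= q' -> C q' w -> C q w) ->
  [/\ a <= exit C a b w <= b,
     forall q, a <= q <= b -> q < exit C a b w -> C q w,
     forall q, a <= q <= b -> C q w -> q <= exit C a b w &
     C b w -> exit C a b w = b].
Proof.
move=> a0 ab Ca Cdec; set E := [set q | a <= q <= b /\ C q w].
have Ea : E a by split => //; rewrite lexx.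
have Eb : ubound E b by move=> q [/andP[]].
have hs : has_sup E by split; [exists a|exists b].
have le q : a <= q <= b -> C q w -> q <= sup E.
  by move=> qab Cq; apply: (ub_le_sup hs.2).
have aE : a <= sup E by apply: le => //; rewrite lexx.
have Eb' : sup E <= b by apply: ge_sup => //; exists a.
split => //; first by rewrite /exit aE.
- move=> q /andP[aq qb] qE; have qE' : 0 < sup E - q by rewrite subr_gt0.
  have [u [/andP[au ub] Cu] qu] := sup_adherent qE' hs.
  by apply: Cdec Cu; [exact: le_trans aq|move: qu; rewrite subKr => /ltW].
- by move=> Cb; apply/eqP; rewrite eq_le Eb'/= le// ab lexx.
Qed.

Variables (a b : R).
Hypotheses (a0 : 0 <= a) (ab : a <= b).
Hypothesis mlB : measurable_fun (`[a, b] `*` [set: Omega])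
  (fun qw : measurableTypeR R * Omega => l qw.1 qw.2 * \1_(B qw.1) qw.2).

Let b0 : 0 <= b. Proof. exact: le_trans ab. Qed.

Let lBb q w : 0 <= q -> `|l q w * \1_(B q) w| <= c.
Proof.
move=> q0; rewrite indicE; have [Bq|Bq] := pselect (B q w).
  by rewrite mem_set// mulr1 lB.
by rewrite memNset// mulr0 normr0.
Qed.

Let J w := \int[leb]_(q in `[a, b]) (l q w * \1_(B q) w).

Let prod_int : (leb \x P)%E.-integrable (`[a, b] `*` [set: Omega])
  (EFin \o (fun qw : measurableTypeR R * Omega => l qw.1 qw.2 * \1_(B qw.1) qw.2)).
Proof.
apply: (@bounded_integrableR _ _ _ _ _ _ _ _ (c)) => //.
- exact: measurableX.
- exact: itv_setT_lty.
- by move=> [q w] [/= +  _]; rewrite in_itv/= => /andP[aq _]; apply: lBb; exact: le_trans aq.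
Qed.

Let mJ : measurable_fun setT J.
Proof.
have mab : measurable ([set` `[a, b]] : set (measurableTypeR R)) by exact: measurable_itv.
have h := integrable_Rintegral21 mab measurableT prod_int.
apply/measurable_EFinP; exact: (measurable_int _ h).
Qed.

Let lBi w : leb.-integrable `[a, b] (EFin \o (fun q => l q w * \1_(B q) w)).
Proof.
apply: (@bounded_integrableR _ _ _ _ _ _ _ _ (c)) => //; first exact: lebesgue_itvcc_lty.
  pose F := fun qw : measurableTypeR R * Omega => (qw.1, qw.2).
  have := mlB; move=> h.
  apply: (@measurable_comp _ _ _ _ _ _ (`[a, b] `*` [set: Omega])
    (fun qw : measurableTypeR R * Omega => l qw.1 qw.2 * \1_(B qw.1) qw.2) _
    (fun q : measurableTypeR R => (q, w))) => //.
  - exact: measurableX.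
  - by move=> _ [q qab <-].
  - exact: measurable_funTS (pair2_measurable w).
by move=> q /=; rewrite in_itv/= => /andP[aq _]; apply: lBb; exact: le_trans aq.
Qed.

Let Jb w : `|J w| <= c * (b - a).
Proof.
have -> : b - a = fine (leb `[a, b]) by rewrite lebesgue_itvcc.
apply: Rintegral_bound => //; first exact: lebesgue_itvcc_lty.
  by apply/measurable_EFinP; exact: (measurable_int _ (lBi w)).
by move=> q /=; rewrite in_itv/= => /andP[aq _]; apply: lBb; exact: le_trans aq.
Qed.

Let l_int u v w : 0 <= u -> u <= v -> leb.-integrable `[u, v] (EFin \o (l ^~ w)).
Proof.
move=> u0 uv; apply: integrableS (li w (le_trans u0 uv)) => //.
by apply: subset_itvr; rewrite bnd_simp.
Qed.

Let lco_int u v w : 0 <= u -> u <= v -> leb.-integrable `[u, v[ (EFin \o (l ^~ w)).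
Proof.
by move=> u0 uv; apply: integrableS (l_int w u0 uv) => //; exact: subset_itv_co_cc.
Qed.

Let l_bound u v w : 0 <= u -> u <= v -> (forall q, u <= q -> q < v -> B q w) ->
  `|\int[leb]_(q in `[u, v]) l q w| <= c * (v - u).
Proof.
move=> u0 uv Bq; rewrite -Rintegral_itv_bndo_bndc; last exact: lco_int.
have -> : v - u = fine (leb `[u, v[).
  rewrite lebesgue_measure_itv/= lte_fin; case: ltgtP uv => // -> _; by rewrite subrr.
apply: Rintegral_bound => //.
- exact: lebesgue_itvco_lty.
- by apply/measurable_EFinP; exact: (measurable_int _ (lco_int w u0 uv)).
by move=> q /=; rewrite in_itv/= => /andP[uq qv]; apply: lB; [exact: le_trans uq|exact: Bq].
Qed.

(** The integrand is [l] strictly before [sg] and zero strictly after; at [sg] itself membership in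
    [B] is undetermined, and half-open intervals discard that point. *)
Let J_exit sg w : a <= sg <= b -> (forall q, a <= q <= b -> q < sg -> B q w) ->
  (forall q, a <= q <= b -> B q w -> q <= sg) -> J w = \int[leb]_(q in `[a, sg]) l q w.
Proof.
move=> /andP[asg sgb] Blt Ble; rewrite /J.
have fi := lBi w.
rewrite (Rintegral_cat asg sgb fi).
have fi1 : leb.-integrable `[a, sg[ (EFin \o (fun q => l q w * \1_(B q) w)).
  by apply: integrableS fi => //; apply: subset_itvl; rewrite bnd_simp.
have fi2 : leb.-integrable `]sg, b] (EFin \o (fun q => l q w * \1_(B q) w)).
  by apply: integrableS fi => //; apply: subset_itvr; rewrite bnd_simp.
rewrite -(Rintegral_itv_bndo_bndc fi1) -(Rintegral_itv_obnd_cbnd fi2).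
rewrite [X in _ + X](_ : _ = 0) ?addr0; last first.
  rewrite [LHS](_ : _ = \int[leb]_(q in `]sg, b]) 0); first by rewrite Rintegral_cst// mul0r.
  apply: eq_Rintegral => q; rewrite inE/= in_itv/= => /andP[sq qb].
  rewrite indicE memNset ?mulr0// => /Ble; rewrite qb (ltW (le_lt_trans asg sq)) => /(_ isT).
  by rewrite leNgt sq.
rewrite -[RHS]Rintegral_itv_bndo_bndc; last exact: lco_int.
apply: eq_Rintegral => q; rewrite inE/= in_itv/= => /andP[aq qs].
by rewrite indicE mem_set ?mulr1//; apply: Blt; rewrite ?aq ?(ltW (lt_le_trans qs sgb)).
Qed.

Let y_dist u v w : `|y u w - y v w| <= 1.
Proof. by have := y01 u w; have := y01 v w; rewrite ler_norml; lra. Qed.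

Let N_diff sg w : a <= sg ->
  N sg w - N a w = y sg w - y a w - \int[leb]_(q in `[a, sg]) l q w.
Proof.
move=> asg; rewrite /N (@Rintegral_cat _ _ 0 a sg)//; last exact: li (le_trans a0 asg).
ring.
Qed.

Let N_bound sg w : 0 <= sg -> sg <= b -> (forall q, 0 <= q -> q < sg -> B q w) ->
  `|N sg w| <= 2 + c * b.
Proof.
move=> sg0 sgb Bq; rewrite /N (le_trans (ler_normB _ _))// lerD//.
  by rewrite (le_trans (y_dist _ _ _))// ler1n.
apply: (le_trans (l_bound (lexx 0) sg0 Bq)).
by rewrite subr0 ler_wpM2l.
Qed.

(** Majorant of the error. Where [tau <= b], the target [Z] and the stopped increment are each at
    most [1 + c * (b - a)], whence the factor 2; elsewhere an error arises only off [B b], and is an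
    increment of [y], at most 1. *)
Let hfun (tau : Omega -> \bar R) w : R := \1_(~` B b) w +
  2 * (1 + c * (b - a)) * \1_[set w | (tau w <= b%:E)%E] w.

Let cba : 0 <= c * (b - a). Proof. by rewrite mulr_ge0// subr_ge0. Qed.

Let k0 : 0 <= 2 * (1 + c * (b - a)). Proof. by rewrite mulr_ge0// addr_ge0. Qed.

Let hT tau w : (tau w <= b%:E)%E -> 2 * (1 + c * (b - a)) <= hfun tau w.
Proof. by move=> tb; rewrite /hfun (indicE _ [set w | (tau w <= b%:E)%E]) mem_set// mulr1 lerDr. Qed.

Let hB tau w : ~ B b w -> 1 <= hfun tau w.
Proof. by move=> nB; rewrite /hfun (indicE _ (~` B b)) mem_set// lerDl mulr_ge0. Qed.

Let h0 tau w : 0 <= hfun tau w.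
Proof. by rewrite addr_ge0// mulr_ge0. Qed.

Let Z w := y b w - y a w - J w.

Let mZ : measurable_fun setT Z.
Proof. by apply: measurable_funB => //; apply: measurable_funB; exact: my. Qed.

Let Zb w : `|Z w| <= 1 + c * (b - a).
Proof. by rewrite (le_trans (ler_normB _ _))// lerD. Qed.

Let PD D : measurable D -> (P D < +oo)%E.
Proof. by move=> mD; rewrite (le_lt_trans (probability_le1 _ _))// ltry. Qed.

(** The exit from this event comes no later than [tau], so up to it the stopped process is [N]
    itself. *)
Let C (tau : Omega -> \bar R) q := B q `&` [set w | (q%:E < tau w)%E].

Let increment_bound tau sg w : C tau a w -> a <= sg <= b ->
  (forall q, a <= q <= b -> q < sg -> C tau q w) ->
  (forall q, a <= q <= b -> C tau q w -> q <= sg) -> (C tau b w -> sg = b) ->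
  `|Z w - (y sg w - y a w - \int[leb]_(q in `[a, sg]) l q w)| <= hfun tau w.
Proof.
move=> [Ba _] asgb Clt Cle Csg; have /andP[asg sgb] := asgb.
have Blt q : a <= q <= b -> q < sg -> B q w by move=> qab /(Clt q qab)[].
have [tb|bt] := leP (tau w) b%:E.
  apply: le_trans (@hT tau w tb); rewrite (le_trans (ler_normB _ _))// mulr_natl mulr2n lerD//.
  rewrite (le_trans (ler_normB _ _))// lerD// (le_trans (l_bound a0 asg _))//.
    by move=> q aq qs; apply: Blt => //; rewrite aq (le_trans (ltW qs)).
  by rewrite ler_wpM2l// lerB.
(* For [b < tau], leaving [C tau] within [[a, b]] means leaving [B]: the two integrals agree and
   only the change of [y] after the exit remains. *)
rewrite /Z (J_exit asgb Blt); last first.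
  move=> q /andP[aq qb] Bq; apply: Cle; rewrite ?aq//; split => //=.
  by rewrite (le_lt_trans _ bt)// lee_fin.
set I := \int[leb]_(q in `[a, sg]) _.
have -> : y b w - y a w - I - (y sg w - y a w - I) = y b w - y sg w by ring.
have [Bb|/(@hB tau)] := pselect (B b w); last by apply: le_trans; exact: y_dist.
by rewrite Csg ?subrr ?normr0//; split.
Qed.

(* The increment of the stopped martingale over [[a, exit time of C]] has mean
   zero and differs from [Z] only where the exit happens before [b]. *)
Let exit_increment (tau : Omega -> \bar R) A : stopping_time Fil tau ->
  martingale P Fil (fun t w => N (stop_time t (tau w)) w) -> Fil a A ->
  exists D : Omega -> R, [/\ P.-integrable (A `&` C tau a) (EFin \o D),
    \int[P]_(w in A `&` C tau a) D w = 0 &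
    forall w, (A `&` C tau a) w -> `|Z w - D w| <= hfun tau w].
Proof.
move=> [tau0 tauF] mart aA.
have filM t D : Fil t D -> measurable D by case: fil => _ [h _]; exact: h.
have filG t : sigma_algebra setT (Fil t) by case: fil.
have mA := filM _ _ aA; have mBb := filM _ _ (FB b0).
have mT := filM _ _ (tauF b b0).
pose M t w := N (stop_time t (tau w)) w.
have FC q : 0 <= q -> Fil q (C tau q).
  move=> q0; apply: (sigma_algebra_setI (filG q)); first exact: FB.
  rewrite (_ : [set _ | _] = ~` [set w | (tau w <= q%:E)%E]).
    by apply: (sigma_algebra_setC (filG q)); exact: tauF.
  by apply/seteqP; split => w /=; rewrite ltNge => /negP.
have Cdec w q q' : 0 <= q -> q <= q' -> C tau q' w -> C tau q w.
  move=> q0 qq' [Bq /= tq]; split; first exact: Bdec Bq.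
  by rewrite /= (le_lt_trans _ tq)// lee_fin.
pose sg := exit (C tau) a b.
pose Aa := A `&` C tau a.
have aAa : Fil a Aa by apply: (sigma_algebra_setI (filG a)) => //; exact: FC.
have mAa := filM _ _ aAa.
have sgP w : Aa w -> [/\ a <= sg w <= b,
     forall q, a <= q <= b -> q < sg w -> C tau q w,
     forall q, a <= q <= b -> C tau q w -> q <= sg w & C tau b w -> sg w = b].
  by move=> [_ Ca]; apply: exitP => //; exact: Cdec.
(* Were [tau w < sg w], the time [tau w] itself would belong to [C tau], that is,
   [tau w < tau w]. *)
have sgtau w : Aa w -> ((sg w)%:E <= tau w)%E.
  move=> Aw; have [/andP[asg sgb] Clt _ _] := sgP w Aw; have [_ [_ /= atau]] := Aw.
  rewrite leNgt; apply/negP; case E : (tau w) => [r| |] rsg.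
  - rewrite E lte_fin in atau; rewrite lte_fin in rsg.
    have [|_ /=] := Clt r _ rsg; first by rewrite (ltW atau) (le_trans (ltW rsg)).
    by rewrite E lte_fin ltxx.
  - by move: rsg; rewrite ltNge leey.
  - by move: (tau0 w); rewrite E.
have Msg w : Aa w -> M (sg w) w = N (sg w) w.
  move=> Aw; have := sgtau w Aw; rewrite /M /stop_time; case: (tau w) => [r| |]//.
  by rewrite lee_fin => h; rewrite min_l.
have Ma w : Aa w -> M a w = N a w.
  move=> [_ [_ /=]]; rewrite /M /stop_time; case: (tau w) => [r| |]//.
  by rewrite lte_fin => h; rewrite min_l// ltW.
have sg0 w : Aa w -> 0 <= sg w by move=> /sgP[/andP[asg _] _ _ _]; exact: le_trans asg.
have Bsg w q : Aa w -> 0 <= q -> q < sg w -> B q w.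
  move=> Aw q0 qs; have [/andP[asg sgb] Clt _ _] := sgP w Aw.
  have [aq|qa] := leP a q.
    by have [] := Clt q _ qs; first by rewrite aq (le_trans (ltW qs)).
  by have [_ [Ba _]] := Aw; apply: Bdec Ba => //; exact: ltW.
have rcM w : Aa w -> (M ^~ w) @ at_right (sg w) --> M (sg w) w.
  move=> Aw; have := sgtau w Aw; rewrite Msg//.
  have Nc := @N_cont w _ (sg0 w Aw).
  (* If the exit occurs at [tau w], the stopped path is constant to the right of it; otherwise it
     agrees with [N] near the exit. *)
  rewrite le_eqVlt => /predU1P[E|lt].
    apply: (@cvg_trans _ ((fun _ : R => N (sg w) w) @ at_right (sg w))); last exact: cvg_cst.
    apply: near_eq_cvg; near=> q; rewrite /M /stop_time -E min_r//.
  have nr : \forall q \near at_right (sg w), (q%:E < tau w)%E.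
    case E : (tau w) lt => [r| |] //; last by move=> _; apply: nearW => q; exact: ltry.
    by rewrite lte_fin => /nbhs_right_lt; apply: filterS => q; rewrite lte_fin.
  apply: cvg_trans Nc; apply: near_eq_cvg; apply: filterS nr => q.
  by rewrite /M /stop_time; case: (tau w) => [r| |]//; rewrite lte_fin => /ltW h; rewrite min_l.
have mM t : 0 <= t -> P.-integrable setT (EFin \o M t) by case: mart => _ [h _]; exact: h.
have MaI : P.-integrable Aa (EFin \o M a) by exact: (integrableS measurableT mAa (@subsetT _ _) (mM a a0)).
have Mdiff w : Aa w -> M (sg w) w - M a w = y (sg w) w - y a w - \int[leb]_(q in `[a, sg w]) l q w.
  move=> Aw; have [/andP[asg _] _ _ _] := sgP w Aw.
  have E1 := Msg w Aw; have E2 := Ma w Aw; rewrite E1 E2; exact: N_diff.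
have Mb w : Aa w -> `|M (sg w) w| <= 2 + c * b.
  move=> Aw; have E := Msg w Aw; rewrite E; have [/andP[_ sgb] _ _ _] := sgP w Aw.
  by apply: N_bound => //; [exact: sg0|move=> q; exact: Bsg].
have [mMs EMs] : measurable_fun Aa (fun w => M (sg w) w) /\
    \int[P]_(w in Aa) M (sg w) w = \int[P]_(w in Aa) M a w.
  apply: (@optional_exit _ _ _ _ _ _ fil mart (C tau) Aa sg a b (2 + c * b)) => //.
    by move=> q /andP[aq _]; apply: FC; exact: le_trans aq.
  move=> w Aw; have [h1 h2 h3 _] := sgP w Aw.
  exact: (And5 h1 h2 h3 (rcM w Aw) (Mb w Aw)).
have MsI : P.-integrable Aa (EFin \o (fun w => M (sg w) w)).
  apply: (@bounded_integrableR _ _ _ P Aa mAa (PD mAa) _ (2 + c * b) mMs).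
  exact: Mb.
move: mMs => _.
exists (fun w => M (sg w) w - M a w); split.
- exact: (integrableRB mAa MsI MaI).
- by rewrite (RintegralB mAa MsI MaI) EMs subrr.
move=> w Aw; have [h1 h2 h3 h4] := sgP w Aw; have E := Mdiff w Aw; rewrite E.
exact: (increment_bound (proj2 Aw) h1 h2 h3 h4).
Unshelve. all: by end_near. Qed.

(** Outside [C tau a] either [tau <= a <= b], or [B] has been left by time [a]; then it stays left,
    the integral [J] is zero and [Z] is an increment of [y]. *)
Let outside_bound tau A w : (A `\` C tau a) w -> `|Z w| <= hfun tau w.
Proof.
move=> [_ nC]; have [Ba|nBa] := pselect (B a w).
    have tb : (tau w <= b%:E)%E.
      rewrite leNgt; apply/negP => bt; apply: nC; split => //=.
      by rewrite (le_lt_trans _ bt)// lee_fin.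
    apply: le_trans (@hT tau w tb); apply: (le_trans (Zb w)).
    by rewrite ler_peMl ?ler1n// addr_ge0.
  have nB q : a <= q -> ~ B q w by move=> aq Bq; apply: nBa; exact: Bdec Bq.
  have J0 : J w = 0.
    rewrite /J [LHS](_ : _ = \int[leb]_(q in `[a, b]) 0); first by rewrite Rintegral_cst// mul0r.
    apply: eq_Rintegral => q; rewrite inE/= in_itv/= => /andP[aq _].
    by rewrite indicE memNset ?mulr0//; exact: nB.
  by apply: le_trans (@hB tau w (nB _ ab)); rewrite /Z J0 subr0.
Qed.

Let bound_step (tau : Omega -> \bar R) A : stopping_time Fil tau ->
  martingale P Fil (fun t w => N (stop_time t (tau w)) w) -> Fil a A ->
  `|\int[P]_(w in A) Z w| <= \int[P]_(w in A) hfun tau w.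
Proof.
move=> stau mart aA; have [D [DI D0 Dh]] := exit_increment stau mart aA.
have filM t D' : Fil t D' -> measurable D' by case: fil => _ [h _]; exact: h.
have mA := filM _ _ aA; have mBb := filM _ _ (FB b0).
have mT := filM _ _ (stau.2 b b0).
have mCa : measurable (C tau a).
  apply: measurableI; first exact: filM (FB a0).
  rewrite (_ : [set _ | _] = ~` [set w | (tau w <= a%:E)%E]).
    by apply: measurableC; exact: filM (stau.2 a a0).
  by apply/seteqP; split => w /=; rewrite ltNge => /negP.
have mAa : measurable (A `&` C tau a) by exact: measurableI.
have mAD : measurable (A `\` C tau a) by exact: measurableD.
have Zi E : measurable E -> P.-integrable E (EFin \o Z).
  move=> mE; apply: (@bounded_integrableR _ _ _ P E mE (PD mE) _ (1 + c * (b - a))) => //.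
  exact: measurable_funTS.
have mh : measurable_fun setT (hfun tau).
  apply: measurable_funD; first by apply: measurable_indic; exact: measurableC.
  by apply: measurable_funM => //; exact: measurable_indic.
have hi E : measurable E -> P.-integrable E (EFin \o hfun tau).
  move=> mE; apply: (@bounded_integrableR _ _ _ P E mE (PD mE) _ (1 + 2 * (1 + c * (b - a)))).
    exact: measurable_funTS.
  move=> w _; rewrite (le_trans (ler_normD _ _))// lerD//; rewrite ?normrM indicE.
    by case: (_ \in _); rewrite ?normr1 ?normr0.
  by rewrite -normrM (ger0_norm k0) ler_piMr//; case: (_ \in _); rewrite ?normr1 ?normr0.
have split_ f : P.-integrable A (EFin \o f) -> \int[P]_(w in A) f w =
    \int[P]_(w in A `&` C tau a) f w + \int[P]_(w in A `\` C tau a) f w.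
  move=> fi; rewrite -[in LHS](setUIDK A (C tau a)) Rintegral_setU//.
    by rewrite setUIDK.
  by apply/disj_set2P; rewrite setDE setIACA setICr setI0.
rewrite split_; last exact: Zi.
rewrite [leRHS]split_; last exact: hi.
have -> : \int[P]_(w in A `&` C tau a) Z w = \int[P]_(w in A `&` C tau a) (Z w - D w).
  by rewrite (RintegralB mAa (Zi _ mAa) DI) D0 subr0.
have ZDI := integrableRB mAa (Zi _ mAa) DI.
rewrite (le_trans (ler_normD _ _))// lerD//.
  apply: le_trans (le_normr_Rintegral mAa ZDI) _.
  by apply: le_Rintegral => //; [exact: integrable_norm|exact: hi].
apply: le_trans (le_normr_Rintegral mAD (Zi _ mAD)) _.
apply: le_Rintegral => //; [apply: integrable_norm; exact: Zi|exact: hi|].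
by move=> w; exact: outside_bound.
Qed.

(** Each localizing time gives the bound with an extra error on [{tau n <= b}]. The left-hand side
    does not involve [tau n], so dominated convergence along the sequence removes that error. *)
Lemma exit_estimate A : Fil a A ->
  `|\int[P]_(w in A) (y b w - y a w -
    \int[leb]_(q in `[a, b]) (l q w * \1_(B q) w))| <= fine (P (~` B b)).
Proof.
rewrite -[X in `|X| <= _]/(\int[P]_(w in A) Z w).
move=> aA; have [tau [tst tinc tae tmart]] := lmart.
have mA : measurable A by case: fil => _ [h _]; exact: h aA.
have mBb : measurable (B b) by case: fil => _ [h _]; exact: h (FB b0).
pose T n := [set w | (tau n w <= b%:E)%E].
have mT n : measurable (T n).
  by case: fil => _ [h _]; apply: (h b); case: (tst n) => _; apply.
pose k := 2 * (1 + c * (b - a)).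
have PA : (P A < +oo)%E by rewrite (le_lt_trans (probability_le1 _ _))// ltry.
have mI : measurable_fun A (\1_(~` B b) : Omega -> R).
  by apply: measurable_indic; exact: measurableC.
have Tlim : \int[P]_(w in A) (\1_(~` B b) w + k * \1_(T n) w) @[n --> \oo] -->
    \int[P]_(w in A) (\1_(~` B b) w : R).
  apply: (@Rdominated_cvg _ _ _ P A _ _ (fun _ => 1 + k)) => //.
  - by move=> n; apply: measurable_funD => //; apply: measurable_funM => //; exact: measurable_indic.
  - apply: filterS tae => w wt _; have [m bm] := wt b.
    apply: (@cvg_trans _ ((fun _ : nat => \1_(~` B b) w : R) @ \oo)); last exact: cvg_cst.
    apply: near_eq_cvg; exists m => // n /= mn.
    rewrite [\1_(T n) w]indicE memNset ?mulr0 ?addr0// /T/= => nb.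
    have : (tau m w <= tau n w)%E.
      rewrite -(subnKC mn); elim: (n - m)%N => [|j IH]; rewrite ?addn0// addnS.
      exact: le_trans IH (tinc _ _).
    by move=> /le_trans/(_ nb); rewrite leNgt bm.
  - exact: integrable_cstR.
  - move=> n w _; rewrite (le_trans (ler_normD _ _))// lerD//.
      by rewrite indicE; case: (_ \in _); rewrite ?normr1 ?normr0.
    rewrite normrM (@ger0_norm _ k k0) ler_piMr// indicE.
    by case: (_ \in _); rewrite ?normr1 ?normr0.
have le0 : `|\int[P]_(w in A) Z w| <= \int[P]_(w in A) (\1_(~` B b) w : R).
  rewrite -(cvg_lim _ Tlim)//; apply: limr_ge; first exact: cvgP Tlim.
  by apply: nearW => n; exact: (bound_step (tst n) (tmart n) aA).
apply: le_trans le0 _.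
rewrite /Rintegral integral_indic//; last exact: measurableC.
have mAB : measurable (~` B b `&` A) by apply: measurableI => //; exact: measurableC.
apply: fine_le; rewrite ?fin_num_measure//; first exact: measurableC.
by apply: le_measure; rewrite ?inE//; exact: measurableC.
Qed.

(** Meant for [kappa = exp phi_b]: the martingale problem is applied to [exp <psi_b, .>], and this
    constant factor turns it into [V b]. *)
Lemma exit_estimate_scaled A (kappa : R) : 0 <= kappa <= 1 -> Fil a A ->
  `|\int[P]_(w in A) (kappa * y b w - kappa * y a w -
    \int[leb]_(q in `[a, b]) (kappa * l q w * \1_(B q) w))| <= fine (P (~` B b)).
Proof.
move=> /andP[ka0 ka1] aA.
have mA : measurable A by case: fil => _ [fm _]; exact: fm aA.
have E w : kappa * y b w - kappa * y a w -
    \int[leb]_(q in `[a, b]) (kappa * l q w * \1_(B q) w) = kappa * Z w.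
  have lBw := lBi w; rewrite /Z /J !mulrBr; congr (_ - _); rewrite -RintegralZl//.
  by apply: eq_Rintegral => q _; rewrite mulrA.
have ZI : P.-integrable A (EFin \o Z).
  apply: (@bounded_integrableR _ _ _ P _ mA (PD mA) _ (1 + c * (b - a))).
    exact: measurable_funTS mZ.
  by move=> w _; exact: Zb.
have -> : \int[P]_(w in A) (kappa * y b w - kappa * y a w -
    \int[leb]_(q in `[a, b]) (kappa * l q w * \1_(B q) w)) = \int[P]_(w in A) (kappa * Z w).
  by apply: eq_Rintegral => w _; exact: E.
rewrite RintegralZl// normrM ger0_norm//.
by apply: le_trans (exit_estimate aA); rewrite ler_piMl.
Qed.

End exit_estimate.

(** * The triangle argument *)

Section time_prod.
Context d (Omega : measurableType d) (R : realType) (P : probability Omega R).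

(* The library makes a product of measures canonically sigma-finite only when
   both factors are subprobabilities. *)
Definition time_prod : set (measurableTypeR R * Omega)%type -> \bar R :=
  (@lebesgue_measure R \x P)%E.

HB.instance Definition _ := Measure.on time_prod.

Let time_prod_sigma_finite : sigma_finite setT time_prod.
Proof.
exists (fun n : nat => ([set` `[- n%:R, n%:R]] : set (measurableTypeR R)) `*` [set: Omega]).
  apply/seteqP; split => // -[x w] _; exists (truncn `|x|).+1 => //; split => //=.
  by rewrite in_itv/= -ler_norml ltW// truncnS_gt.
move=> n; split; last exact: itv_setT_lty.
by apply: measurableX => //; exact: measurable_itv.
Qed.

HB.instance Definition _ :=
  @Measure_isSigmaFinite.Build _ _ _ time_prod time_prod_sigma_finite.

End time_prod.

Section triangle.
Context d (Omega : measurableType d) (R : realType) (P : probability Omega R).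
Notation leb := (@lebesgue_measure R).
Notation LR := (measurableTypeR R).

Lemma measurable_itvcc (a b : R) : measurable ([set` `[a, b]] : set LR).
Proof. exact: measurable_itv. Qed.

Lemma probability_lty (A : set Omega) : measurable A -> (P A < +oo)%E.
Proof. by move=> mA; rewrite (le_lt_trans (probability_le1 _ _))// ltry. Qed.

Lemma le_Rintegral_cst (A : set Omega) (f : Omega -> R) (C : R) :
  measurable A -> measurable_fun A f -> 0 <= C -> (forall w, A w -> `|f w| <= C) ->
  `|\int[P]_(w in A) f w| <= C.
Proof.
move=> mA mf C0 fC.
apply: le_trans (Rintegral_bound mA (probability_lty mA) mf fC) _.
rewrite ler_piMr// -lee_fin fineK ?fin_num_measure//; exact: probability_le1.
Qed.

Lemma integrable_itv_Rintegral (A : set Omega) (F : LR * Omega -> R) (u v C : R) :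
  measurable A -> measurable_fun (`[u, v] `*` [set: Omega]) F ->
  (forall x w, u <= x <= v -> `|F (x, w)| <= C) ->
  leb.-integrable `[u, v] (EFin \o (fun x => \int[P]_(w in A) F (x, w))).
Proof.
move=> mA mF FC.
have mUA : measurable (([set` `[u, v]] : set LR) `*` A) by apply: measurableX => //; exact: measurable_itvcc.
have fi : (leb \x P)%E.-integrable (([set` `[u, v]] : set LR) `*` A) (EFin \o F).
  apply: (@bounded_integrableR _ _ _ _ _ mUA _ _ C).
  - apply: le_lt_trans (itv_setT_lty P u v); apply: le_measure; rewrite ?inE//.
      by apply: measurableX => //; exact: measurable_itvcc.
    by move=> [x w] [].
  - apply: measurable_funS mF; first by apply: measurableX => //; exact: measurable_itvcc.
    by move=> [x w] [].
  - by move=> [x w] [/= + _]; rewrite in_itv/=; exact: FC.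
exact: (integrable_Rintegral12 (measurable_itvcc u v) mA fi).
Qed.

Variables (A : set Omega) (t s eps : R) (V W : R -> LR * Omega -> R) (chi : LR * Omega -> R).
Hypotheses (mA : measurable A) (s0 : 0 <= s).
Let D1 : set LR := [set` `[0, s]].
Let D2 : set (LR * Omega) := ([set` `[t, t + s]] : set LR) `*` [set: Omega].
Let mD1 : measurable D1. Proof. exact: measurable_itvcc. Qed.
Let mD2 : measurable D2.
Proof. by apply: measurableX => //; exact: measurable_itvcc. Qed.
Hypotheses
  (mV : measurable_fun (D1 `*` D2) (fun bz => V bz.1 bz.2))
  (mW : measurable_fun (D1 `*` D2) (fun bz => W bz.1 bz.2))
  (mchi : measurable_fun D2 chi)
  (V01 : forall b z, 0 <= b <= s -> 0 <= V b z <= 1)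
  (chi01 : forall z, 0 <= chi z <= 1)
  (Wi : forall z, D2 z -> leb.-integrable `[0, s] (EFin \o (fun b => W b z)))
  (WV : forall u z, 0 <= u <= s -> D2 z ->
     \int[leb]_(b in `[0, u]) W b z = (V u z - V 0 z) * chi z)
  (Wz : exists C, forall z, D2 z -> \int[leb]_(b in `[0, s]) `|W b z| <= C)
  (Wb : forall b, 0 <= b <= s -> exists C, forall z, D2 z -> `|W b z| <= C)
  (est : forall b q, 0 <= b <= s -> t <= q <= t + s ->
     `|\int[P]_(w in A) (V b (q, w) - V b (t, w) - \int[leb]_(p in `[t, q]) W b (p, w))| <= eps)
  (small : forall q, t <= q <= t + s -> \int[P]_(w in A) (1 - chi (q, w)) <= eps).

Let D2P q w : D2 (q, w) <-> t <= q <= t + s.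
Proof. by rewrite /D2/=; split => [[]|]; rewrite in_itv/=. Qed.

Let tri (bz : LR * (LR * Omega)) : R := \1_[set bz : LR * (LR * Omega) | bz.1 + bz.2.1 <= t + s] bz.

Let mtri : measurable_fun setT tri.
Proof.
apply: measurable_indic; rewrite -[X in measurable X]setTI.
have m1 : measurable_fun setT (fun bz : LR * (LR * Omega) => bz.1 + bz.2.1 : R).
  apply: (@measurable_funD _ (LR * (LR * Omega))%type R) => //.
  by apply: measurableT_comp.
rewrite (_ : [set _ | _] = (fun bz : LR * (LR * Omega) => bz.1 + bz.2.1 : R) @^-1` `]-oo, t + s]).
  exact: m1.
by apply/seteqP; split => bz; rewrite /= in_itv.
Qed.

Let G (bz : LR * (LR * Omega)) := W bz.1 bz.2 * tri bz * \1_A bz.2.2.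

Let mG : measurable_fun (D1 `*` D2) G.
Proof.
apply: measurable_funM; first by apply: measurable_funM => //; exact: measurable_funTS.
apply: measurable_funTS.
apply: (@measurableT_comp _ _ _ _ _ _ (\1_A : Omega -> R)); first exact: measurable_indic.
by apply: measurableT_comp.
Qed.

Let G_le b z : `|G (b, z)| <= `|W b z|.
Proof.
rewrite /G /tri !normrM -mulrA ler_piMr// !indicE.
by case: (_ \in _); case: (_ \in _); rewrite ?normr1 ?normr0 ?mulr1 ?mulr0.
Qed.

Let mG1 z : D2 z -> measurable_fun D1 (fun b => G (b, z)).
Proof.
move=> Dz; apply: (@measurable_comp _ _ _ _ _ _ (D1 `*` D2) G _ (fun b : LR => (b, z))) => //.
- exact: measurableX.
- by move=> _ [b bD <-].
- exact: measurable_funTS (pair2_measurable z).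
Qed.

Let mG2 b : D1 b -> measurable_fun D2 (fun z => G (b, z)).
Proof.
move=> Db; apply: (@measurable_comp _ _ _ _ _ _ (D1 `*` D2) G _ (fun z : LR * Omega => (b, z))) => //.
- exact: measurableX.
- by move=> _ [z zD <-].
- exact: measurable_funTS (pair1_measurable b).
Qed.

Let Gi1 z : D2 z -> leb.-integrable D1 (EFin \o (fun b => G (b, z))).
Proof.
move=> Dz; apply: (le_integrableR mD1 (mG1 Dz) _ (integrable_norm (Wi Dz))).
by move=> b _; exact: G_le.
Qed.

Let lebP : {sigma_finite_measure set (LR * Omega)%type -> \bar R} :=
  [the {sigma_finite_measure set (LR * Omega)%type -> \bar R} of time_prod P].

Let lebP_lty : (lebP D2 < +oo)%E. Proof. exact: itv_setT_lty. Qed.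

Let Gi : (leb \x lebP)%E.-integrable (D1 `*` D2) (EFin \o G).
Proof.
have [C WC] := Wz.
have h := @integrable_prod_bound _ _ _ _ R leb lebP D1 D2 mD1 mD2 G C lebP_lty mG.
apply: h => z Dz; first exact: Gi1.
apply: le_trans (WC z Dz); apply: (le_Rintegral mD1).
- exact: integrable_norm (Gi1 Dz).
- exact: integrable_norm (Wi Dz).
- by move=> b _; exact: G_le.
Qed.

(* Fubini on the triangle [b + (q - t) <= s] *)
Let fub : \int[leb]_(b in D1) \int[lebP]_(z in D2) G (b, z) =
  \int[lebP]_(z in D2) \int[leb]_(b in D1) G (b, z).
Proof. by rewrite -(Rintegral_prod12 mD1 mD2 Gi) (Rintegral_prod21 mD1 mD2 Gi). Qed.

Let k b q := \int[P]_(w in A) V b (q, w).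

Let V_le b z : 0 <= b <= s -> `|V b z| <= 1.
Proof. by move=> bs; have /andP[V0 V1] := @V01 b z bs; rewrite ger0_norm. Qed.

Let mVcomp (f : LR -> LR) (g : LR -> LR) (u v : R) :
  measurable_fun setT f -> measurable_fun setT g ->
  (forall x, u <= x <= v -> 0 <= f x <= s) -> (forall x, u <= x <= v -> t <= g x <= t + s) ->
  measurable_fun (([set` `[u, v]] : set LR) `*` [set: Omega])
    (fun xw : LR * Omega => V (f xw.1) (g xw.1, xw.2)).
Proof.
move=> mf mg fs gs.
apply: (@measurable_comp _ _ _ _ _ _ (D1 `*` D2) (fun bz => V bz.1 bz.2) _
  (fun xw : LR * Omega => (f xw.1, (g xw.1, xw.2)))) => //.
- exact: measurableX.
- move=> _ [[x w] [/= + _] <-]; rewrite in_itv/= => xuv; split => /=.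
    by rewrite /D1/= in_itv/= fs.
  by apply/D2P; exact: gs.
apply: measurable_funTS; apply: measurable_fun_pair; first exact: measurableT_comp.
by apply: measurable_fun_pair => //; exact: measurableT_comp.
Qed.

Let k_int (f g : LR -> LR) (u v : R) :
  measurable_fun setT f -> measurable_fun setT g ->
  (forall x, u <= x <= v -> 0 <= f x <= s) -> (forall x, u <= x <= v -> t <= g x <= t + s) ->
  leb.-integrable `[u, v] (EFin \o (fun x => k (f x) (g x))).
Proof.
move=> mf mg fs gs.
apply: (integrable_itv_Rintegral (F := fun xw : LR * Omega => V (f xw.1) (g xw.1, xw.2)) (C := 1) mA).
  exact: mVcomp.
by move=> x w xuv /=; apply: V_le; exact: fs.
Qed.

Let mid (x : R) : 0 <= x <= s -> t <= t + s - x <= t + s.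
Proof. lra. Qed.

Let mid' (x : R) : t <= x <= t + s -> 0 <= t + s - x <= s.
Proof. lra. Qed.

Let mVw b q : 0 <= b <= s -> t <= q <= t + s -> measurable_fun setT (fun w => V b (q, w)).
Proof.
move=> bs qs.
apply: (@measurable_comp _ _ _ _ _ _ (D1 `*` D2) (fun bz => V bz.1 bz.2) _
  (fun w : Omega => (b : LR, (q : LR, w)))) => //.
- exact: measurableX.
- by move=> _ [w _ <-]; split; [rewrite /D1/= in_itv|exact/D2P].
- by apply: measurable_fun_pair => //; exact: pair1_measurable.
Qed.

Let Vw_int b q : 0 <= b <= s -> t <= q <= t + s -> P.-integrable A (EFin \o (fun w => V b (q, w))).
Proof.
move=> bs qs; apply: (@bounded_integrableR _ _ _ P A mA (probability_lty mA) _ 1).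
  exact: measurable_funTS (mVw bs qs).
by move=> w _; exact: V_le.
Qed.

(* [b] fixed, [z = (q, w)] integrated first *)
Let inner_b b : 0 <= b <= s ->
  `|k b (t + s - b) - k b t - \int[lebP]_(z in D2) G (b, z)| <= eps.
Proof.
move=> bs; have tsb := mid bs; have tt : t <= t <= t + s by rewrite lexx lerDl.
have Db : D1 b by rewrite /D1/= in_itv.
have [C WC] := Wb bs.
have Gbi : lebP.-integrable D2 (EFin \o (fun z => G (b, z))).
  apply: (@bounded_integrableR _ _ _ _ _ mD2 lebP_lty _ C (mG2 Db)).
  by move=> z Dz; rewrite (le_trans (G_le _ _))// WC.
have E : \int[lebP]_(z in D2) G (b, z) =
    \int[P]_(w in A) \int[leb]_(p in `[t, t + s - b]) W b (p, w).
  rewrite (Rintegral_prod21 (m1 := leb) (m2 := P) (measurable_itvcc t (t + s)) measurableT Gbi).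
  rewrite [RHS]Rintegral_mkcond; apply: eq_Rintegral => w _; rewrite patch_indic.
  have GE q : G (b, (q, w)) = (W b (q, w) * \1_A w) * \1_([set` `]-oo, t + s - b]]) q.
    rewrite /G /tri /= mulrAC; congr (_ * _); rewrite !indicE; congr ((nat_of_bool _)%:R).
    by apply/idP/idP; rewrite !inE/= !in_itv/=; lra.
  have -> : \int[leb]_(q in `[t, t + s]) G (b, (q, w)) =
      \int[leb]_(q in `[t, t + s - b]) (W b (q, w) * \1_A w).
    rewrite (_ : [set` `[t, t + s - b]] = [set` `[t, t + s]] `&` [set` `]-oo, t + s - b]]); last first.
      by apply/seteqP; split => q; rewrite /= !in_itv/=; [move=> ?; split; lra|case=> ? ?; lra].
    rewrite Rintegral_mkcondr; apply: eq_Rintegral => q _.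
    by rewrite GE patch_indic.
  rewrite [RHS]/=.
  have [->|->] : \1_A w = 0 :> R \/ \1_A w = 1 :> R by rewrite indicE; case: (_ \in _); [right|left].
    rewrite mulr0 (_ : \int[_]_(_ in _) _ = \int[leb]_(q in `[t, t + s - b]) 0).
      by rewrite Rintegral_cst// mul0r.
    by apply: eq_Rintegral => q _; rewrite mulr0.
  by rewrite mulr1; apply: eq_Rintegral => q _; rewrite mulr1.
rewrite E; have := est bs tsb.
have Wint : P.-integrable A (EFin \o (fun w => \int[leb]_(p in `[t, t + s - b]) W b (p, w))).
  have mDb : measurable ([set` `[t, t + s - b]] : set LR) by exact: measurable_itvcc.
  have Fi : (leb \x P)%E.-integrable (([set` `[t, t + s - b]] : set LR) `*` A)
      (EFin \o (fun z => W b z)).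
    apply: (@bounded_integrableR _ _ _ _ _ (measurableX mDb mA) _ _ C).
    - apply: le_lt_trans (itv_setT_lty P t (t + s)); apply: le_measure; rewrite ?inE.
      + exact: measurableX.
      + exact: mD2.
      + by move=> [x w] [/=]; rewrite !in_itv/= => ? _; split => //=; lra.
    - apply: (@measurable_comp _ _ _ _ _ _ (D1 `*` D2) (fun bz => W bz.1 bz.2) _
        (fun z : LR * Omega => (b : LR, z))) => //.
      + exact: measurableX.
      + by move=> _ [[x w] [/= + _] <-]; rewrite in_itv/= => ?; split => //=; apply/D2P; lra.
      + exact: measurable_funTS (pair1_measurable _).
    - by move=> [x w] [/= + _]; rewrite in_itv/= => ?; apply: WC; apply/D2P; lra.
  exact: (integrable_Rintegral21 mDb mA Fi).
rewrite (RintegralB mA (integrableRB mA (Vw_int bs tsb) (Vw_int bs tt)) Wint).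
by rewrite (RintegralB mA (Vw_int bs tsb) (Vw_int bs tt)).
Qed.

(* [z = (q, w)] fixed, [b] integrated first *)
Let inner_z q w : t <= q <= t + s ->
  \int[leb]_(b in D1) G (b, (q, w)) =
  (V (t + s - q) (q, w) - V 0 (q, w)) * chi (q, w) * \1_A w.
Proof.
move=> qs; have qs' := mid' qs; have Dz : D2 (q, w) by exact/D2P.
rewrite -WV//.
have GE b : G (b, (q, w)) = (W b (q, w) * \1_A w) * \1_([set` `]-oo, t + s - q]]) b.
  rewrite /G /tri /= mulrAC; congr (_ * _); rewrite !indicE; congr ((nat_of_bool _)%:R).
  by apply/idP/idP; rewrite !inE/= !in_itv/=; lra.
have -> : \int[leb]_(b in D1) G (b, (q, w)) =
    \int[leb]_(b in `[0, t + s - q]) (W b (q, w) * \1_A w).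
  rewrite (_ : [set` `[0, t + s - q]] = [set` `[0, s]] `&` [set` `]-oo, t + s - q]]); last first.
    by apply/seteqP; split => b; rewrite /= !in_itv/=; [move=> ?; split; lra|case=> ? ?; lra].
  rewrite Rintegral_mkcondr; apply: eq_Rintegral => b _.
  by rewrite GE patch_indic.
rewrite RintegralZr//; apply: integrableS (Wi Dz) => //.
by apply: subset_itvl; rewrite bnd_simp; case/andP: qs'.
Qed.

(** The integrated flow identity carries the factor [chi]; dropping it costs at most the integral of
    [1 - chi], because differences of values of [V] are at most 1. *)
Let inner_q q : t <= q <= t + s ->
  `|\int[P]_w \int[leb]_(b in D1) G (b, (q, w)) - (k (t + s - q) q - k 0 q)| <= eps.
Proof.
move=> qs; have qs' := mid' qs; have z0 : 0 <= (0 : R) <= s by rewrite lexx.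
apply: le_trans (small qs).
have mchiw : measurable_fun A (fun w => chi (q, w)).
  apply: (@measurable_comp _ _ _ _ _ _ D2 chi _ (fun w : Omega => (q : LR, w))) => //.
    by move=> _ [w _ <-]; exact/D2P.
  exact: measurable_funTS (pair1_measurable _).
have VVi := integrableRB mA (Vw_int qs' qs) (Vw_int z0 qs).
have VV1 w : `|V (t + s - q) (q, w) - V 0 (q, w)| <= 1.
  have := @V01 _ (q, w) qs'; have := @V01 _ (q, w) z0; rewrite ler_norml; lra.
have mVV : measurable_fun A (fun w => V (t + s - q) (q, w) - V 0 (q, w)).
  by apply/measurable_EFinP; exact: (measurable_int _ VVi).
have VVc : P.-integrable A (EFin \o (fun w => (V (t + s - q) (q, w) - V 0 (q, w)) * chi (q, w))).
  apply: (@bounded_integrableR _ _ _ P A mA (probability_lty mA) _ 1).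
    exact: measurable_funM.
  move=> w _; have /andP[c0 c1] := chi01 (q, w).
  by rewrite normrM mulr_ile1// ger0_norm.
have -> : \int[P]_w \int[leb]_(b in D1) G (b, (q, w)) =
    \int[P]_(w in A) ((V (t + s - q) (q, w) - V 0 (q, w)) * chi (q, w)).
  rewrite [RHS]Rintegral_mkcond; apply: eq_Rintegral => w _.
  by rewrite inner_z// patch_indic.
rewrite -(RintegralB mA (Vw_int qs' qs) (Vw_int z0 qs)) -(RintegralB mA VVc VVi).
apply: le_trans (le_normr_Rintegral mA (integrableRB mA VVc VVi)) _.
apply: (le_Rintegral mA).
- exact: integrable_norm (integrableRB mA VVc VVi).
- apply: (@bounded_integrableR _ _ _ P A mA (probability_lty mA) _ 1).
    exact: measurable_funB.
  by move=> w _; have := chi01 (q, w); rewrite ler_norml; lra.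
move=> w _; have /andP[c0 c1] := chi01 (q, w).
have -> : (V (t + s - q) (q, w) - V 0 (q, w)) * chi (q, w) - (V (t + s - q) (q, w) - V 0 (q, w)) =
  (V (t + s - q) (q, w) - V 0 (q, w)) * (chi (q, w) - 1) by ring.
by rewrite normrM (distrC (chi (q, w)) 1) (ger0_norm (_ : 0 <= 1 - chi (q, w))) ?subr_ge0// ler_piMl ?subr_ge0 ?VV1.
Qed.

Let cstT (x : R) : measurable_fun setT (fun _ : LR => x : LR).
Proof. exact: measurable_cst. Qed.

Let idT : measurable_fun setT (idfun : LR -> LR).
Proof. exact: measurable_id. Qed.

Let flipT : measurable_fun setT (fun x : LR => t + s - x : LR).
Proof. exact: measurable_funB. Qed.

Let leb_bound (f : R -> R) u v : u <= v -> leb.-integrable `[u, v] (EFin \o f) ->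
  (forall x, u <= x <= v -> `|f x| <= eps) -> `|\int[leb]_(x in `[u, v]) f x| <= eps * (v - u).
Proof.
move=> uv fi fe; have -> : v - u = fine (leb `[u, v]) by rewrite lebesgue_itvcc.
apply: Rintegral_bound => //; first exact: lebesgue_itvcc_lty.
by apply/measurable_EFinP; exact: (measurable_int _ fi).
Qed.

(** The two legs of the triangle remain once the hypotenuse terms cancel; each of the two families
    of slices contributes an error [eps] over a length [s]. *)
Lemma triangle : `|\int[leb]_(b in `[0, s]) (\int[P]_(w in A) V b (t, w)) -
  \int[leb]_(q in `[t, t + s]) (\int[P]_(w in A) V 0 (q, w))| <= 2 * eps * s.
Proof.
have tts : t <= t + s by rewrite lerDl.
have tt : t <= t <= t + s by rewrite lexx.
have z0 : 0 <= (0 : R) <= s by rewrite lexx.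
have i1 : leb.-integrable `[0, s] (EFin \o (fun b => k b (t + s - b))).
  exact: (k_int (f := idfun) (g := fun x => t + s - x) idT flipT (fun x h => h) (@mid)).
have i2 : leb.-integrable `[0, s] (EFin \o (fun b => k b t)).
  exact: (k_int (f := idfun) (g := fun _ => t) idT (cstT t) (fun x h => h) (fun x _ => tt)).
have i3 : leb.-integrable `[t, t + s] (EFin \o (fun q => k (t + s - q) q)).
  exact: (k_int (f := fun x => t + s - x) (g := idfun) flipT idT (@mid') (fun x h => h)).
have i4 : leb.-integrable `[t, t + s] (EFin \o (fun q => k 0 q)).
  exact: (k_int (f := fun _ => 0) (g := idfun) (cstT 0) idT (fun x _ => z0) (fun x h => h)).
have i5 : leb.-integrable `[0, s] (EFin \o (fun b => \int[lebP]_(z in D2) G (b, z))).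
  exact: (integrable_Rintegral12 mD1 mD2 Gi).
have Hi : lebP.-integrable D2 (EFin \o (fun z => \int[leb]_(b in D1) G (b, z))).
  exact: (integrable_Rintegral21 mD1 mD2 Gi).
have i6 : leb.-integrable `[t, t + s]
    (EFin \o (fun q => \int[P]_w \int[leb]_(b in D1) G (b, (q, w)))).
  exact: (integrable_Rintegral12 (m1 := leb) (m2 := P) (measurable_itvcc t (t + s)) measurableT Hi).
have E6 : \int[lebP]_(z in D2) \int[leb]_(b in D1) G (b, z) =
    \int[leb]_(q in `[t, t + s]) \int[P]_w \int[leb]_(b in D1) G (b, (q, w)).
  exact: (Rintegral_prod12 (m1 := leb) (m2 := P) (measurable_itvcc t (t + s)) measurableT Hi).
(* The hypotenuse is parametrized by [q] in one identity and by [b] in the other; reflection matches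
   them. *)
have refl : \int[leb]_(q in `[t, t + s]) k (t + s - q) q = \int[leb]_(b in `[0, s]) k b (t + s - b).
  have := Rintegral_subl (f := fun b => k b (t + s - b)) (t + s) i1.
  rewrite addrK subr0 => <-; apply: eq_Rintegral => q _; by rewrite subKr.
have e1 : `|\int[leb]_(b in `[0, s]) (k b (t + s - b) - k b t - \int[lebP]_(z in D2) G (b, z))| <= eps * s.
  rewrite -[X in eps * X](subr0 s); apply: leb_bound; [exact: s0| |exact: inner_b].
  by apply: integrableRB => //; exact: integrableRB.
have e2 : `|\int[leb]_(q in `[t, t + s]) (\int[P]_w \int[leb]_(b in D1) G (b, (q, w)) -
    (k (t + s - q) q - k 0 q))| <= eps * s.
  have -> : eps * s = eps * (t + s - t) by congr (_ * _); lra.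
  apply: leb_bound; [exact: tts| |exact: inner_q].
  by apply: integrableRB => //; exact: integrableRB.
move: e1 e2.
rewrite RintegralB//; last exact: integrableRB.
rewrite RintegralB//.
rewrite RintegralB//; last exact: integrableRB.
rewrite RintegralB// refl -E6 -fub.
rewrite -/D1.
move: (\int[leb]_(b in D1) \int[lebP]_(z in D2) G (b, z)) => x1.
move: (\int[leb]_(b in D1) k b (t + s - b)) => x2.
rewrite -/(k _ _).
move: (\int[leb]_(b in D1) k b t) => x3.
move: (\int[leb]_(q in `[t, t + s]) k 0 q) => x4 h1 h2.
have -> : x3 - x4 = - ((x2 - x3 - x1) + (x1 - (x2 - x4))) by ring.
rewrite normrN (le_trans (ler_normD _ _))//.
have -> : 2 * eps * s = eps * s + eps * s by ring.
exact: lerD.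
Qed.

End triangle.

(** * Confinement of the total mass *)

(** The path is read at the right end [v m x] of the cell of mesh [1 / (m + 1)] containing [x]. This
    point lies strictly to the right of [x], so right-continuity gives convergence, and on each cell
    the approximation depends on [w] alone. *)
Lemma measurable_right_continuous d (Omega : measurableType d) (R : realType)
    (Y : R -> Omega -> R) (D : set (measurableTypeR R * Omega)) :
  measurable D -> (forall z, D z -> 0 <= z.1) ->
  (forall t, 0 <= t -> measurable_fun setT (Y t)) ->
  (forall t w, 0 <= t -> (Y ^~ w) @ at_right t --> Y t w) ->
  measurable_fun D (fun z => Y z.1 z.2).
Proof.
move=> mD D0 mY rY.
pose v (m : nat) (x : R) : R := (truncn (x * m.+1%:R)).+1%:R / m.+1%:R.
have vgt m x : 0 <= x -> x < v m x <= x + m.+1%:R^-1.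
  move=> x0; have xm : 0 <= x * m.+1%:R by rewrite mulr_ge0.
  have /andP[h1 h2] := truncn_itv xm; rewrite /v ltr_pdivlMr// h2 /=.
  by rewrite ler_pdivrMr// mulrDl mulVf// -natr1 lerD2r.
apply: (@measurable_fun_cvg _ _ _ D (fun m z => Y (v m z.1) z.2)) => [m|[x w] Dz]; last first.
  have x0 := D0 _ Dz; rewrite /= in x0.
  have /cvgrPdist_lt rc := rY x w x0; apply/cvgrPdist_lt => e e0 /=.
  have [r /= r0 hr] := rc e e0.
  near=> m; have /andP[h1 h2] := vgt m x x0.
  apply: hr => //=; rewrite ltr0_norm ?subr_lt0// opprB.
  rewrite (@le_lt_trans _ _ m.+1%:R^-1)// ?lerBlDl//.
  by near: m; exact: near_infty_natSinv_lt (PosNum r0).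
pose E k : set (measurableTypeR R * Omega) :=
  ([set` `[k%:R / m.+1%:R, k.+1%:R / m.+1%:R[] : set (measurableTypeR R)) `*` [set: Omega].
have mE k : measurable (E k) by apply: measurableX => //; exact: measurable_itv.
have DE : D `<=` \bigcup_k E k.
  move=> [x w] /D0 /= x0; have xm : 0 <= x * m.+1%:R by rewrite mulr_ge0.
  exists (truncn (x * m.+1%:R)) => //; split => //=; rewrite in_itv/=.
  by have := truncn_itv xm; rewrite ler_pdivrMr// ltr_pdivlMr.
apply: (measurable_funS _ DE); first exact: bigcup_measurable.
apply/(measurable_fun_bigcup _ mE) => k.
apply: (@eq_measurable_fun _ _ _ _ _ (fun z => Y (k.+1%:R / m.+1%:R) z.2)).
  move=> [x w]; rewrite inE /E /= in_itv/= => -[/andP[h1 h2] _]; rewrite /v.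
  rewrite (@truncn_def _ _ k)//.
  by rewrite -ler_pdivrMr// h1 -ltr_pdivlMr.
apply: measurable_funTS.
apply: (@measurableT_comp _ _ _ _ _ _ (Y (k.+1%:R / m.+1%:R)) _ snd) => //.
by apply: mY; rewrite divr_ge0.
Unshelve. all: by end_near. Qed.

(** The one-sided limits bound [f] near every point of the compact interval. At 0 there is no left
    limit, which is why only nonnegative times are compared. *)
Lemma cadlag_bounded (R : realType) (f : R -> R) (q : R) :
  (forall t, 0 <= t -> f @ at_right t --> f t) ->
  (forall t, 0 < t -> cvg (f @ at_left t)) ->
  exists n0 : nat, forall n, (n0 <= n)%N -> forall u, 0 <= u <= q -> f u <= n%:R.
Proof.
move=> rc ll.
have loc (u : R) : 0 <= u -> exists C : R, \forall u' \near u, 0 <= u' -> f u' <= C.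
  move=> u0; have /cvgrPdist_le/(_ 1 ltr01)[r1 /= r10 h1] := rc u u0.
  have [l [r2 r20 h2]] : exists l : R, exists2 r2 : R, 0 < r2 & forall u' : R, `|u - u'| < r2 -> 0 <= u' -> u' < u -> f u' <= l.
    move: u0; rewrite le_eqVlt => /predU1P[<-|u0].
      by exists 0; exists 1 => // u' _ h; rewrite ltNge h.
    have /cvgrPdist_le/(_ 1 ltr01)[r2 /= r20 h2] := ll u u0.
    exists (lim (f @ at_left u) + 1); exists r2 => // u' h _ uu.
    by have := h2 u' h uu; rewrite ler_norml => /andP[+ _]; rewrite /=; lra.
  exists (maxr (f u + 1) l); exists (minr r1 r2); first by rewrite /= lt_min r10.
  move=> u' /=; rewrite lt_min => /andP[b1 b2] u'0; rewrite le_max.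
  have [uu|uu|<-] := ltgtP u' u.
  - by rewrite (h2 u') ?orbT.
  - by have := h1 u' b1 uu; rewrite ler_norml => /andP[+ _]; rewrite /= => ?; apply/orP; left; lra.
  - by rewrite lerDl ler01.
have /compact_near_coveringP cov := @segment_compact R 0 q.
have : \forall n \near \oo, `[0, q]%classic `<=` (fun u => 0 <= u -> f u <= n%:R).
  apply: cov => u; rewrite /= in_itv/= => /andP[u0 _]; have [C hC] := loc u u0.
  exists ([set u' | 0 <= u' -> f u' <= C], [set n : nat | C <= n%:R]).
    by split => //=; exact: nbhs_infty_ger.
  by move=> [u' n] [/= h1 h2] u'0; rewrite (le_trans (h1 u'0)).
move=> [n0 _ h]; exists n0 => n n0n u /andP[u0 uq].
by apply: (h n n0n u) => //=; rewrite in_itv/= u0.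
Qed.

Section confinement.
Context (R : realType) (K : pseudoPMetricType R).
Context d (Omega : measurableType d) (P : probability Omega R).
Variables (Fil : R -> set (set Omega)) (X : R -> Omega -> Mplus K).
Hypotheses (fil : filtration Fil) (cad : forall w, cadlag_path (fun t => X t w))
  (adapt : forall t, 0 <= t -> forall h : K -> R, continuous h ->
     measurable_wrt (Fil t) (fun w => pair h (X t w))).
Notation LR := (measurableTypeR R).

Lemma process_measurable t h : 0 <= t -> continuous h ->
  measurable_fun setT (fun w => pair h (X t w)).
Proof.
move=> t0 ch _ B mB; rewrite setTI.
by case: fil => _ [fm _]; apply: (fm t); exact: adapt.
Qed.

Lemma process_joint (D : set (LR * Omega)) h : measurable D ->
  (forall z, D z -> 0 <= z.1) -> continuous h ->
  measurable_fun D (fun z => pair h (X z.1 z.2)).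
Proof.
move=> mD D0 ch.
apply: (@measurable_right_continuous _ _ _ (fun t w => pair h (X t w))) => //.
  by move=> t t0; exact: process_measurable.
by move=> t w t0; have [+ _] := cad w ch; exact.
Qed.

(** The rationals as a real sequence, with value 0 at indices that code none; testing the mass along
    it keeps the confinement events countable intersections. *)
Let r_ (n : nat) : R := if unpickle n is Some u then ratr (u : rat) else 0.

Let r_dense (x y : R) : x < y -> exists n, x < r_ n < y.
Proof.
move=> /rat_in_itvoo[u]; rewrite in_itv/= => h.
by exists (pickle u); rewrite /r_ pickleK.
Qed.

Let mX t w := mass (X t w).

(* [confined N q]: the total mass has not exceeded [N] up to time [q] *)
Definition confined (N : nat) (q : R) : set Omega :=
  [set w | mX q w <= N%:R] `&`
  \bigcap_n [set w | 0 <= r_ n <= q -> mX (r_ n) w <= N%:R].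

Let cst1 : continuous (fun _ : K => 1 : R). Proof. exact: continuous_cst. Qed.

Let FmX N q : 0 <= q -> Fil q [set w | mX q w <= N%:R].
Proof.
move=> q0; have := adapt q0 cst1 (measurable_itv `]-oo, N%:R]).
by congr (Fil _ _); apply/seteqP; split => w; rewrite /= in_itv.
Qed.

Lemma confined_adapted N q : 0 <= q -> Fil q (confined N q).
Proof.
move=> q0; have fG : sigma_algebra setT (Fil q) by case: fil.
apply: (sigma_algebra_setI fG); first exact: FmX.
apply: (sigma_algebra_setbigcap fG) => n.
have [rn|nrn] := boolP (0 <= r_ n <= q).
  have /andP[rn0 rnq] := rn; case: fil => _ [_ /(_ _ _ rnq)]; apply.
  have := FmX N rn0; congr (Fil _ _); apply/seteqP; split => w //=; exact.
rewrite (_ : [set _ | _] = ~` set0); first by apply: (sigma_algebra_setC fG); case: fG.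
by apply/seteqP; split => w //= _.
Qed.

(** The time [q] may be irrational and thus untested in [confined N q']. By right-continuity a mass
    above [N] at [q] would persist to a rational time before [q']. *)
Lemma confined_decr N q q' w : 0 <= q -> q <= q' -> confined N q' w -> confined N q w.
Proof.
move=> q0; rewrite le_eqVlt => /predU1P[<-//|qq'] [h1 h2]; split; last first.
  by move=> n _ /= /andP[rn0 rnq]; apply: (h2 n I); rewrite rn0 (le_trans rnq)// ltW.
rewrite /= leNgt; apply/negP => Nlt.
have [rc _] := cad w cst1.
have e0 : 0 < mX q w - N%:R by rewrite subr_gt0.
have /cvgrPdist_lt/(_ _ e0)[r /= r0 hr] := rc q q0.
have [n /andP[n1 n2]] : exists n, q < r_ n < minr q' (q + r).
  by apply: r_dense; rewrite lt_min qq' ltrDl.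
move: n2; rewrite lt_min => /andP[n2 n3].
have := h2 n I; rewrite /= (le_trans q0 (ltW n1)) (ltW n2) => /(_ isT).
have := hr (r_ n); rewrite /= ltr0_norm ?subr_lt0// opprB ltrBlDl => /(_ n3 n1).
rewrite -/(mX _ _) ltr_norml => /andP[_]; rewrite /mX /mass; lra.
Qed.

(** Each rational constraint is a union of two cylinders: the current time precedes [r_ n], or the
    mass at [r_ n] is at most [N]. *)
Lemma confined_joint N (D : set (LR * Omega)) : measurable D ->
  (forall z, D z -> 0 <= z.1) ->
  measurable_fun D (fun z => \1_(confined N z.1) z.2 : R).
Proof.
move=> mD D0.
pose E := D `&` [set z | confined N z.1 z.2].
have mE : measurable E.
  rewrite (_ : E = (D `&` [set z | mX z.1 z.2 <= N%:R]) `&`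
    \bigcap_n (D `&` [set z | 0 <= r_ n <= z.1 -> mX (r_ n) z.2 <= N%:R])); last first.
    apply/seteqP; split => [z [Dz [h1 h2]]|z [[Dz h1] h2]].
      by split => // n _; split => //; exact: h2.
    by split => //; split => // n _; have [] := h2 n I.
  apply: measurableI.
    rewrite (_ : [set _ | _] = (fun z => mX z.1 z.2) @^-1` `]-oo, N%:R]); last first.
      by apply/seteqP; split => z; rewrite /= in_itv.
    by apply: (process_joint mD D0 cst1 mD); exact: measurable_itv.
  apply: bigcapT_measurable => n.
  have [rn|rn] := leP 0 (r_ n); last first.
    rewrite (_ : _ `&` _ = D)//; by apply/seteqP; split => [z []//|z Dz]; split.
  rewrite (_ : _ `&` _ = D `&` ((fst @^-1` `]-oo, r_ n[) `|` (snd @^-1` [set w | mX (r_ n) w <= N%:R]))).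
    apply: measurableI => //; apply: measurableU.
      by rewrite -[X in measurable X]setTI; apply: measurable_fst => //; exact: measurable_itv.
    rewrite -[X in measurable X]setTI; apply: measurable_snd => //.
    by case: fil => _ [fm _]; apply: (fm (r_ n)); exact: FmX.
  apply/seteqP; split => z [Dz /= h]; split => //=.
    by have [zr|rz] := ltP z.1 (r_ n); [left; rewrite in_itv|right; exact: h].
  by move=> rz; case: h => //; rewrite in_itv/= ltNge rz.
have : measurable_fun D (\1_E : LR * Omega -> R) by exact: measurable_indic.
apply: eq_measurable_fun => z; rewrite inE => Dz; rewrite !indicE; congr ((nat_of_bool _)%:R).
by apply/idP/idP; rewrite !inE /E /=; [case|].
Qed.

Lemma confined_mass N q w : confined N q w -> mass (X q w) <= N%:R.
Proof. by case. Qed.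

(** The mass along a cadlag path is bounded on [[0, q]], so every path is confined for large [N]. *)
Lemma confined_prob q : 0 <= q ->
  fine (P (~` confined N q)) @[N --> \oo] --> (0 : R).
Proof.
move=> q0.
have mB N : measurable (confined N q).
  by case: fil => _ [fm _]; apply: (fm q); exact: confined_adapted.
have E N : fine (P (~` confined N q)) = \int[P]_w (\1_(~` confined N q) w).
  by rewrite /Rintegral integral_indic ?setIT//; exact: measurableC.
rewrite (_ : (fun N => _) = fun N => \int[P]_w (\1_(~` confined N q) w)); last exact/funext.
rewrite -[X in _ --> X](_ : \int[P]_(w in setT) (0 : R) = 0); last by rewrite Rintegral_cst// mul0r.
apply: (@Rdominated_cvg _ _ _ P setT _ _ (fun _ => 1)) => //.
- by move=> N; apply: measurable_indic; exact: measurableC.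
- apply: aeW => w _.
  have [rc ll] := cad w cst1.
  have [n0 hn] : exists n0 : nat, forall n, (n0 <= n)%N -> forall u : R, 0 <= u <= q -> mX u w <= n%:R.
    exact: cadlag_bounded rc ll.
  apply: (@cvg_trans _ ((fun _ : nat => 0 : R) @ \oo)); last exact: cvg_cst.
  apply: near_eq_cvg; exists n0 => // n /= nn; rewrite indicE memNset//=; apply.
  split; first by apply: (hn n nn); rewrite q0 lexx.
  by move=> m _ /= h; exact: (hn n nn).
- apply: (@bounded_integrableR _ _ _ P _ measurableT _ _ 1) => [||w _].
  + by rewrite (le_lt_trans (probability_le1 P measurableT))// ltry.
  + exact: measurable_cst.
  + by rewrite normr1.
- by move=> n w _; rewrite indicE; case: (_ \in _); rewrite ?normr1 ?normr0.
Qed.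

End confinement.

(** * The exponential-affine flow *)

Section left_derivative.
Context (R : realType).
Notation leb := (@lebesgue_measure R).

Let left_near (h : R -> R) (b e : R) : h x @[x --> b^'-] --> h b -> 0 < e ->
  exists2 d : R, 0 < d & forall x, b - d < x -> x <= b -> `|h x - h b| <= e.
Proof.
move=> /cvgrPdist_le hb e0; have [d /= d0 hd] := hb e e0.
exists d => // x xd; rewrite le_eqVlt => /predU1P[->|xb]; first by rewrite subrr normr0 ltW.
rewrite distrC; apply: hd => //=; rewrite gtr0_norm ?subr_gt0//; lra.
Qed.

Let left_average (h : R -> R) (a b e : R) : a <= b ->
  leb.-integrable `[a, b] (EFin \o h) -> (forall x, a <= x <= b -> `|h x - h b| <= e) ->
  `|\int[leb]_(x in `[a, b]) h x - h b * (b - a)| <= e * (b - a).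
Proof.
move=> ab hi he.
have hbi : leb.-integrable `[a, b] (EFin \o (fun _ => h b)).
  by apply: (@bounded_integrableR _ _ _ leb _ _ (lebesgue_itvcc_lty a b) _ `|h b|).
have di : leb.-integrable `[a, b] (EFin \o (fun x => h x - h b)) by apply: integrableRB.
have E : fine (leb `[a, b]) = b - a by rewrite lebesgue_itvcc.
have -> : h b * (b - a) = \int[leb]_(x in `[a, b]) (h b) by rewrite Rintegral_cst// E.
rewrite -RintegralB// -E.
apply: Rintegral_bound => //; first exact: lebesgue_itvcc_lty.
by apply/measurable_EFinP; exact: (measurable_int _ di).
Qed.

(** Subtracting the hypothesis at [S - dl] from that at [S] equates the integrals over the last
    stretch of length [dl]; by left continuity each is within [e * dl] of [dl] times the endpoint
    value. *)
Lemma eq_of_integrals (h1 h2 : R -> R) (t S : R) : 0 < S ->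
  leb.-integrable `[0, S] (EFin \o h1) -> leb.-integrable `[t, t + S] (EFin \o h2) ->
  (forall s, 0 <= s <= S ->
     \int[leb]_(x in `[0, s]) h1 x = \int[leb]_(x in `[t, t + s]) h2 x) ->
  h1 x @[x --> S^'-] --> h1 S -> h2 x @[x --> (t + S)^'-] --> h2 (t + S) ->
  h1 S = h2 (t + S).
Proof.
move=> S0 i1 i2 E c1 c2.
have key e : 0 < e -> `|h1 S - h2 (t + S)| <= 2 * e.
  move=> e0; have [d1 d10 H1] := left_near c1 e0; have [d2 d20 H2] := left_near c2 e0.
  pose m := minr (minr d1 d2) S.
  have m0 : 0 < m by rewrite !lt_min d10 d20.
  have m1 : m <= d1 by rewrite !ge_min lexx.
  have m2 : m <= d2 by rewrite !ge_min lexx orbT.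
  have mS : m <= S by rewrite ge_min lexx orbT.
  clearbody m; pose dl := m / 2.
  have [l0 l1 l2 lS] : [/\ 0 < dl, dl < d1, dl < d2 & dl < S].
    by rewrite /dl; split; lra.
  clearbody dl.
  have u1 : 0 <= S - dl by lra.
  have u2 : S - dl <= S by lra.
  have v1 : t <= t + (S - dl) by lra.
  have v2 : t + (S - dl) <= t + S by lra.
  have D : \int[leb]_(x in `[S - dl, S]) h1 x = \int[leb]_(x in `[t + (S - dl), t + S]) h2 x.
    have := E S; rewrite lexx (ltW S0) => /(_ isT).
    rewrite (Rintegral_cat u1 u2 i1) (Rintegral_cat v1 v2 i2).
    have -> := E (S - dl); last by rewrite u1 u2.
    exact: addrI.
  have j1 : leb.-integrable `[S - dl, S] (EFin \o h1).
    by apply: integrableS i1 => //; apply: subset_itvr; rewrite bnd_simp.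
  have j2 : leb.-integrable `[t + (S - dl), t + S] (EFin \o h2).
    by apply: integrableS i2 => //; apply: subset_itvr; rewrite bnd_simp.
  have A1 : `|\int[leb]_(x in `[S - dl, S]) h1 x - h1 S * (S - (S - dl))| <= e * (S - (S - dl)).
    by apply: left_average => // x /andP[? ?]; apply: H1 => //; lra.
  have A2 : `|\int[leb]_(x in `[t + (S - dl), t + S]) h2 x
      - h2 (t + S) * (t + S - (t + (S - dl)))| <= e * (t + S - (t + (S - dl))).
    by apply: left_average => // x /andP[? ?]; apply: H2 => //; lra.
  move: A1 A2; rewrite D.
  have -> : S - (S - dl) = dl by ring.
  have -> : t + S - (t + (S - dl)) = dl by ring.
  move: (\int[leb]_(x in _) _) (h1 S) (h2 _) => I a b A1 A2.
  rewrite -(ler_pM2r l0) -[X in _ * X <= _](gtr0_norm l0) -normrM.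
  have -> : (a - b) * dl = (I - b * dl) - (I - a * dl) by ring.
  apply: le_trans (ler_normB _ _) _; have -> : 2 * e * dl = e * dl + e * dl by ring.
  exact: lerD.
apply/eqP; rewrite -subr_eq0; apply/negPn/negP => ne.
have p : 0 < `|h1 S - h2 (t + S)| by rewrite normr_gt0.
move: p key; move: `|_| => x p key.
have x4 : 0 < x / 4 by lra.
have := key _ x4; lra.
Qed.

End left_derivative.

(** * The flow equation in integrated form, with its bounds and measurability *)

Section affine_flow.
Context (R : realType) (K : pseudoPMetricType R).
Hypothesis Kcpt : compact [set: K].
Notation leb := (@lebesgue_measure R).
Notation LR := (measurableTypeR R).
Variables (S : R) (f : R -> R) (p r : R -> K -> R).
Hypotheses (S0 : 0 < S)
  (cp : forall b, 0 <= b <= S -> continuous (p b))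
  (cr : forall b, 0 <= b <= S -> continuous (r b))
  (p0 : forall b x, 0 <= b <= S -> p b x <= 0)
  (ri : forall nu, leb.-integrable `[0, S] (EFin \o (fun b => pair (r b) nu)))
  (pE : forall nu b, 0 <= b <= S ->
     pair (p b) nu = pair (p 0) nu + \int[leb]_(x in `[0, b]) pair (r x) nu)
  (fi : leb.-integrable `[0, S] (EFin \o f))
  (phi0 : forall b, 0 <= b <= S -> \int[leb]_(x in `[0, b]) f x <= 0).

Definition flow_exp (b : R) (nu : Mplus K) : R :=
  expR (\int[leb]_(x in `[0, b]) f x + pair (p b) nu).

Definition flow_rate (b : R) (nu : Mplus K) : R := f b + pair (r b) nu.

Notation V := flow_exp.
Notation l := flow_rate.

Lemma flow_expE b nu : V b nu = expR (\int[leb]_(x in `[0, b]) f x) * expf (p b) nu.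
Proof. by rewrite /flow_exp expRD. Qed.

Lemma expf01 b nu : 0 <= b <= S -> 0 <= expf (p b) nu <= 1.
Proof.
move=> bS; rewrite expR_ge0 -expR0 ler_expR.
by apply: pair_le0 => //; [exact: cp|move=> x; exact: p0].
Qed.

Lemma scale01 b : 0 <= b <= S -> 0 <= expR (\int[leb]_(x in `[0, b]) f x) <= 1.
Proof. by move=> bS; rewrite expR_ge0 -expR0 ler_expR; exact: phi0. Qed.

(** The signs of [phi] and [psi] enter here; with [V] in [[0, 1]], the error from leaving an event
    is at most its probability. *)
Lemma flow_exp01 b nu : 0 <= b <= S -> 0 <= V b nu <= 1.
Proof.
move=> bS; rewrite flow_expE; have /andP[a0 a1] := expf01 nu bS.
by have /andP[b0 b1] := scale01 bS; rewrite mulr_ge0// mulr_ile1.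
Qed.

Let sub0 (u : R) : 0 <= u <= S -> [set` `[0, u]] `<=` [set` `[0, S]].
Proof. by move=> /andP[_ uS]; apply: subset_itvl; rewrite bnd_simp. Qed.

Let restr u (h : R -> R) : 0 <= u <= S -> leb.-integrable `[0, S] (EFin \o h) ->
  leb.-integrable `[0, u] (EFin \o h).
Proof. by move=> uS hi; apply: integrableS hi => //; exact: sub0. Qed.

Let li u nu : 0 <= u <= S -> leb.-integrable `[0, u] (EFin \o (l ^~ nu)).
Proof.
move=> uS.
have h1 : leb.-integrable `[0, u] (EFin \o f) by exact: restr uS fi.
have h2 : leb.-integrable `[0, u] (EFin \o (fun b => pair (r b) nu)).
  exact: restr uS (ri nu).
by apply: integrableRD.
Qed.

Lemma flow_chain u nu : 0 <= u <= S ->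
  leb.-integrable `[0, u] (EFin \o (fun b => l b nu * V b nu)) /\
  V u nu - V 0 nu = \int[leb]_(b in `[0, u]) (l b nu * V b nu).
Proof.
move=> uS; have /andP[u0 uS'] := uS.
apply: (@expR_integral_chain R (l ^~ nu)
  (fun b => \int[leb]_(x in `[0, b]) f x + pair (p b) nu) 0 u u0 (li nu uS)).
  move=> b /andP[b0 bu]; have bS : 0 <= b <= S by rewrite b0 (le_trans bu).
  rewrite (pE nu bS) set_itv1 Rintegral_set1 add0r addrCA; congr (_ + _).
  rewrite /flow_rate RintegralD//.
  - exact: restr bS fi.
  - exact: restr bS (ri nu).
move=> b /andP[b0 bu]; have bS : 0 <= b <= S by rewrite b0 (le_trans bu).
by have /andP[_] := flow_exp01 nu bS; rewrite -[X in _ <= X]expR0 ler_expR.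
Qed.

(** The maximum keeps the time in the range where the flow is controlled, even along sequences whose
    first terms are negative. *)
Lemma flow_exp_left nu : V (maxr 0 b) nu @[b --> S^'-] --> V S nu.
Proof.
have SS : 0 <= S <= S by rewrite lexx ltW.
have [gi E] := flow_chain nu SS.
have h : V 0 nu + \int[leb]_(x in `[0, u]) (l x nu * V x nu) @[u --> S^'-] -->
    V 0 nu + \int[leb]_(x in `[0, S]) (l x nu * V x nu).
  by apply: cvgD; [exact: cvg_cst|exact: parameterized_integral_cvg_at_left S0 gi].
rewrite -E addrC subrK in h; apply: cvg_trans h; apply: near_eq_cvg; near=> u.
have u0 : 0 < u by near: u; exact: nbhs_left_gt.
have uS : u < S by near: u; exact: nbhs_left_lt.
have uu : 0 <= u <= S by rewrite !ltW.
have [_ Eu] := flow_chain nu uu.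
by rewrite max_r ?(ltW u0)// -Eu addrC subrK.
Unshelve. all: by end_near. Qed.

Let mpar (h : R -> R) : leb.-integrable `[0, S] (EFin \o h) ->
  measurable_fun [set` `[0, S]] (fun b => \int[leb]_(x in `[0, b]) h x).
Proof.
move=> hi; have c := parameterized_integral_continuous (ltW S0) hi.
exact: (subspace_continuous_measurable_fun (measurable_itv _) c).
Qed.

(** Paired with a point mass, the flow equation presents [p b x] as an indefinite integral, hence
    continuous in [b]. *)
Let mp x : measurable_fun [set` `[0, S]] (p ^~ x).
Proof.
have [nu nuP] := dirac_Mplus x; have z0 : 0 <= (0 : R) <= S by rewrite lexx ltW.
have : measurable_fun [set` `[0, S]]
    (fun b => pair (p 0) nu + \int[leb]_(x in `[0, b]) pair (r x) nu).
  apply: measurable_funD; first exact: measurable_cst.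
  exact: mpar.
apply: eq_measurable_fun => b; rewrite inE/= in_itv/= => bS.
by rewrite -pE// nuP//; exact: cp.
Qed.

Let ms (s : R) : s <= S -> [set` `[0, s]] `<=` [set` `[0, S]].
Proof. by move=> sS; apply: subset_itvl; rewrite bnd_simp. Qed.

Let mfst d2 (T2 : measurableType d2) (D2 : set T2) (h : R -> R) (s : R) :
  s <= S -> measurable D2 -> measurable_fun [set` `[0, S]] h ->
  measurable_fun (([set` `[0, s]] : set LR) `*` D2) (fun bz : LR * T2 => h bz.1).
Proof.
move=> sS mD2 mh.
apply: (@measurable_comp _ _ _ _ _ _ ([set` `[0, S]] : set LR) h _
  (fst : LR * T2 -> LR)).
- exact: measurable_itv.
- by move=> _ [[x y] [xs _] <-]; exact: (ms sS).
- exact: mh.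
- exact: measurable_funTS measurable_fst.
Qed.

Let mpair_ d2 (T2 : measurableType d2) (D2 : set T2) (nu : T2 -> Mplus K) (s : R)
    (q : R -> K -> R) : s <= S -> measurable D2 ->
  (forall b, 0 <= b <= S -> continuous (q b)) ->
  (forall x, measurable_fun [set` `[0, S]] (q ^~ x)) ->
  (forall h, continuous h -> measurable_fun D2 (fun z => pair h (nu z))) ->
  measurable_fun (([set` `[0, s]] : set LR) `*` D2) (fun bz : LR * T2 => pair (q bz.1) (nu bz.2)).
Proof.
move=> sS mD2 cq mq mnu.
apply: (pair_jointly_measurable Kcpt (T1 := LR) (h := q)) => //.
- move=> b; rewrite /= in_itv/= => /andP[b0 bs]; apply: cq.
  by rewrite b0 (le_trans bs).
- move=> x; apply: measurable_funS (mq x); first exact: measurable_itv.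
  exact: ms.
Qed.

Lemma flow_exp_measurable d2 (T2 : measurableType d2) (D2 : set T2)
    (nu : T2 -> Mplus K) (s : R) : s <= S -> measurable D2 ->
  (forall h, continuous h -> measurable_fun D2 (fun z => pair h (nu z))) ->
  measurable_fun (([set` `[0, s]] : set LR) `*` D2) (fun bz : LR * T2 => V bz.1 (nu bz.2)).
Proof.
move=> sS mD2 mnu; apply: measurableT_comp; first exact: measurable_expR.
apply: measurable_funD; last exact: (mpair_ sS mD2 cp mp mnu).
apply: (mfst (h := fun b => \int[leb]_(x in `[0, b]) f x)) => //; exact: mpar.
Qed.

Lemma flow_rate_measurable d2 (T2 : measurableType d2) (D2 : set T2)
    (nu : T2 -> Mplus K) (s : R) : s <= S -> measurable D2 ->
  (forall h, continuous h -> measurable_fun D2 (fun z => pair h (nu z))) ->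
  measurable_fun (([set` `[0, s]] : set LR) `*` D2) (fun bz : LR * T2 => l bz.1 (nu bz.2)).
Proof.
move=> sS mD2 mnu; apply: measurable_funD; last first.
  apply: mpair_ => // x; exact: (measurable_coord cr ri).
apply: mfst => //; apply/measurable_EFinP; exact: (measurable_int _ fi).
Qed.

Lemma flow_rate_bound b (N : R) : 0 <= b <= S -> 0 <= N ->
  exists2 C, 0 <= C & forall nu, mass nu <= N -> `|l b nu| <= C.
Proof.
move=> bS N0; have [C C0 rC] := continuous_bounded Kcpt (cr bS).
exists (`|f b| + C * N); first by rewrite addr_ge0// mulr_ge0.
move=> nu nuN; apply: le_trans (ler_normD _ _) _; rewrite lerD2l.
apply: le_trans (norm_pair_le Kcpt nu (cr bS) rC) _.
exact: ler_wpM2l.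
Qed.

(** At a fixed time the rate is bounded on measures of mass at most [N], but by a constant depending
    on [b]. Integrated over [b], a constant independent of [nu] comes from [uniform_integral_bound],
    and [V <= 1] removes the exponential. *)
Lemma flow_integral_bound (N : R) s : 0 <= N -> 0 <= s <= S ->
  exists C, forall nu, mass nu <= N ->
    \int[leb]_(b in `[0, s]) `|l b nu * V b nu| <= C.
Proof.
move=> N0 sS; have [C C0 rC] := uniform_integral_bound Kcpt (ltW S0) cr ri.
exists (\int[leb]_(b in `[0, S]) `|f b| + C * N) => nu nuN.
have SS : 0 <= S <= S by rewrite lexx ltW.
have nf : leb.-integrable `[0, S] (EFin \o (fun b => `|f b|)) by exact: integrable_norm fi.
have nr : leb.-integrable `[0, S] (EFin \o (fun b => `|pair (r b) nu|)).
  exact: integrable_norm (ri nu).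
have [gi _] := flow_chain nu SS.
have ng : leb.-integrable `[0, S] (EFin \o (fun b => `|l b nu * V b nu|)).
  exact: integrable_norm gi.
have /andP[s0 sS'] := sS.
apply: (le_trans (Rintegral_subitv (lexx 0) s0 sS' ng _)) => //.
apply: (@le_trans _ _ (\int[leb]_(b in `[0, S]) (`|f b| + `|pair (r b) nu|))).
  apply: le_Rintegral; first exact: measurable_itv.
  - exact: ng.
  - by apply: integrableRD.
  move=> b; rewrite /= in_itv/= => bS; have /andP[V0 V1] := flow_exp01 nu bS.
  rewrite normrM (ger0_norm V0); apply: le_trans (ler_normD _ _).
  by rewrite ler_piMr.
rewrite RintegralD// lerD2l; apply: le_trans (rC nu) _.
exact: ler_wpM2l.
Qed.

End affine_flow.

(** * The transform identity for a solution of the martingale problem *)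

Section affine_process.
Context (R : realType) (K : pseudoPMetricType R).
Hypothesis Kcpt : compact [set: K].
Context d (Omega : measurableType d) (P : probability Omega R).
Notation leb := (@lebesgue_measure R).
Notation LR := (measurableTypeR R).
Variables (Fil : R -> set (set Omega)) (X : R -> Omega -> Mplus K).
Variables (t S : R) (f : R -> R) (p r : R -> K -> R).
Hypotheses (S0 : 0 < S)
  (cp : forall b, 0 <= b <= S -> continuous (p b))
  (cr : forall b, 0 <= b <= S -> continuous (r b))
  (p0 : forall b x, 0 <= b <= S -> p b x <= 0)
  (ri : forall nu, leb.-integrable `[0, S] (EFin \o (fun b => pair (r b) nu)))
  (pE : forall nu b, 0 <= b <= S ->
     pair (p b) nu = pair (p 0) nu + \int[leb]_(x in `[0, b]) pair (r x) nu)
  (fi : leb.-integrable `[0, S] (EFin \o f))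
  (phi0 : forall b, 0 <= b <= S -> \int[leb]_(x in `[0, b]) f x <= 0)
  (t0 : 0 <= t) (fil : filtration Fil) (cad : forall w, cadlag_path (fun t => X t w))
  (adapt : forall t, 0 <= t -> forall h : K -> R, continuous h ->
     measurable_wrt (Fil t) (fun w => pair h (X t w)))
  (mpi : forall b w u, 0 <= b <= S -> 0 <= u -> leb.-integrable `[0, u]
     (EFin \o (fun q => flow_rate f r b (X q w) * expf (p b) (X q w))))
  (mpm : forall b, 0 <= b <= S -> local_martingale P Fil (fun u w =>
     expf (p b) (X u w) - expf (p b) (X 0 w) -
     \int[leb]_(q in `[0, u]) (flow_rate f r b (X q w) * expf (p b) (X q w)))).
Notation V := (flow_exp f p).
Notation l := (flow_rate f r).

Let TS0 : 0 <= t + S. Proof. by rewrite addr_ge0// ltW. Qed.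

Let filM u A : Fil u A -> measurable A.
Proof. by case: fil => _ [fm _]; exact: fm. Qed.

Let mB N q : 0 <= q -> measurable (confined X N q).
Proof. by move=> q0; apply: (@filM q); exact: confined_adapted. Qed.

Let eps N := fine (P (~` confined X N (t + S))).

Let eps_ge N q : 0 <= q -> q <= t + S -> fine (P (~` confined X N q)) <= eps N.
Proof.
move=> q0 qT; have m1 := measurableC (mB N q0); have m2 := measurableC (mB N TS0).
apply: fine_le; rewrite ?fin_num_measure//.
apply: le_measure; rewrite ?inE//.
by move=> w nB Bw; apply: nB; exact: (confined_decr cad q0 qT Bw).
Qed.

Let strip (a q : R) : set (LR * Omega) := ([set` `[a, q]] : set LR) `*` [set: Omega].

Let mstrip a q : measurable (strip a q).
Proof. by apply: measurableX => //; exact: measurable_itvcc. Qed.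

Let strip_ge0 a q z : 0 <= a -> strip a q z -> 0 <= z.1.
Proof.
by move=> a0 [/= + _]; rewrite in_itv/= => /andP[az _]; exact: le_trans az.
Qed.

Let mX a q h : 0 <= a -> continuous h ->
  measurable_fun (strip a q) (fun z => pair h (X z.1 z.2)).
Proof.
move=> a0 ch; apply: (process_joint fil cad adapt (mstrip a q) _ ch) => z.
exact: strip_ge0.
Qed.

Let mchi N a q : 0 <= a ->
  measurable_fun (strip a q) (fun z => \1_(confined X N z.1) z.2 : R).
Proof.
move=> a0; apply: (confined_joint fil cad adapt N (mstrip a q)) => z.
exact: strip_ge0.
Qed.

Let ml b a q : 0 <= b <= S -> 0 <= a ->
  measurable_fun (strip a q) (fun z => l b (X z.1 z.2)).
Proof.
move=> bS a0; apply: measurable_funD; first exact: measurable_cst.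
exact: mX a0 (cr bS).
Qed.

Let mE b a q : 0 <= b <= S -> 0 <= a ->
  measurable_fun (strip a q) (fun z => expf (p b) (X z.1 z.2)).
Proof.
move=> bS a0; apply: measurableT_comp; first exact: measurable_expR.
exact: mX a0 (cp bS).
Qed.

Let mV b a q : 0 <= b <= S -> 0 <= a ->
  measurable_fun (strip a q) (fun z => V b (X z.1 z.2)).
Proof.
move=> bS a0; apply: measurableT_comp; first exact: measurable_expR.
apply: measurable_funD; first exact: measurable_cst.
exact: mX a0 (cp bS).
Qed.

Let V01 b nu : 0 <= b <= S -> 0 <= V b nu <= 1.
Proof. exact: (flow_exp01 Kcpt cp p0 phi0). Qed.

Let lV_le b nu : 0 <= b <= S -> `|l b nu * V b nu| <= `|l b nu|.
Proof.
move=> bS; have /andP[a0 a1] := V01 nu bS.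
by rewrite normrM (ger0_norm a0) ler_piMr.
Qed.

Let chi01 N q w : 0 <= (\1_(confined X N q) w : R) <= 1.
Proof. by rewrite indicE; case: (_ \in _); rewrite ?lexx ler01. Qed.

Let chi_bound N (g : Mplus K -> R) (C : R) q w : 0 <= C ->
  (forall nu, mass nu <= N%:R -> `|g nu| <= C) ->
  `|g (X q w) * \1_(confined X N q) w| <= C.
Proof.
move=> C0 gC; rewrite indicE; have [Bq|Bq] := pselect (confined X N q w).
  by rewrite mem_set// mulr1 gC//; exact: confined_mass.
by rewrite memNset// mulr0 normr0.
Qed.

Let lV_bound N b : 0 <= b <= S -> exists2 C, 0 <= C & forall q w,
  `|l b (X q w) * V b (X q w) * \1_(confined X N q) w| <= C.
Proof.
move=> bS; have [C C0 lC] := flow_rate_bound Kcpt f cr bS (ler0n R N).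
exists C => // q w; apply: (chi_bound (g := fun nu => l b nu * V b nu)) => // nu nuN.
by apply: (le_trans (lV_le nu bS)); exact: lC.
Qed.

(** The martingale problem enters here: the exit estimate is applied to [exp <psi_b, X>] and scaled
    by [exp phi_b], for one fixed [b] at a time. *)
Let est N A b a q : 0 <= b <= S -> 0 <= a -> a <= q -> q <= t + S -> Fil a A ->
  `|\int[P]_(w in A) (V b (X q w) - V b (X a w) -
    \int[leb]_(x in `[a, q]) (l b (X x w) * V b (X x w) * \1_(confined X N x) w))| <= eps N.
Proof.
move=> bS a0 aq qT aA.
have [C C0 lC] := flow_rate_bound Kcpt f cr bS (ler0n R N).
have E01 nu : 0 <= expf (p b) nu <= 1 by exact: (expf01 Kcpt cp p0).
have yrc u w : 0 <= u -> (fun s => expf (p b) (X s w)) @ at_right u --> expf (p b) (X u w).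
  move=> u0; have [h _] := cad w (cp bS).
  by apply: continuous_cvg; [exact: continuous_expR|exact: h].
have my u : 0 <= u -> measurable_fun setT (fun w => expf (p b) (X u w)).
  move=> u0; apply: measurableT_comp; first exact: measurable_expR.
  exact: (process_measurable fil adapt u0 (cp bS)).
have li u w : 0 <= u ->
    leb.-integrable `[0, u] (EFin \o (fun q => l b (X q w) * expf (p b) (X q w))).
  by move=> u0; exact: mpi.
have FB u : 0 <= u -> Fil u (confined X N u) by move=> u0; exact: confined_adapted.
have Bdec u u' w : 0 <= u -> u <= u' -> confined X N u' w -> confined X N u w.
  by move=> u0 uu; exact: (confined_decr cad u0 uu).
have lB u w : 0 <= u -> confined X N u w -> `|l b (X u w) * expf (p b) (X u w)| <= C.
  move=> u0 Bu; have /andP[e0 e1] := E01 (X u w).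
  rewrite normrM (ger0_norm e0); apply: (@le_trans _ _ `|l b (X u w)|).
    by rewrite ler_piMr.
  by apply: lC; exact: confined_mass Bu.
have mlB : measurable_fun (strip a q) (fun qw : LR * Omega =>
    l b (X qw.1 qw.2) * expf (p b) (X qw.1 qw.2) * \1_(confined X N qw.1) qw.2).
  by apply: measurable_funM; [apply: measurable_funM; [exact: ml|exact: mE]|exact: mchi].
have k01 := scale01 phi0 bS.
have h := exit_estimate_scaled fil (fun u w => E01 (X u w)) yrc my (fun u w => li u w)
  (mpm bS) FB Bdec C0 lB a0 aq mlB k01 aA.
apply: (le_trans _ (eps_ge N (le_trans a0 aq) qT)); apply: le_trans h.
rewrite le_eqVlt; apply/orP; left; apply/eqP; congr (`|_|).
apply: eq_Rintegral => w _; rewrite !flow_expE; congr (_ - _).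
by apply: eq_Rintegral => x _; rewrite flow_expE mulrCA.
Qed.

Let lV_integrable N A b a q : 0 <= b <= S -> 0 <= a -> measurable A ->
  P.-integrable A (EFin \o (fun w =>
    \int[leb]_(x in `[a, q]) (l b (X x w) * V b (X x w) * \1_(confined X N x) w))).
Proof.
move=> bS a0 mA; have [C C0 lC] := lV_bound N bS.
have mlV : measurable_fun (strip a q) (fun qw : LR * Omega =>
    l b (X qw.1 qw.2) * V b (X qw.1 qw.2) * \1_(confined X N qw.1) qw.2).
  by apply: measurable_funM; [apply: measurable_funM; [exact: ml|exact: mV]|exact: mchi].
have mI : measurable (([set` `[a, q]] : set LR) `*` A).
  by apply: measurableX => //; exact: measurable_itvcc.
have Fi : (leb \x P)%E.-integrable (([set` `[a, q]] : set LR) `*` A)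
    (EFin \o (fun z : LR * Omega => l b (X z.1 z.2) * V b (X z.1 z.2) * \1_(confined X N z.1) z.2)).
  apply: (@bounded_integrableR _ _ _ _ _ mI _ _ C).
  - apply: le_lt_trans (itv_setT_lty P a q); apply: le_measure; rewrite ?inE//.
    + exact: mstrip.
    + by move=> [x w] [].
  - apply: measurable_funS mlV; first exact: mstrip.
    by move=> [x w] [].
  - by move=> z _; exact: lC.
exact: (integrable_Rintegral21 (m1 := leb) (m2 := P) (measurable_itvcc a q) mA Fi).
Qed.

Let mVX b q : 0 <= b <= S -> 0 <= q -> measurable_fun setT (fun w => V b (X q w)).
Proof.
move=> bS q0; apply: measurableT_comp; first exact: measurable_expR.
apply: measurable_funD; first exact: measurable_cst.
exact: (process_measurable fil adapt q0 (cp bS)).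
Qed.

Let VX_int A b q : 0 <= b <= S -> 0 <= q -> measurable A ->
  P.-integrable A (EFin \o (fun w => V b (X q w))).
Proof.
move=> bS q0 mA; apply: (@bounded_integrableR _ _ _ P A mA (probability_lty P mA) _ 1).
  exact: measurable_funTS (mVX bS q0).
by move=> w _; have /andP[V0 V1] := V01 (X q w) bS; rewrite ger0_norm.
Qed.

Let tri N A s : 0 <= s <= S -> Fil t A ->
  `|\int[leb]_(b in `[0, s]) (\int[P]_(w in A) V b (X t w)) -
    \int[leb]_(q in `[t, t + s]) (\int[P]_(w in A) V 0 (X q w))| <= 2 * eps N * s.
Proof.
move=> sS tA; have mA := filM tA; have /andP[s0 s1] := sS.
have bs b : 0 <= b <= s -> 0 <= b <= S.
  by move=> /andP[b0 b1]; rewrite b0 (le_trans b1).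
have mnu h : continuous h -> measurable_fun (strip t (t + s)) (fun z => pair h (X z.1 z.2)).
  exact: mX.
pose W b (z : LR * Omega) := l b (X z.1 z.2) * V b (X z.1 z.2) * \1_(confined X N z.1) z.2.
have mVt := flow_exp_measurable Kcpt S0 cp ri pE fi s1 (mstrip t (t + s)) mnu.
have mWt : measurable_fun (([set` `[0, s]] : set LR) `*` strip t (t + s))
    (fun bz : LR * (LR * Omega) => W bz.1 bz.2).
  apply: measurable_funM.
    apply: measurable_funM; last exact: mVt.
    exact: (flow_rate_measurable Kcpt cr ri fi s1 (mstrip t (t + s)) mnu).
  apply: (@measurable_comp _ _ _ _ _ _ (strip t (t + s))
    (fun z : LR * Omega => \1_(confined X N z.1) z.2 : R) _ (snd : LR * (LR * Omega) -> LR * Omega)).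
  - exact: mstrip.
  - by move=> _ [[x z] [_ zs] <-].
  - exact: mchi.
  - exact: measurable_funTS measurable_snd.
have gi u z : 0 <= u <= s -> leb.-integrable `[0, u]
    (EFin \o (fun b => l b (X z.1 z.2) * V b (X z.1 z.2))).
  move=> us; have [h _] := flow_chain Kcpt cp p0 ri pE fi phi0 (X z.1 z.2) (bs _ us); exact: h.
have ss : 0 <= s <= s by rewrite s0 lexx.
have Wi z : leb.-integrable `[0, s] (EFin \o (fun b => W b z)).
  rewrite (_ : (fun b => W b z) = fun b =>
    \1_(confined X N z.1) z.2 * (l b (X z.1 z.2) * V b (X z.1 z.2))).
    by apply: integrableRZ => //; exact: gi.
  by apply/funext => b; rewrite mulrC.
have WV u z : 0 <= u <= s -> \int[leb]_(b in `[0, u]) W b z =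
    (V u (X z.1 z.2) - V 0 (X z.1 z.2)) * \1_(confined X N z.1) z.2.
  move=> us; have g := gi u z us; rewrite /W RintegralZr//; congr (_ * _).
  by have [_ ->] := flow_chain Kcpt cp p0 ri pE fi phi0 (X z.1 z.2) (bs _ us).
have Wz : exists C, forall z : LR * Omega, strip t (t + s) z -> \int[leb]_(b in `[0, s]) `|W b z| <= C.
  have [C CP] := flow_integral_bound Kcpt S0 cp cr p0 ri pE fi phi0 (ler0n R N) sS.
  (* The maximum also covers points off the confinement event, where [W] vanishes. *)
  exists (maxr 0 C) => z _; rewrite /W indicE.
  have [Bz|Bz] := pselect (confined X N z.1 z.2); last first.
    rewrite memNset// (_ : \int[_]_(_ in _) _ = \int[leb]_(b in `[0, s]) 0).
      by rewrite Rintegral_cst// mul0r le_max lexx.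
    by apply: eq_Rintegral => b _; rewrite mulr0 normr0.
  rewrite mem_set// (_ : \int[_]_(_ in _) _ =
      \int[leb]_(b in `[0, s]) `|l b (X z.1 z.2) * V b (X z.1 z.2)|).
    by rewrite le_max CP ?orbT//; exact: confined_mass Bz.
  by apply: eq_Rintegral => b _; rewrite mulr1.
have Wb b : 0 <= b <= s -> exists C, forall z : LR * Omega, strip t (t + s) z -> `|W b z| <= C.
  by move=> /bs bS; have [C _ CP] := lV_bound N bS; exists C => z _; exact: CP.
have sml q : t <= q <= t + s -> \int[P]_(w in A) (1 - \1_(confined X N q) w) <= eps N.
  move=> /andP[tq qs]; have q0 := le_trans t0 tq.
  have qT : q <= t + S by rewrite (le_trans qs)// lerD2l.
  apply: le_trans (eps_ge N q0 qT); have mC := measurableC (mB N q0).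
  rewrite (_ : \int[_]_(_ in _) _ = \int[P]_(w in A) \1_(~` confined X N q) w); last first.
    apply: eq_Rintegral => w _; rewrite !indicE in_setC; case: (_ \in _); rewrite /= ?subrr ?subr0//.
  rewrite /Rintegral integral_indic//; apply: fine_le; rewrite ?fin_num_measure//.
  - exact: measurableI.
  - by apply: le_measure; rewrite ?inE//; exact: measurableI.
have est' b q : 0 <= b <= s -> t <= q <= t + s ->
    `|\int[P]_(w in A) (V b (X q w) - V b (X t w) - \int[leb]_(x in `[t, q]) W b (x, w))| <= eps N.
  move=> /bs bS /andP[tq qs]; apply: est => //.
  by rewrite (le_trans qs)// lerD2l.
have mct : measurable_fun (strip t (t + s)) (fun z => \1_(confined X N z.1) z.2 : R) by exact: mchi.
have h := (triangle (V := fun b z => V b (X z.1 z.2)) (W := W)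
  (chi := fun z => \1_(confined X N z.1) z.2) mA s0 mVt mWt mct
  (fun b z bS => V01 (X z.1 z.2) (bs _ bS)) (fun z => chi01 N z.1 z.2)
  (fun z _ => Wi z) (fun u z us _ => WV u z us) Wz Wb est' sml).
exact h.
Qed.

Let eps_small (e : R) : 0 < e -> exists N, eps N < e.
Proof.
move=> e0; have /cvgrPdist_lt/(_ _ e0)[N _ /(_ N (leqnn N))] := confined_prob P fil cad adapt TS0.
by rewrite /= sub0r normrN => h; exists N; exact: le_lt_trans (ler_norm _) h.
Qed.

Let integrals_eq A s : 0 <= s <= S -> Fil t A ->
  \int[leb]_(b in `[0, s]) (\int[P]_(w in A) V b (X t w)) =
  \int[leb]_(q in `[t, t + s]) (\int[P]_(w in A) V 0 (X q w)).
Proof.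
move=> sS tA; apply/eqP; rewrite -subr_eq0; apply/negPn/negP => ne.
have h N := tri N sS tA.
move: ne h; move: (_ - _) => D; rewrite -normr_gt0; move: `|D| => x x0 h.
have /andP[s0 s1] := sS.
(* With this choice the triangle error [2 * eps N * s] stays below [x / 2], contradicting
   [x > 0]. *)
have e0 : 0 < x / (4 * S) by rewrite divr_gt0// mulr_gt0.
have [N epsN] := eps_small e0.
have eN : eps N * S < x / 4.
  by move: epsN; rewrite invfM mulrA ltr_pdivlMr.
have e1 : 0 <= eps N by rewrite fine_ge0.
have : eps N * s <= eps N * S by rewrite ler_wpM2l.
have := h N; rewrite -mulrA; lra.
Qed.

Let left_b A : measurable A ->
  \int[P]_(w in A) V b (X t w) @[b --> S^'-] --> \int[P]_(w in A) V S (X t w).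
Proof.
move=> mA.
(* Clamping the time to [[0, S]] makes the bound by 1 valid along the whole of any approximating
   sequence. *)
have h : \int[P]_(w in A) V (maxr 0 (minr b S)) (X t w) @[b --> S^'-] --> \int[P]_(w in A) V S (X t w).
  apply/cvg_at_leftP => u [uS uc].
  have uu n : 0 <= maxr 0 (minr (u n) S) <= S.
    by rewrite le_max lexx ge_max (ltW S0) ge_min lexx orbT.
  have SS : 0 <= S <= S by rewrite lexx ltW.
  apply: (@Rdominated_cvg _ _ _ P A _ _ (fun _ => 1)) => //.
  - by move=> n; exact: measurable_funTS (mVX (uu n) t0).
  - exact: measurable_funTS (mVX SS t0).
  - apply: aeW => w _.
    have := flow_exp_left Kcpt S0 cp p0 ri pE fi phi0 (nu := X t w).
    move=> /cvg_at_leftP/(_ u (conj uS uc)); apply: cvg_trans.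
    apply: near_eq_cvg; apply: nearW => n /=.
    by rewrite min_l// ltW.
  - apply: (@bounded_integrableR _ _ _ P A mA (probability_lty P mA) _ 1).
      exact: measurable_cst.
    by move=> w _; rewrite normr1.
  - move=> n w _; have /andP[V0 V1] := V01 (X t w) (uu n).
    by rewrite ger0_norm.
apply: cvg_trans h; apply: near_eq_cvg; near=> b.
have b0 : 0 < b by near: b; exact: nbhs_left_gt.
have bS : b < S by near: b; exact: nbhs_left_lt.
have E : maxr 0 (minr b S) = b by rewrite (min_l (ltW bS)) (max_r (ltW b0)).
exact: (congr1 (fun x => \int[P]_(w in A) V x (X t w)) E).
Unshelve. all: by end_near. Qed.

(** The path may jump at [t + S], so left continuity is not pathwise. It holds in mean, by the
    martingale estimate on [[q, t + S]]: the confined drift is at most [C] times the length, and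
    leaving the confinement event has small probability. *)
Let left_q A : Fil t A ->
  \int[P]_(w in A) V 0 (X q w) @[q --> (t + S)^'-] --> \int[P]_(w in A) V 0 (X (t + S) w).
Proof.
move=> tA; have mA := filM tA; have z0 : 0 <= (0 : R) <= S by rewrite lexx ltW.
apply/cvgrPdist_le => e e0; have e2 : 0 < e / 2 by rewrite divr_gt0.
have [N epsN] := eps_small e2; have [C C0 lC] := lV_bound N z0.
have C1 : 0 < C + 1 by rewrite ltr_wpDl.
near=> q.
have tq : t < q by near: q; apply: nbhs_left_gt; rewrite ltrDl.
have qT : q < t + S by near: q; exact: nbhs_left_lt.
have qd : t + S - e / 2 / (C + 1) < q.
  by near: q; apply: nbhs_left_gt; rewrite gtrBl divr_gt0.
have q0 := le_trans t0 (ltW tq).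
have qA : Fil q A by case: fil => _ [_ /(_ _ _ (ltW tq))]; exact.
have := est N z0 q0 (ltW qT) (lexx _) qA.
have i1 := VX_int z0 TS0 mA; have i2 := VX_int z0 q0 mA.
have i3 := lV_integrable N (t + S) z0 q0 mA.
rewrite RintegralB//; last by apply: integrableRB.
rewrite RintegralB//.
have : `|\int[P]_(w in A) \int[leb]_(x in `[q, t + S])
    (l 0 (X x w) * V 0 (X x w) * \1_(confined X N x) w)| <= C * (t + S - q).
  apply: le_Rintegral_cst => //.
  - by apply/measurable_EFinP; exact: (measurable_int _ i3).
  - by rewrite mulr_ge0// subr_ge0 ltW.
  move=> w _; have -> : t + S - q = fine (leb `[q, t + S]) by rewrite lebesgue_itvcc// ltW.
  apply: Rintegral_bound => //; first exact: lebesgue_itvcc_lty.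
  apply: (@measurable_comp _ _ _ _ _ _ (strip q (t + S)) (fun qw : LR * Omega =>
    l 0 (X qw.1 qw.2) * V 0 (X qw.1 qw.2) * \1_(confined X N qw.1) qw.2) _
    (fun x : LR => (x, w))).
  - exact: mstrip.
  - by move=> _ [x xq <-].
  - by apply: measurable_funM; [apply: measurable_funM; [exact: ml|exact: mV]|exact: mchi].
  - exact: measurable_funTS (pair2_measurable w).
have : C * (t + S - q) <= e / 2.
  have h1 : t + S - q < e / 2 / (C + 1) by rewrite ltrBlDr -ltrBlDl.
  have h2 : (t + S - q) * (C + 1) <= e / 2 by rewrite -ler_pdivlMr// ltW.
  apply: le_trans h2; rewrite mulrC ler_pM2l ?subr_gt0//; lra.
move: (\int[P]_(w in A) \int[leb]_(x in `[q, t + S])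
    (l 0 (X x w) * V 0 (X x w) * \1_(confined X N x) w))
  (\int[P]_(w in A) V 0 (X q w)) (\int[P]_(w in A) V 0 (X (t + S) w)) => J a b h1 h2 h3.
have -> : b - a = (b - a - J) + J by ring.
apply: le_trans (ler_normD _ _) _; lra.
Unshelve. all: by end_near. Qed.

Lemma affine_transform_identity A : Fil t A ->
  \int[P]_(w in A) V S (X t w) = \int[P]_(w in A) V 0 (X (t + S) w).
Proof.
move=> tA; have mA := filM tA; have z0 : 0 <= (0 : R) <= S by rewrite lexx ltW.
apply: (eq_of_integrals (h1 := fun b => \int[P]_(w in A) V b (X t w))
  (h2 := fun q => \int[P]_(w in A) V 0 (X q w)) S0).
- have mnu h : continuous h -> measurable_fun setT (fun w => pair h (X t w)).
    by move=> ch; exact: (process_measurable fil adapt t0 ch).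
  apply: (integrable_itv_Rintegral P (F := fun xw : LR * Omega => V xw.1 (X t xw.2)) (C := 1) mA).
    exact: (flow_exp_measurable Kcpt S0 cp ri pE fi (lexx S) measurableT mnu).
  by move=> b w bS /=; have /andP[V0 V1] := V01 (X t w) bS; rewrite ger0_norm.
- apply: (integrable_itv_Rintegral P (F := fun xw : LR * Omega => V 0 (X xw.1 xw.2)) (C := 1) mA).
    exact: mV.
  by move=> q w _ /=; have /andP[V0 V1] := V01 (X q w) z0; rewrite ger0_norm.
- by move=> s sS; exact: integrals_eq.
- exact: left_b.
- exact: left_q.
Qed.

End affine_process.

Theorem theorem6p6 (R : realType) (K : pseudoPMetricType R) (Delta : K)
  (D : set (K -> R)) (L : (Mplus K -> R) -> (Mplus K -> R))
  (F : (K -> R) -> R) (Rop : (K -> R) -> (K -> R))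
  (d : measure_display) (Omega : measurableType d) (P : probability Omega R)
  (Fil : R -> set (set Omega)) (X : R -> Omega -> Mplus K)
  (g : K -> R) (T : R) (psi : R -> K -> R) :
  compact_metric_space K ->
  admissible_D D ->
  linear_operator D L ->
  affine_type Delta D L F Rop ->
  affine_formula_on_MplusEDelta D L F Rop ->
  filtration Fil ->
  MP_solution P Fil D L X ->
  Dminus D g ->
  (forall t, 0 <= t <= T -> Dminus D (psi t)) ->
  psi 0 = g ->
  (forall (nu : Mplus K) t, 0 < t <= T ->
     lebesgue_measure.-integrable `[0, t] (fun s => (pair (Rop (psi s)) nu)%:E)
     /\ pair (psi t) nu
        = pair g nu + Rintegral lebesgue_measure `[0, t]
                        (fun s => pair (Rop (psi s)) nu)) ->
  lebesgue_measure.-integrable `[0, T] (fun s => (F (psi s))%:E) ->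
  (forall t, 0 <= t <= T ->
     Rintegral lebesgue_measure `[0, t] (fun s => F (psi s)) <= 0) ->
  forall t, 0 <= t <= T ->
    is_cond_exp P (Fil t)
      (fun w => expR (pair g (X T w)))
      (fun w => expR (Rintegral lebesgue_measure `[0, T - t] (fun s => F (psi s))
                      + pair (psi (T - t)) (X t w))).
Proof.
move=> [_ Kcpt] [DC _ _ _] _ [RopC _] affE fil [cad adapt _ mp] [Dg g0] Dpsi psi0 psiE Fi phi0 t tT.
have /andP[t0 tT'] := tT; set S := T - t.
have S0 : 0 <= S by rewrite subr_ge0.
have ST : S <= T by rewrite /S lerBlDr lerDl.
have SS : 0 <= S <= S by rewrite S0 lexx.
have TE : t + S = T by rewrite /S addrC subrK.
have T0 : 0 <= T by exact: le_trans tT'.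
have inT b : 0 <= b <= S -> 0 <= b <= T by move=> /andP[b0 b1]; rewrite b0 (le_trans b1).
have cp b : 0 <= b <= S -> continuous (psi b).
  by move=> /inT/Dpsi[Db _]; exact: (DC _ Db).
have cr b : 0 <= b <= S -> continuous (Rop (psi b)).
  by move=> /inT/Dpsi[Db _]; exact: (RopC _ Db).
have p0 b x : 0 <= b <= S -> psi b x <= 0 by move=> /inT/Dpsi[_]; exact.
have phiS b : 0 <= b <= S -> \int[lebesgue_measure]_(s in `[0, b]) F (psi s) <= 0.
  by move=> /inT; exact: phi0.
have cg : continuous g by exact: (DC _ Dg).
pose c := \int[lebesgue_measure]_(s in `[0, S]) F (psi s).
pose Y w := expR (pair g (X T w)).
pose Z w := expR (c + pair (psi S) (X t w)).
have expm (a : R) : measurable_fun setT (fun y : R => expR (a + y)).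
  by apply: measurableT_comp; [exact: measurable_expR|exact: measurable_funD].
have ZW : measurable_wrt (Fil t) Z.
  move=> B mB; have mB' : measurable ((fun y : R => expR (c + y)) @^-1` B).
    by rewrite -[X in measurable X]setTI; exact: expm.
  exact: (adapt t t0 _ (cp _ SS) _ mB').
have mZ : measurable_fun setT Z.
  by move=> _ B mB; rewrite setTI; case: fil => _ [fm _]; apply: (fm t); exact: ZW.
have mY : measurable_fun setT Y.
  apply: measurableT_comp; first exact: measurable_expR.
  exact: (process_measurable fil adapt T0 cg).
have expR_le1 (x : R) : x <= 0 -> `|expR x| <= 1.
  by move=> x0; rewrite ger0_norm ?expR_ge0// -expR0 ler_expR.
have YI A : measurable A -> P.-integrable A (EFin \o Y).
  move=> mA; apply: (@bounded_integrableR _ _ _ P A mA (probability_lty P mA) _ 1).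
    exact: measurable_funTS mY.
  by move=> w _; apply: expR_le1; exact: pair_le0.
have ZI A : measurable A -> P.-integrable A (EFin \o Z).
  move=> mA; apply: (@bounded_integrableR _ _ _ P A mA (probability_lty P mA) _ 1).
    exact: measurable_funTS mZ.
  move=> w _; apply: expR_le1; rewrite -[leRHS]addr0 lerD//; first exact: phiS.
  by apply: pair_le0 => //; [exact: cp|move=> x; exact: p0].
have key A : Fil t A -> \int[P]_(w in A) Y w = \int[P]_(w in A) Z w.
  (* When [t = T] both sides reduce to [exp <g, X_T>]; the triangle argument needs an interval of
     positive length. *)
  move=> tA; move: (S0); rewrite le_eqVlt => /predU1P[Se|Sp].
    have tE : t = T by rewrite -TE -Se addr0.
    apply: eq_Rintegral => w _.
    by rewrite /Y /Z /c -Se set_itv1 Rintegral_set1 add0r psi0 tE.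
  have SpT : 0 < S <= T by rewrite Sp.
  have ri nu : lebesgue_measure.-integrable `[0, S] (EFin \o (fun b => pair (Rop (psi b)) nu)).
    by have [h _] := psiE nu S SpT; exact: h.
  have pE nu b : 0 <= b <= S -> pair (psi b) nu = pair (psi 0) nu +
      \int[lebesgue_measure]_(x in `[0, b]) pair (Rop (psi x)) nu.
    move=> /inT/andP[]; rewrite le_eqVlt => /predU1P[<- _|b0 bT].
      by rewrite set_itv1 Rintegral_set1 addr0.
    have b0T : 0 < b <= T by rewrite b0.
    by have [_ ->] := psiE nu b b0T; rewrite psi0.
  have fi : lebesgue_measure.-integrable `[0, S] (EFin \o (fun b => F (psi b))).
    by apply: integrableS Fi => //; apply: subset_itvl; rewrite bnd_simp.
  pose f b := F (psi b); pose r b := Rop (psi b).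
  (* The solution may charge the added point, so the affine formula is used on all of [Mplus K], as
     an equality of functions. *)
  have LE b : 0 <= b <= S ->
      L (expf (psi b)) = (fun nu => flow_rate f r b nu * expf (psi b) nu).
    by move=> /inT bT; apply/funext => nu; exact: affE (Dpsi _ bT) nu.
  have dom b : 0 <= b <= S -> domL D (expf (psi b)).
    by move=> /inT bT; right; exists (psi b) => //; exact: Dpsi.
  have mpi b w u : 0 <= b <= S -> 0 <= u -> lebesgue_measure.-integrable `[0, u]
      (EFin \o (fun q => flow_rate f r b (X q w) * expf (psi b) (X q w))).
    by move=> bS u0; have [h _] := mp _ (dom b bS); have := h w u u0; rewrite LE.
  have mpm b : 0 <= b <= S -> local_martingale P Fil (fun u w =>
      expf (psi b) (X u w) - expf (psi b) (X 0 w) -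
      \int[lebesgue_measure]_(q in `[0, u]) (flow_rate f r b (X q w) * expf (psi b) (X q w))).
    by move=> bS; have [_ h] := mp _ (dom b bS); rewrite LE in h.
  have id := affine_transform_identity Kcpt (f := f) (r := r) Sp cp cr p0 ri pE fi phiS t0
    fil cad adapt mpi mpm tA.
  transitivity (\int[P]_(w in A) flow_exp f psi 0 (X (t + S) w)); last exact/esym/id.
  apply: eq_Rintegral => w _.
  by rewrite /Y /flow_exp set_itv1 Rintegral_set1 add0r psi0 TE.
split; [exact: YI|exact: ZW|exact: ZI|move=> A tA].
have mA : measurable A by case: fil => _ [fm _]; exact: (fm t).
(* [is_cond_exp] compares extended-real integrals; both are finite, so the equality of their real
   values suffices. *)
have F1 := integrable_fin_num mA (YI A mA); have F2 := integrable_fin_num mA (ZI A mA).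
transitivity ((\int[P]_(w in A) Y w)%:E); first by rewrite -[LHS](fineK F1).
by rewrite (key A tA) -[RHS](fineK F2).
Qed.
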